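(* Let $(M,\mathcal{T},I)$ be a weighted closed triangulated surface with $I\ge 0$, with Euclidean background geometry. Consider the Euclidean combinatorial Ricci flow in $\Omega$, with initial value $r(0)\in\Omega$, $$\frac{dg_i}{dt}=(R_{av}-R_i)g_i,\qquad g_i=r_i^2,\quad R_{av}=\frac{2\pi\chi(M)}{\|r\|_2^2}.\qquad (\ast)$$ (1) Along $(\ast)$ the curvature $R$ evolves according to $$\frac{dR_i}{dt}=\Delta R_i+R_i(R_i-R_{av}),$$ where, with $u_i=\ln r_i^2$, the Laplace operator is, for $f\in C(V)$, $$\Delta f_i=\frac{1}{r_i^2}\sum_{j=1}^N\Big(-\frac{\partial K_i}{\partial u_j}\Big)f_j=\frac{1}{r_i^2}\sum_{j\sim i}\Big(-\frac{\partial K_i}{\partial u_j}\Big)(f_j-f_i).$$ (2) If the solution of $(\ast)$ stays in $\Omega$ and converges to some $r^*\in\Omega$, then there exists a constant $R$-curvature metric in $\Omega$, and $r^*$ is such a metric. (3) Suppose $\chi(M)\le 0$ and there exists a metric $r^*\in\Omega$ with constant $R$-curvature, where $r^*$ is normalized so that $\|r^*\|_2=\|r(0)\|_2$. Then the solution of $(\ast)$ develops no essential singularities in finite time or at time infinity. Furthermore, if the solution of $(\ast)$ develops no removable singularities in finite time, then it exists for all time, converges exponentially fast to $r^*$, and does not develop removable singularities at time infinity. (4) Suppose $\chi(M)\le 0$ and there exists a metric $r^*\in\Omega$ with constant $R$-curvature. Then any solution of the extended combinatorial Ricci flow on $\mathbb{R}^N_{>0}$, $$\frac{dg_i}{dt}=(R_{av}-\widetilde{R}_i)g_i,\qquad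 g_i=r_i^2,$$ with initial value satisfying $\|r(0)\|_2=\|r^*\|_2$, exists for all time and converges exponentially fast to $r^*$.
   Context: $M$ is a closed surface with a triangulation $\mathcal{T}=\{V,E,F\}$ (vertices, edges, faces), $V=\{1,\dots,N\}$; $i\sim j$ means $\{ij\}\in E$; $C(V)$ is the set of functions $V\to\mathbb{R}$. A weight is a function $I:E\to[0,+\infty)$ (written $I\ge0$), called the inversive distance. $\chi(M)$ is the Euler number and $\|r\|_2^2=\sum_{i=1}^N r_i^2$. For $r\in\mathbb{R}^N_{>0}$ the Euclidean length of an edge $\{ij\}$ is $l_{ij}=\sqrt{r_i^2+r_j^2+2r_ir_jI_{ij}}$. The admissible space is $\Omega=\{r\in\mathbb{R}^N_{>0}: l_{ij}<l_{ik}+l_{kj},\ l_{ik}<l_{ij}+l_{jk},\ l_{jk}<l_{ji}+l_{ik}\ \text{for all faces }\triangle ijk\in F\}$; its elements are the Euclidean inversive distance circle packing metrics. For $r\in\Omega$, $\theta_i^{jk}$ is the inner angle at $i$ of the Euclidean triangle with edge lengths $l_{ij},l_{jk},l_{ik}$, $K_i=2\pi-\sum_{\triangle ijk\in F}\theta_i^{jk}$ (sum over faces having $i$ as a vertex), and the $R$-curvature is $R_i=K_i/r_i^2$. A constant $R$-curvature metric is an $r\in\Omega$ with $R_i(r)$ independent of $i$ (then necessarily $R_i=R_{av}$). Extended curvature: for any $r\in\mathbb{R}^N_{>0}$ and face $\triangle ijk$, $\widetilde\theta_i^{jk}=\theta_i^{jk}$ if the three strict triangle inequalities hold for $l_{ij},l_{jk},l_{ik}$;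 $\widetilde\theta_i^{jk}=\pi$ if $l_{jk}\ge l_{ik}+l_{ij}$; $\widetilde\theta_i^{jk}=0$ if $l_{ik}\ge l_{jk}+l_{ij}$ or $l_{ij}\ge l_{jk}+l_{ik}$. Set $\widetilde K_i=2\pi-\sum_{\triangle ijk\in F}\widetilde\theta_i^{jk}$ and $\widetilde R_i=\widetilde K_i/r_i^2$ (these are continuous functions on $\mathbb{R}^N_{>0}$; solutions of the extended flow may be non-unique). Singularities: suppose the solution of the flow $(\ast)$ exists on $[0,\tau)$, $\tau\le+\infty$. It develops an essential singularity at time $\tau$ if there is $i\in V$ and a sequence $t_n\to\tau$ with $r_i(t_n)\to 0$. It develops a removable singularity at $\tau$ if there is a sequence $t_n\to\tau$ such that $r(t_n)$ stays in a compact subset of $\mathbb{R}^N_{>0}$ and there is a face $\triangle ijk\in F$ whose triangle inequalities degenerate along $t_n$ (i.e. one of the quantities $l_{ij}+l_{ik}-l_{jk}$, $l_{ij}+l_{jk}-l_{ik}$, $l_{ik}+l_{jk}-l_{ij}$ tends to $0$). ''In finite time'' means $\tau<+\infty$, ''at time infinity'' means $\tau=+\infty$. ''Converges exponentially fast to $r^*$'' means $|r(t)-r^*|\le Ce^{-\lambda t}$ for all $t\ge 0$, for some constants $C,\lambda>0$. *)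

(* Defs.v *)
From HB Require Import structures.
From mathcomp Require Import all_boot all_order all_algebra.
From mathcomp Require Import all_classical all_reals all_analysis.

Set Implicit Arguments.
Unset Strict Implicit.
Unset Printing Implicit Defensive.

Import Order.TTheory GRing.Theory Num.Theory.
Import numFieldNormedType.Exports.

Local Open Scope classical_set_scope.
Local Open Scope ring_scope.

(* A triangulated connected closed surface on the vertex set 'I_N, given as an
   abstract simplicial complex: the underlying space is a closed surface exactly
   when the link of every vertex is a (combinatorial) circle.  In [link_cycle]
   the cyclic sequence [s] lists the link of [v]; for j outside [s] both
   [next s j] and [prev s j] are j itself, hence the guard [j \in s]. *)
Record triangulated_surface (N : nat) := TriangulatedSurface {
  edges : {set {set 'I_N}};
  faces : {set {set 'I_N}};
  card_edge : forall e, e \in edges -> #|e| = 2%N;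
  card_face : forall f, f \in faces -> #|f| = 3%N;
  face_edge : forall f e : {set 'I_N},
    f \in faces -> e \subset f -> #|e| = 2%N -> e \in edges;
  link_cycle : forall v : 'I_N, exists s : seq 'I_N,
    [/\ uniq s, (2 < size s)%N,
        forall j, (j \in s) = ([set v; j]%SET \in edges) &
        forall j k, ([set v; j; k]%SET \in faces)
                    = (j \in s) && ((k == next s j) || (k == prev s j))];
  vertex_nonempty : (0 < N)%N;
  surface_connected :
    forall i j : 'I_N, connect (fun a b => [set a; b]%SET \in edges) i j
}.

Definition euler_char (N : nat) (T : triangulated_surface N) : int :=
  N%:Z - #|edges T|%:Z + #|faces T|%:Z.

Section InversiveDistance.
Variables (R : realType) (N : nat) (T : triangulated_surface N).
Variable I : {set 'I_N} -> R. (* only the values on [edges T] matter *)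
Implicit Types (r u : 'rV[R]_N) (i j k : 'I_N).

Definition weight_nonneg : Prop := forall e, e \in edges T -> 0 <= I e.

Definition norm2 r : R := Num.sqrt (\sum_i r 0 i ^+ 2).

Definition positive_radii : set 'rV[R]_N := [set r | forall i, 0 < r 0 i].

Definition elen r i j : R :=
  Num.sqrt (r 0 i ^+ 2 + r 0 j ^+ 2
            + 2 * r 0 i * r 0 j * I [set i; j]%SET).

(* i, j, k range over all orderings of each face, so that the single inequality
   below yields the three triangle inequalities. *)
Definition admissible : set 'rV[R]_N :=
  [set r | positive_radii r /\
     forall i j k, [set i; j; k]%SET \in faces T ->
       elen r i j < elen r i k + elen r k j].

(* Inner angle at i of the Euclidean triangle ijk (law of cosines). *)
Definition angle r i j k : R :=
  acos ((elen r i j ^+ 2 + elen r i k ^+ 2 - elen r j k ^+ 2)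
        / (2 * elen r i j * elen r i k)).

Definition ext_angle r i j k : R :=
  if elen r i k + elen r i j <= elen r j k then pi
  else if (elen r j k + elen r i j <= elen r i k)
       || (elen r j k + elen r i k <= elen r i j) then 0
  else angle r i j k.

(* Angles are symmetric in the last two vertices; the condition j < k makes
   each face containing i occur exactly once. *)
Definition vertex_curv (th : 'I_N -> 'I_N -> 'I_N -> R) i : R :=
  2 * pi - \sum_(p : 'I_N * 'I_N | (p.1 < p.2)%N &&
                   ([set i; p.1; p.2]%SET \in faces T)) th i p.1 p.2.

Definition Kcurv r i : R := vertex_curv (angle r) i.
Definition Rcurv r i : R := Kcurv r i / r 0 i ^+ 2.

Definition ext_Kcurv r i : R := vertex_curv (ext_angle r) i.
Definition ext_Rcurv r i : R := ext_Kcurv r i / r 0 i ^+ 2.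

Definition Rav r : R := 2 * pi * (euler_char T)%:~R / norm2 r ^+ 2.

Definition constant_R_metric r : Prop :=
  admissible r /\ exists c : R, forall i, Rcurv r i = c.

(* The coordinates u_i = ln (r_i ^ 2) and their inverse. *)
Definition log_coord r : 'rV[R]_N := \row_i ln (r 0 i ^+ 2).
Definition radii u : 'rV[R]_N := \row_i expR (u 0 i / 2).
Definition Kcurv_log i u : R := Kcurv (radii u) i.

Definition dKdu r i j : R := 'D_(delta_mx 0 j) (Kcurv_log i) (log_coord r).

Definition laplacian r (f : 'I_N -> R) i : R :=
  (r 0 i ^+ 2)^-1 * \sum_j (- dKdu r i j) * f j.

Definition time_domain (tau : \bar R) : set R :=
  [set t | 0 <= t /\ (t%:E < tau)%E].

(* Derivative relative to A; at t = 0 in [time_domain tau] it is the right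
   derivative, at interior points the ordinary one. *)
Definition has_deriv_within (A : set R) (f : R -> R) (t l : R) : Prop :=
  (f s - f t) / (s - t) @[s --> within A t^'] --> l.

(* Solution on [0, tau), staying in X, of g_i' = (R_av - C_i) g_i with
   g_i = r_i ^ 2.  Values of r outside [0, tau) are irrelevant. *)
Definition flow_solution (X : set 'rV[R]_N) (C : 'rV[R]_N -> 'I_N -> R)
    (tau : \bar R) (r : R -> 'rV[R]_N) : Prop :=
  (0 < tau)%E /\
  forall t, time_domain tau t ->
    X (r t) /\
    forall i, has_deriv_within (time_domain tau) (fun s => r s 0 i ^+ 2) t
                ((Rav (r t) - C (r t) i) * r t 0 i ^+ 2).

Definition maximal_flow_solution (X : set 'rV[R]_N)
    (C : 'rV[R]_N -> 'I_N -> R) (tau : \bar R) (r : R -> 'rV[R]_N) : Prop :=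
  flow_solution X C tau r /\
  ~ exists (tau' : \bar R) (r' : R -> 'rV[R]_N),
      [/\ (tau < tau')%E, flow_solution X C tau' r' &
          forall t, time_domain tau t -> r' t = r t].

Definition ricci_flow := flow_solution admissible Rcurv.
Definition maximal_ricci_flow := maximal_flow_solution admissible Rcurv.
Definition maximal_ext_ricci_flow :=
  maximal_flow_solution positive_radii ext_Rcurv.

Definition times_to (tau : \bar R) (t : nat -> R) : Prop :=
  (forall n, time_domain tau (t n)) /\ (t n)%:E @[n --> \oo] --> tau.

Definition essential_singularity (tau : \bar R) (r : R -> 'rV[R]_N) : Prop :=
  exists (i : 'I_N) (t : nat -> R),
    times_to tau t /\ r (t n) 0 i @[n --> \oo] --> (0 : R).

Definition removable_singularity (tau : \bar R) (r : R -> 'rV[R]_N) : Prop :=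
  exists t : nat -> R,
    [/\ times_to tau t,
        exists Q : set 'rV[R]_N,
          [/\ compact Q, Q `<=` positive_radii & forall n, Q (r (t n))] &
        exists i j k : 'I_N, [set i; j; k]%SET \in faces T /\
          elen (r (t n)) i j + elen (r (t n)) i k - elen (r (t n)) j k
            @[n --> \oo] --> (0 : R)].

Definition converges_exp (r : R -> 'rV[R]_N) (rs : 'rV[R]_N) : Prop :=
  exists C lam : R, [/\ 0 < C, 0 < lam &
    forall t, 0 <= t -> norm2 (r t - rs) <= C * expR (- lam * t)].

End InversiveDistance.

(* Main.v *)
(* In the coordinates u_i = ln r_i^2 the flow reads u_i' = R_av - K_i e^(-u_i), and
   by Gauss-Bonnet the total mass sum_i e^(u_i) = |r|^2 is conserved, so that R_av
   is a constant c <= 0 when chi <= 0.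

   On a single triangle the matrix of the derivatives of the angles in u is negative
   semidefinite with kernel (1, 1, 1) (Guo).  An extended angle is constant where the
   triangle degenerates, so pairing the extended angles with a direction d gives a
   function that decreases along every line of direction d; hence the extended
   curvature map is monotone, strongly so (modulo constants) at a nondegenerate point.

   Compactness: if the radii of a proper set A of vertices are much smaller than the
   others, the total extended curvature of A is close to a limit which is strictly
   smaller than its value at the constant curvature metric, hence negative and
   bounded away from 0; the mass of A then grows.  Suitable thresholds
   for the masses of all sets A are thus never crossed, and all radii stay bounded below.

   Convergence: with g = r^2 the relative entropy L = sum g (u - u0) - g + g0, where r0, u0, g0, K0
   belong to the constant curvature metric, satisfies
   L' = - sum (K - K0) (u - u0) + c sum (g - g0) (u - u0) <= - lambda L by strong
   monotonicity and a Poincare inequality on the connected edge graph, while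
   L >= |r - r0|^2.

   A solution that ceases to exist at a finite time has a positive limit there, from
   which Peano's theorem continues it. *)

Require Import Defs.
From HB Require Import structures.
From mathcomp Require Import all_boot all_order all_algebra.
From mathcomp Require Import all_classical all_reals all_analysis.
From mathcomp Require Import ring lra zify.

Import Order.TTheory GRing.Theory Num.Theory.
Import numFieldNormedType.Exports.

Set Implicit Arguments.
Unset Strict Implicit.

Local Open Scope classical_set_scope.
Local Open Scope ring_scope.

(** * One-sided derivatives *)

(** The obstacle is that a segment in u between two metrics may leave the region of nondegenerate
    triangles and re-enter it, so the negative definite Jacobian cannot simply be integrated along
    it. Monotonicity survives because in a degenerate triangle every extended angle is 0 or pi: off
    the good region the pairing takes finitely many values, and a continuous function cannot climb
    through any other level. Strictness is extracted only from the initial piece of the segment,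
    near the constant curvature metric.

    A solution in Omega also solves the extended flow while it lasts, so one set of estimates serves
    both. The flows differ only in the endpoints that allow continuation: every positive limit for
    the extended flow, only limits in Omega for the other, where a limit outside Omega exhibits a
    removable singularity.

    The sign of chi enters in the barrier, through the total curvature of A at the constant
    curvature metric, and in the entropy, where the term with c has the right sign. *)

Section OneSidedDerivatives.
Variable R : realType.
Implicit Types (A : set R) (f g : R -> R) (t l a b : R).

(** The first-order expansion avoids the quotient and no longer excludes s = t, which makes
    restriction and gluing of domains immediate. *)
Lemma has_deriv_withinP A f t l : has_deriv_within A f t l <->
  forall e, 0 < e -> exists2 d, 0 < d &
    forall s, A s -> `|s - t| < d -> `|f s - f t - l * (s - t)| <= e * `|s - t|.
Proof.
split=> [/cvgrPdist_lt H e e0|H].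
  have /nbhs_normP[d /= d0 Hd] := H _ e0.
  exists d => // s As st; have [->|nst] := eqVneq s t.
    by rewrite !subrr mulr0 subrr normr0 mulr0.
  have hs : ball_ Num.norm t d s by rewrite /ball_/= distrC.
  move: (Hd s hs nst As) => /= /ltW.
  have s0 : `|s - t| != 0 by rewrite normr_eq0 subr_eq0.
  have s1 : s - t != 0 by rewrite subr_eq0.
  rewrite distrC -(ler_pM2r (x := `|s - t|)); last by rewrite lt_neqAle eq_sym s0 /=.
  by rewrite -normrM mulrBl mulfVK.
apply/cvgrPdist_le => e e0; have [d d0 Hd] := H _ e0.
apply/nbhs_normP; exists d => //= s; rewrite /ball_/= distrC => st nst As.
have s0 : `|s - t| != 0 by rewrite normr_eq0 subr_eq0.
have s1 : s - t != 0 by rewrite subr_eq0.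
rewrite distrC -(ler_pM2r (x := `|s - t|)); last by rewrite lt_neqAle eq_sym s0 /=.
by rewrite -normrM mulrBl mulfVK //; exact: Hd.
Qed.

Lemma has_deriv_within_cvg A f t l : has_deriv_within A f t l ->
  f s @[s --> within A t^'] --> f t.
Proof.
move=> H.
have Ht : s @[s --> within A t^'] --> t.
  by apply/cvgrPdist_lt => e e0; apply/nbhs_normP; exists e.
have /cvgrPdist_lt H2 : ((f s - f t) / (s - t)) * (s - t) + f t
     @[s --> within A t^'] --> l * (t - t) + f t.
  apply: cvgD; last exact: cvg_cst.
  by apply: cvgM => //; apply: cvgB => //; exact: cvg_cst.
rewrite subrr mulr0 add0r in H2; apply/cvgrPdist_lt => e e0.
have /nbhs_normP[d /= d0 Hd] := H2 _ e0; apply/nbhs_normP; exists d => //= s bs nst As.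
have := Hd s bs nst As; rewrite /= divfK ?subrK //.
by rewrite subr_eq0.
Qed.

Lemma has_deriv_within_cst A (c t : R) : has_deriv_within A (fun=> c) t 0.
Proof.
by apply/has_deriv_withinP => e e0; exists 1 => // s _ _; rewrite subrr mul0r subrr normr0 mulr_ge0 // ltW.
Qed.

Lemma has_deriv_within_id A t : has_deriv_within A id t 1.
Proof.
by apply/has_deriv_withinP => e e0; exists 1 => // s _ _; rewrite mul1r subrr normr0 mulr_ge0 // ltW.
Qed.

Lemma has_deriv_withinD A f g t a b : has_deriv_within A f t a ->
  has_deriv_within A g t b -> has_deriv_within A (fun s => f s + g s) t (a + b).
Proof.
move=> Hf Hg; rewrite /has_deriv_within.
rewrite (_ : (fun s => _) = (fun s => (f s - f t) / (s - t) + (g s - g t) / (s - t))).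
  exact: cvgD.
by apply/funext => s; rewrite -mulrDl; congr (_ / _); ring.
Qed.

Lemma has_deriv_withinM A f g t a b : has_deriv_within A f t a ->
  has_deriv_within A g t b ->
  has_deriv_within A (fun s => f s * g s) t (a * g t + f t * b).
Proof.
move=> Hf Hg; rewrite /has_deriv_within.
rewrite (_ : (fun s => _) = (fun s => (f s - f t) / (s - t) * g t + f s * ((g s - g t) / (s - t)))).
  apply: cvgD; apply: cvgM => //; first exact: cvg_cst.
  exact: has_deriv_within_cvg Hf.
by apply/funext => s; set d := (s - t)^-1; ring.
Qed.

Lemma has_deriv_withinZ A f t a c : has_deriv_within A f t a ->
  has_deriv_within A (fun s => c * f s) t (c * a).
Proof.
move=> Hf; have := has_deriv_withinM (has_deriv_within_cst A c t) Hf.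
by rewrite mul0r add0r.
Qed.

Lemma has_deriv_within_sum A (J : Type) (r : seq J) (P : pred J) (f : J -> R -> R) t (a : J -> R) :
  (forall j, P j -> has_deriv_within A (f j) t (a j)) ->
  has_deriv_within A (fun s => \sum_(j <- r | P j) f j s) t (\sum_(j <- r | P j) a j).
Proof.
move=> H; rewrite (_ : (fun s => _) = \sum_(j <- r | P j) f j); last first.
  by apply/funext => s; rewrite fct_sumE.
apply: (big_ind2 (fun f a => has_deriv_within A f t a)) => //.
- exact: has_deriv_within_cst.
- by move=> f1 a1 f2 a2; exact: has_deriv_withinD.
Qed.

Lemma is_derive_has_deriv_within f t l : is_derive t 1 f l -> has_deriv_within setT f t l.
Proof.
case=> df <-; apply/has_deriv_withinP => e e0.
have := @derivable_nbhs _ _ _ f t 1.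
have /cvgrPdist_lt /(_ _ e0) /nbhs_normP[d /= d0 Hd] : h^-1 *: (f (h *: 1 + t) - f t) @[h --> 0^'] --> 'D_1 f t.
  exact: df.
move=> _; exists d => // s _ st; have [->|nst] := eqVneq s t.
  by rewrite !subrr mulr0 subrr normr0 mulr0.
have nst0 : s - t != 0 by rewrite subr_eq0.
have hs : ball_ Num.norm (0 : R) d (s - t) by rewrite /ball_/= sub0r normrN.
have := Hd _ hs nst0; rewrite [X in f X](_ : _ = s); last first.
  by rewrite /GRing.scale/= mulr1 subrK.
rewrite /GRing.scale/= distrC => /ltW.
have s0 : `|s - t| != 0 by rewrite normr_eq0.
rewrite -(ler_pM2r (x := `|s - t|)); last by rewrite lt_neqAle eq_sym s0 /=.
by rewrite -normrM mulrBl mulrAC mulVf // mul1r.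
Qed.

Lemma has_deriv_within_is_derive A f t l : nbhs t A ->
  has_deriv_within A f t l -> is_derive t 1 f l.
Proof.
move=> nA /has_deriv_withinP H.
have Hc : h^-1 *: (f (h *: 1 + t) - f t) @[h --> (0:R)^'] --> l.
  apply/cvgrPdist_le => e e0; have [d d0 Hd] := H _ e0.
  have /nbhs_normP[d' /= d'0 Hd'] := nA.
  apply/nbhs_normP; exists (Num.min d d') => /=; first by rewrite lt_min d0.
  move=> h; rewrite /ball_/= sub0r normrN lt_min => /andP[hd hd'] h0.
  have As : A (h + t) by apply: Hd'; rewrite /ball_/= opprD addrCA subrr addr0 normrN.
  have := Hd (h + t) As; rewrite addrK => /(_ hd).
  have s0 : `|h| != 0 by rewrite normr_eq0.
  rewrite distrC /GRing.scale/= mulr1 => Hh.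
  rewrite -(ler_pM2r (x := `|h|)); last by rewrite lt_neqAle eq_sym s0 /=.
  by rewrite -normrM mulrBl mulrAC mulVf // mul1r.
by split; [apply/cvg_ex; exists l|apply/cvg_lim].
Qed.

Lemma has_deriv_within_sub A B f t l : B `<=` A ->
  has_deriv_within A f t l -> has_deriv_within B f t l.
Proof.
move=> BA /has_deriv_withinP H; apply/has_deriv_withinP => e /H[d d0 Hd].
by exists d => // s /BA; exact: Hd.
Qed.

Lemma has_deriv_within_comp A f t l (phi : R -> R) m : has_deriv_within A f t l ->
  is_derive (f t) 1 phi m -> has_deriv_within A (fun s => phi (f s)) t (m * l).
Proof.
move=> Hf /is_derive_has_deriv_within /has_deriv_withinP Hp.
have Fc := has_deriv_within_cvg Hf.
(* Caratheodory's slope function: f may return to the value f t at points s other than t, where the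
   quotient in y would be undefined. *)
pose q y := if y == f t then m else (phi y - phi (f t)) / (y - f t).
have qc : q (f s) @[s --> within A t^'] --> m.
  apply/cvgrPdist_le => e e0; have [d d0 Hd] := Hp _ e0.
  move/cvgrPdist_lt : Fc => /(_ _ d0); apply: filterS => s; rewrite distrC => sd.
  rewrite /q; case: eqVneq => [_|fs]; first by rewrite subrr normr0 ltW.
  have := Hd _ I sd.
  have s1 : f s - f t != 0 by rewrite subr_eq0.
  have s0 : 0 < `|f s - f t| by rewrite normr_gt0.
  by move=> H1; rewrite distrC -(ler_pM2r s0) -normrM mulrBl mulfVK.
rewrite /has_deriv_within (_ : (fun s => _) = (fun s => q (f s) * ((f s - f t) / (s - t)))).
  exact: cvgM.
apply/funext => s; rewrite /q; case: eqVneq => [->|fs]; first by rewrite !subrr !mul0r mulr0.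
by rewrite mulrA divfK // subr_eq0.
Qed.

Lemma has_deriv_within_eq A f g t l : (forall s, A s -> f s = g s) -> A t ->
  has_deriv_within A f t l -> has_deriv_within A g t l.
Proof.
move=> fg At /has_deriv_withinP H; apply/has_deriv_withinP => e /H[d d0 Hd].
by exists d => // s As; rewrite -!fg //; exact: Hd.
Qed.

Lemma has_deriv_within_ln A f t l : 0 < f t -> has_deriv_within A f t l ->
  has_deriv_within A (fun s => ln (f s)) t (l / f t).
Proof.
by move=> f0 H; rewrite mulrC; apply: has_deriv_within_comp H (is_derive1_ln f0).
Qed.

Lemma has_deriv_within_exp A f t l : has_deriv_within A f t l ->
  has_deriv_within A (fun s => expR (f s)) t (expR (f t) * l).
Proof. by move=> H; apply: has_deriv_within_comp H (is_derive_expR _). Qed.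

(** Inside [a, b] the derivative relative to A is an ordinary one; at the endpoints it serves only
    to give continuity. *)
Lemma has_deriv_within_mvt A f (f' : R -> R) a b : a <= b ->
  (forall s, a <= s <= b -> A s) ->
  (forall s, a <= s <= b -> has_deriv_within A f s (f' s)) ->
  exists2 c, a <= c <= b & f b - f a = f' c * (b - a).
Proof.
move=> ab HA Hd.
have [||c] := @MVT_segment R f f' a b ab; last by rewrite in_itv; exists c.
- move=> x; rewrite in_itv/= => /andP[ax xb].
  apply: (@has_deriv_within_is_derive A); last by apply: Hd; rewrite !ltW.
  have /near_in_itvoo : x \in `]a, b[ by rewrite in_itv/= ax xb.
  by apply: filterS => y; rewrite in_itv/= => /andP[ay yb]; apply: HA; rewrite !ltW.
- apply/subspace_continuousP => x; rewrite /= in_itv/= => xab.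
  have /has_deriv_withinP /(_ 1 ltr01)[d d0 Hxd] := Hd _ xab.
  apply/cvgrPdist_le => e e0; apply/nbhs_normP.
  have M0 : 0 < 1 + `|f' x| by rewrite ltr_pwDl.
  exists (Num.min d (e / (1 + `|f' x|))) => /=; first by rewrite lt_min d0 divr_gt0.
  move=> s; rewrite /ball_/= distrC lt_min => /andP[sd se]; rewrite in_itv/= => sab.
  have := Hxd s (HA _ sab) sd; rewrite mul1r => H1.
  rewrite distrC (_ : f s - f x = (f s - f x - f' x * (s - x)) + f' x * (s - x)); last by rewrite subrK.
  apply: le_trans (ler_normD _ _) _.
  rewrite normrM; apply: (@le_trans _ _ (`|s - x| * (1 + `|f' x|))).
    by rewrite (mulrDr `|s - x|) mulr1 (mulrC _ `|f' x|) lerD2r.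
  by rewrite -ler_pdivlMr // ltW.
Qed.

Lemma has_deriv_within_le A f (f' : R -> R) a b m : a <= b ->
  (forall s, a <= s <= b -> A s) ->
  (forall s, a <= s <= b -> has_deriv_within A f s (f' s)) ->
  (forall s, a <= s <= b -> f' s <= m) -> f b - f a <= m * (b - a).
Proof.
move=> ab HA Hd Hm; have [c cab ->] := has_deriv_within_mvt ab HA Hd.
by rewrite ler_wpM2r ?subr_ge0 // Hm.
Qed.

Lemma has_deriv_within_dist A f (f' : R -> R) a b v m : a <= b ->
  (forall s, a <= s <= b -> A s) ->
  (forall s, a <= s <= b -> has_deriv_within A f s (f' s)) ->
  (forall s, a <= s <= b -> `|f' s - v| <= m) -> `|f b - f a - v * (b - a)| <= m * (b - a).
Proof.
move=> ab HA Hd Hm; have [c cab ->] := has_deriv_within_mvt ab HA Hd.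
by rewrite -mulrBl normrM (ger0_norm (x := b - a)) ?ler_wpM2r ?subr_ge0 // Hm.
Qed.

(** Continuity induction: the supremum of the times up to which P holds is attained by the
    closedness premise, and the openness premise pushes past it unless the goal is reached. It
    replaces arguments about a first crossing time. *)
Lemma real_induction (D : set R) (P : R -> Prop) :
  (forall s t, 0 <= s -> s <= t -> D t -> D s) ->
  (D 0 -> P 0) ->
  (forall t, 0 <= t -> D t -> (forall s, 0 <= s <= t -> P s) ->
     exists2 d, 0 < d & forall s, D s -> t < s -> s < t + d -> P s) ->
  (forall t, 0 < t -> D t -> (forall s, 0 <= s < t -> P s) -> P t) ->
  forall t, 0 <= t -> D t -> P t.
Proof.
move=> Dint P0 Popen Pclosed b b0 Db; apply: contrapT => nPb.
pose E := [set t | 0 <= t <= b /\ forall s, 0 <= s <= t -> P s].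
have E0 : E 0.
  split; first by rewrite lexx.
  by move=> s; rewrite -eq_le => /eqP <-; exact: P0 (Dint _ _ (lexx 0) b0 Db).
have supE : has_sup E by split; [exists 0|exists b => t [/andP[]]].
have s0 : 0 <= sup E by apply: sup_upper_bound.
have sb : sup E <= b by apply: ge_sup; [exists 0|move=> t [/andP[]]].
have Ds : D (sup E) by exact: Dint sb Db.
have Plt s : 0 <= s < sup E -> P s.
  move=> /andP[ss0 ss].
  have [t [_ Et] st] := sup_adherent (ltac:(rewrite subr_gt0; exact: ss) : 0 < sup E - s) supE.
  by apply: Et; rewrite ss0 ltW //; move: st; rewrite opprB addrCA subrr addr0.
have Ps : P (sup E).
  move: s0; rewrite le_eqVlt => /predU1P[<-|sgt0]; last exact: Pclosed.
  exact: P0 (Dint _ _ (lexx 0) b0 Db).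
have Ple s : 0 <= s <= sup E -> P s.
  by move=> /andP[ss0]; rewrite le_eqVlt => /predU1P[-> //|ss]; apply: Plt; rewrite ss0.
have [d d0 Hd] := Popen _ s0 Ds Ple.
have sltb : sup E < b.
  by rewrite lt_neqAle sb andbT; apply/eqP => eb; apply: nPb; rewrite -eb.
pose t := Num.min b (sup E + d / 2).
have st : sup E < t by rewrite lt_min sltb ltrDl divr_gt0.
have : E t.
  split; first by rewrite (le_trans s0 (ltW st)) /= ge_min lexx.
  move=> s /andP[ss0 sst]; have [sle|slt] := leP s (sup E); first by apply: Ple; rewrite ss0.
  apply: Hd => //.
    by apply: (Dint _ _ ss0 _ Db); rewrite (le_trans sst) // ge_min lexx.
  rewrite (le_lt_trans sst) // gt_min ltrD2l ltr_pdivrMr // ltr_pMr //.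
  by rewrite ltr1n orbT.
by move=> /(sup_upper_bound supE); rewrite leNgt st.
Qed.

End OneSidedDerivatives.

(** * Angles of Euclidean triangles *)

Section Triangles.
Variable R : realType.
Implicit Types (x y z : R).

(* The arc cosine of the argument clamped to [-1, 1]: precomposed with the law
   of cosines it is the extended angle. *)
Definition clamped_acos x : R := acos (Num.max (-1) (Num.min 1 x)).

Let clampP x : -1 <= Num.max (-1) (Num.min 1 x) <= 1.
Proof. by rewrite le_max lexx /= ge_max ge_min lexx /= andbT -subr_ge0 opprK addr_ge0. Qed.

Lemma clamped_acosE x : -1 <= x <= 1 -> clamped_acos x = acos x.
Proof. by move=> /andP[x1 x2]; rewrite /clamped_acos (min_idPr x2) (max_idPr x1). Qed.

Lemma clamped_acos_ge0 x : 0 <= clamped_acos x.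
Proof. exact: acos_ge0. Qed.

Lemma clamped_acos_lepi x : clamped_acos x <= pi.
Proof. exact: acos_lepi. Qed.

Lemma clamped_acos_le x : x <= -1 -> clamped_acos x = pi.
Proof.
move=> x1; rewrite /clamped_acos -acosN1; congr acos.
by apply/max_idPl; rewrite ge_min x1 orbT.
Qed.

Lemma clamped_acos_ge x : 1 <= x -> clamped_acos x = 0.
Proof.
move=> x1; rewrite /clamped_acos -acos1 (min_idPl x1); congr acos.
by apply/max_idPr; rewrite -subr_ge0 opprK addr_ge0.
Qed.

Lemma clamped_acos_continuous : continuous clamped_acos.
Proof.
have ac : {within `[(-1), 1], continuous (@acos R)}.
  rewrite -cospi -[X in `[_, X]]cos0; apply: (@segment_can_ge_continuous R 0 pi cos acos).
  - exact: pi_ge0.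
  - by apply: continuous_subspaceT => t; exact: continuous_cos.
  - exact: cosK.
move=> x; move/subspace_continuousP : ac => /(_ (Num.max (-1) (Num.min 1 x))).
rewrite /= in_itv/= => /(_ (clampP x)) H.
have cc : Num.max (-1) (Num.min 1 t) @[t --> x] --> Num.max (-1) (Num.min 1 x).
  apply: (@continuous_max R R (fun=> -1) (Num.min 1) x); first exact: cvg_cst.
  by apply: (@continuous_min R R (fun=> 1) id x); [exact: cvg_cst|exact: cvg_id].
have cc' : Num.max (-1) (Num.min 1 t) @[t --> x] -->
    within `[(-1), 1]%classic (nbhs (Num.max (-1) (Num.min 1 x))).
  move=> A HA; apply: (@filterS _ (nbhs x) _ _ _ _ (cc _ HA)) => t /= Ht.
  by apply: Ht; rewrite in_itv; exact: clampP.
exact: cvg_comp cc' H.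
Qed.

Lemma clamped_acos_lt x y : x < y -> -1 < y -> y < 1 -> clamped_acos y < clamped_acos x.
Proof.
move=> xy y1 y2; rewrite -ltr_cos ?in_itv/= ?clamped_acos_ge0 ?clamped_acos_lepi //.
rewrite /clamped_acos !acosK ?in_itv/= ?clampP //.
by rewrite (min_idPr (ltW y2)) (max_idPr (ltW y1)) gt_max y1 gt_min xy orbT.
Qed.

Lemma clamped_acos_gt0 x : x < 1 -> 0 < clamped_acos x.
Proof.
move=> x1; apply: acos_gt0.
by rewrite le_max lexx /= gt_max gt_min x1 orbT -subr_gt0 opprK addr_gt0.
Qed.

Lemma is_derive_clamped_acos x : -1 < x -> x < 1 ->
  is_derive x 1 clamped_acos (- (Num.sqrt (1 - x ^+ 2))^-1).
Proof.
move=> x1 x2.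
apply: (@near_eq_is_derive _ _ _ (@acos R)) => //; last by apply: is_derive1_acos; rewrite x1.
have /near_in_itvoo : x \in `](-1), 1[ by rewrite in_itv/= x1.
apply: filterS => y; rewrite in_itv/= => /andP[y1 y2].
by rewrite clamped_acosE // !ltW.
Qed.

(* In terms of the squared side lengths [x] (opposite side), [y], [z]. *)
Definition cos_law x y z := (y + z - x) / (2 * Num.sqrt y * Num.sqrt z).

(* Sixteen times the squared area (Heron). *)
Definition heron x y z := 2 * x * y + 2 * y * z + 2 * z * x - x ^+ 2 - y ^+ 2 - z ^+ 2.

Lemma cos_lawC x y z : cos_law x y z = cos_law x z y.
Proof. by rewrite /cos_law (addrC y) -!mulrA (mulrC (Num.sqrt y)). Qed.

Lemma heronC x y z : heron x y z = heron y z x.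
Proof. by rewrite /heron; ring. Qed.

Lemma cos_law_sqr x y z : 0 < y -> 0 < z ->
  1 - cos_law x y z ^+ 2 = heron x y z / (4 * y * z).
Proof.
move=> y0 z0; rewrite /cos_law expr_div_n !exprMn !sqr_sqrtr ?ltW // /heron.
by field; rewrite !gt_eqF.
Qed.

Lemma cos_law_lt1 x y z : 0 < y -> 0 < z ->
  (-1 < cos_law x y z < 1) = (0 < heron x y z).
Proof.
move=> y0 z0; rewrite -ltr_norml -(ltr_pXn2r (n := 2)) ?nnegrE // expr1n real_normK ?num_real //.
by rewrite -subr_gt0 cos_law_sqr // pmulr_lgt0 // invr_gt0 !mulr_gt0.
Qed.

Lemma sin_clamped_acos x y z : 0 < y -> 0 < z -> 0 < heron x y z ->
  sin (clamped_acos (cos_law x y z)) = Num.sqrt (heron x y z) / (2 * Num.sqrt y * Num.sqrt z).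
Proof.
move=> y0 z0 h0; have := h0; rewrite -cos_law_lt1 // => /andP[c1 c2].
have c12 : -1 <= cos_law x y z <= 1 by rewrite !ltW.
rewrite clamped_acosE // sin_acos // cos_law_sqr // sqrtrM ?ltW //; congr (_ * _).
rewrite sqrtrV ?mulr_ge0 ?ltW //; congr (_^-1).
rewrite !sqrtrM ?mulr_ge0 // ?ltW //.
by rewrite (_ : 4 = 2 ^+ 2) ?sqrtr_sqr ?ger0_norm // -natrX.
Qed.

Lemma cos_clamped_acos x y z : 0 < y -> 0 < z -> 0 < heron x y z ->
  cos (clamped_acos (cos_law x y z)) = cos_law x y z.
Proof.
move=> y0 z0; rewrite -cos_law_lt1 // => /andP[c1 c2].
by rewrite clamped_acosE ?acosK ?in_itv/= ?ltW // ?c1 ?ltW.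
Qed.

Lemma clamped_acos_lt_pi x y z : 0 < y -> 0 < z -> 0 < heron x y z ->
  0 < clamped_acos (cos_law x y z) < pi.
Proof.
move=> y0 z0; rewrite -cos_law_lt1 // => /andP[c1 c2].
by rewrite clamped_acosE ?acos_gt0 ?acos_ltpi ?ltW // ?c1 ?c2 ?ltW.
Qed.

(** The law of cosines gives cos (a + b) = cos (pi - c), but injectivity of cos needs a + b in
    [0, pi]. This follows from sin (a + b) = sin c > 0, since a + b lies below 2 pi. *)
Lemma angle_sum_nondeg x y z : 0 < x -> 0 < y -> 0 < z -> 0 < heron x y z ->
  clamped_acos (cos_law x y z) + clamped_acos (cos_law y z x) + clamped_acos (cos_law z x y) = pi.
Proof.
move=> x0 y0 z0 h0.
have h1 : 0 < heron y z x by rewrite -heronC.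
have h2 : 0 < heron z x y by rewrite -heronC.
set a := clamped_acos (cos_law x y z); set b := clamped_acos (cos_law y z x).
set c := clamped_acos (cos_law z x y).
have /andP[a0 api] : 0 < a < pi := clamped_acos_lt_pi y0 z0 h0.
have /andP[b0 bpi] : 0 < b < pi := clamped_acos_lt_pi z0 x0 h1.
have /andP[c0 cpi] : 0 < c < pi := clamped_acos_lt_pi x0 y0 h2.
have sx : Num.sqrt x ^+ 2 = x by rewrite sqr_sqrtr ?ltW.
have sy : Num.sqrt y ^+ 2 = y by rewrite sqr_sqrtr ?ltW.
have sz : Num.sqrt z ^+ 2 = z by rewrite sqr_sqrtr ?ltW.
have sx0 : Num.sqrt x != 0 by rewrite gt_eqF // sqrtr_gt0.
have sy0 : Num.sqrt y != 0 by rewrite gt_eqF // sqrtr_gt0.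
have sz0 : Num.sqrt z != 0 by rewrite gt_eqF // sqrtr_gt0.
have hh : Num.sqrt (heron x y z) ^+ 2 = heron x y z by rewrite sqr_sqrtr ?ltW.
have cosab : cos (a + b) = cos (pi - c).
  rewrite [RHS]cosB cospi sinpi mul0r addr0 mulN1r cosD /a /b /c !cos_clamped_acos // !sin_clamped_acos // -(heronC x y z).
  rewrite [X in _ - X]mulf_div -expr2 hh /cos_law /heron.
  move: sx sy sz sx0 sy0 sz0; move: (Num.sqrt x) (Num.sqrt y) (Num.sqrt z) => p q s <- <- <- p0 q0 s0.
  by field; rewrite p0 q0 s0.
have sinab : 0 < sin (a + b).
  have : 0 < sin c by rewrite sin_gt0_pi // c0.
  rewrite /a /b /c sinD !cos_clamped_acos // !sin_clamped_acos // -(heronC x y z) -(heronC z x y).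
  congr (0 < _); rewrite /cos_law.
  move: sx sy sz sx0 sy0 sz0; move: (Num.sqrt x) (Num.sqrt y) (Num.sqrt z) => p q s <- <- <- p0 q0 s0.
  by field; rewrite p0 q0 s0.
have abpi : a + b < pi.
  rewrite ltNge; apply/negP => piab.
  have : 0 <= sin (a + b - pi) by apply: sin_ge0_pi; lra.
  by rewrite sinB cospi sinpi mulr0 subr0 mulrN1 oppr_ge0 leNgt sinab.
have := cos_inj _ _ cosab; rewrite !in_itv/= => H.
by rewrite H ?subrK //; lra.
Qed.


(** Clamping is thus active exactly when a triangle inequality fails: at 1 when an adjacent side is
    too long, at -1 when the opposite side is. *)
Lemma cos_law_degenerate x y z : 0 < y -> 0 < z ->
  (1 <= cos_law x y z) = (x <= (Num.sqrt y - Num.sqrt z) ^+ 2) /\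
  (cos_law x y z <= -1) = ((Num.sqrt y + Num.sqrt z) ^+ 2 <= x).
Proof.
move=> y0 z0; have p0 : 0 < Num.sqrt y by rewrite sqrtr_gt0.
have q0 : 0 < Num.sqrt z by rewrite sqrtr_gt0.
have d0 : 0 < 2 * Num.sqrt y * Num.sqrt z by rewrite !mulr_gt0.
rewrite /cos_law ler_pdivlMr // ler_pdivrMr // sqrrB sqrrD !sqr_sqrtr ?(ltW y0) ?(ltW z0) //.
by split; apply/idP/idP => ?; lra.
Qed.

(** In the degenerate case Heron's factorization forces one side to be at least the sum of the
    others; its opposite angle is then pi and the other two are 0. *)
Lemma angle_sum x y z : 0 < x -> 0 < y -> 0 < z ->
  clamped_acos (cos_law x y z) + clamped_acos (cos_law y z x) + clamped_acos (cos_law z x y) = pi.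
Proof.
move=> x0 y0 z0; have [h0|h0] := ltP 0 (heron x y z); first exact: angle_sum_nondeg.
have p0 : 0 < Num.sqrt x by rewrite sqrtr_gt0.
have q0 : 0 < Num.sqrt y by rewrite sqrtr_gt0.
have s0 : 0 < Num.sqrt z by rewrite sqrtr_gt0.
have [x1 x2] := cos_law_degenerate x y0 z0; have [y1 y2] := cos_law_degenerate y z0 x0.
have [z1 z2] := cos_law_degenerate z x0 y0.
have ex : x = Num.sqrt x ^+ 2 by rewrite sqr_sqrtr ?ltW.
have ey : y = Num.sqrt y ^+ 2 by rewrite sqr_sqrtr ?ltW.
have ez : z = Num.sqrt z ^+ 2 by rewrite sqr_sqrtr ?ltW.
have hE : heron x y z = (Num.sqrt x + Num.sqrt y + Num.sqrt z) * (Num.sqrt x + Num.sqrt y - Num.sqrt z)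
   * (Num.sqrt y + Num.sqrt z - Num.sqrt x) * (Num.sqrt z + Num.sqrt x - Num.sqrt y).
  by rewrite /heron [in LHS]ex [in LHS]ey [in LHS]ez; ring.
have [c1|c1] := leP (Num.sqrt y + Num.sqrt z) (Num.sqrt x).
  rewrite (@clamped_acos_le (cos_law x y z)) ?(@clamped_acos_ge (cos_law y z x)) ?(@clamped_acos_ge (cos_law z x y)) ?addr0 //.
  - by rewrite z1 [leLHS]ez; nra.
  - by rewrite y1 [leLHS]ey; nra.
  - by rewrite x2 [leRHS]ex; nra.
have [c2|c2] := leP (Num.sqrt z + Num.sqrt x) (Num.sqrt y).
  rewrite (@clamped_acos_ge (cos_law x y z)) ?(@clamped_acos_le (cos_law y z x)) ?(@clamped_acos_ge (cos_law z x y)) ?addr0 ?add0r //.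
  - by rewrite z1 [leLHS]ez; nra.
  - by rewrite y2 [leRHS]ey; nra.
  - by rewrite x1 [leLHS]ex; nra.
have [c3|c3] := leP (Num.sqrt x + Num.sqrt y) (Num.sqrt z).
  rewrite (@clamped_acos_ge (cos_law x y z)) ?(@clamped_acos_ge (cos_law y z x)) ?(@clamped_acos_le (cos_law z x y)) ?addr0 ?add0r //.
  - by rewrite z2 [leRHS]ez; nra.
  - by rewrite y1 [leLHS]ey; nra.
  - by rewrite x1 [leLHS]ex; nra.
exfalso; move: h0; rewrite hE leNgt => /negP; apply.
by rewrite !mulr_gt0 //; lra.
Qed.

Lemma is_derive1_inv x : x != 0 -> is_derive x 1 (@GRing.inv R) (- x ^- 2).
Proof.
move=> x0; have := @is_deriveV R id x 1 1 x0 (is_derive_id x 1).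
by rewrite /GRing.scale/= mulr1.
Qed.

(** With side lengths l_i and area S this is the classical d theta_1 = l_1 / (2 S) (d l_1 - cos
    theta_3 d l_2 - cos theta_2 d l_3), rewritten in squared lengths; the square root of [heron] is
    4 S. *)
Lemma has_deriv_within_angle (A : set R) (fx fy fz : R -> R) t X Y Z :
  0 < fy t -> 0 < fz t -> 0 < heron (fx t) (fy t) (fz t) ->
  has_deriv_within A fx t X -> has_deriv_within A fy t Y -> has_deriv_within A fz t Z ->
  has_deriv_within A (fun s => clamped_acos (cos_law (fx s) (fy s) (fz s))) t
    ((X - (fx t + fy t - fz t) / (2 * fy t) * Y - (fx t + fz t - fy t) / (2 * fz t) * Z)
      / Num.sqrt (heron (fx t) (fy t) (fz t))).
Proof.
move=> y0 z0 h0 HX HY HZ.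
have p0 : 0 < Num.sqrt (fy t) by rewrite sqrtr_gt0.
have q0 : 0 < Num.sqrt (fz t) by rewrite sqrtr_gt0.
have d0 : 0 < 2 * Num.sqrt (fy t) * Num.sqrt (fz t) by rewrite !mulr_gt0.
have Hp := has_deriv_within_comp HY (is_derive1_sqrt y0).
have Hq := has_deriv_within_comp HZ (is_derive1_sqrt z0).
have Hd := has_deriv_withinM (has_deriv_withinZ (c := 2) Hp) Hq.
have Hi := has_deriv_within_comp Hd (is_derive1_inv (lt0r_neq0 d0)).
have Hn := has_deriv_withinD (has_deriv_withinD HY HZ) (has_deriv_withinZ (c := -1) HX).
have Hc := has_deriv_withinM Hn Hi.
have := h0; rewrite -cos_law_lt1 // => /andP[c1 c2].
have Ec : (fun s => (fy s + fz s + -1 * fx s) * (2 * Num.sqrt (fy s) * Num.sqrt (fz s))^-1) =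
  (fun s => cos_law (fx s) (fy s) (fz s)).
  by apply/funext => s; rewrite /cos_law mulN1r.
rewrite Ec in Hc.
have Ha := has_deriv_within_comp Hc (is_derive_clamped_acos c1 c2).
congr (has_deriv_within _ _ _ _) : Ha.
rewrite cos_law_sqr // sqrtrM ?ltW // sqrtrV ?mulr_ge0 ?ltW //.
have E4 : Num.sqrt (4 * fy t * fz t) = 2 * Num.sqrt (fy t) * Num.sqrt (fz t).
  rewrite !sqrtrM ?mulr_ge0 // ?ltW //.
  by rewrite (_ : 4 = 2 ^+ 2) ?sqrtr_sqr ?ger0_norm // -natrX.
rewrite E4.
have hs0 : Num.sqrt (heron (fx t) (fy t) (fz t)) != 0 by rewrite gt_eqF // sqrtr_gt0.
have ey : fy t = Num.sqrt (fy t) ^+ 2 by rewrite sqr_sqrtr ?ltW.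
have ez : fz t = Num.sqrt (fz t) ^+ 2 by rewrite sqr_sqrtr ?ltW.
move: hs0; move: (Num.sqrt (heron _ _ _)) => h h1.
move: p0 q0 ey ez; move: (Num.sqrt (fy t)) (Num.sqrt (fz t)) => p q p0 q0 -> ->.
by field; rewrite h1 !gt_eqF.
Qed.

End Triangles.

(** * Negative definiteness of the angle Jacobian *)

Section GuoForm.
Variable R : realType.
Implicit Types (x y z : R).

(* Derivative of the angle opposite to the first side, times sqrt heron, when the
   squared side lengths x, y, z move with velocities X, Y, Z. *)
Definition angle_form x y z X Y Z := X - (x + y - z) / (2 * y) * Y - (x + z - y) / (2 * z) * Z.

(** A binary form with positive determinant is definite, so one negative value, at (1, 0), (0, 1) or
    (1, 1), decides its sign. *)
Lemma negdef2 (a b c : R) : 0 < a * c - b ^+ 2 ->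
  (a < 0 \/ c < 0 \/ a + 2 * b + c < 0) -> a < 0 /\ c < 0.
Proof.
move=> det H; have ac : 0 < a * c by apply: lt_le_trans det _; rewrite lerBlDr lerDl sqr_ge0.
have [a0|a0] := ltP a 0; first by split => //; rewrite -(nmulr_rgt0 _ a0).
have a1 : 0 < a by rewrite lt_neqAle a0 andbT; apply: contraTneq ac => <-; rewrite mul0r ltxx.
have c1 : 0 < c by rewrite -(pmulr_rgt0 _ a1).
exfalso; case: H => [|[|H]]; [by rewrite ltNge ltW|by rewrite ltNge ltW|].
have : 0 <= (a + b) ^+ 2 + (a * c - b ^+ 2) by rewrite addr_ge0 ?sqr_ge0 ?ltW.
rewrite (_ : _ + _ = a * (a + 2 * b + c)); last by ring.
by rewrite leNgt pmulr_rlt0 // H.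
Qed.

(* Cayley-Hamilton: -tr N * q_N + det N * |D|^2 = - |N D|^2 for N = [a, b; b, c]. *)
Lemma negdef2_bound (a b c D1 D2 : R) :
  (- (a + c)) * (a * D1 ^+ 2 + 2 * b * D1 * D2 + c * D2 ^+ 2) <=
  - (a * c - b ^+ 2) * (D1 ^+ 2 + D2 ^+ 2).
Proof.
rewrite -subr_ge0 (_ : _ - _ = (a * D1 + b * D2) ^+ 2 + (b * D1 + c * D2) ^+ 2); last by ring.
by rewrite addr_ge0 ?sqr_ge0.
Qed.

Section Coefficients.
Variables (p12 p21 p23 p32 p31 p13 : R).
Hypotheses (p12_gt0 : 0 < p12) (p21_gt0 : 0 < p21) (p23_gt0 : 0 < p23)
  (p32_gt0 : 0 < p32) (p31_gt0 : 0 < p31) (p13_gt0 : 0 < p13).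
(* Carnot's condition: the three radical axes are concurrent. *)
Hypothesis carnot : p12 + p23 + p31 = p21 + p32 + p13.
Let x := p23 + p32.
Let y := p31 + p13.
Let z := p12 + p21.

(** Entries of the angle Jacobian times the square root of [heron], where p_ij is the derivative in
    u_i of the squared length of the edge ij. As (1, 1, 1) is in the kernel, the form depends on d1
    - d3 and d2 - d3 alone and a 2 x 2 block suffices. *)
Definition guo11 := - ((x + y - z) / (2 * y) * p13) - (x + z - y) / (2 * z) * p12.
Definition guo12 := p23 - (x + z - y) / (2 * z) * p21.
Definition guo22 := - ((y + z - x) / (2 * z) * p21) - (y + x - z) / (2 * x) * p23.

Let p31E : p31 = p21 + p32 + p13 - p12 - p23. Proof. by rewrite -carnot; ring. Qed.
Let x0 : 0 < x. Proof. exact: addr_gt0. Qed.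
Let y0 : 0 < y. Proof. exact: addr_gt0. Qed.
Let z0 : 0 < z. Proof. exact: addr_gt0. Qed.

(** All factors besides [heron] are positive, so the determinant is positive exactly when the
    triangle is nondegenerate. *)
Lemma guo_det : guo11 * guo22 - guo12 ^+ 2 =
  heron x y z * (p12 * p23 * p31 + p21 * p32 * p13) / (4 * x * y * z).
Proof.
have := lt0r_neq0 x0; have := lt0r_neq0 y0; have := lt0r_neq0 z0.
rewrite /guo11 /guo12 /guo22 /heron /x /y /z p31E => z1 y1 x1.
by field; rewrite x1 y1 z1.
Qed.

(** The value of the reduced form at (1, 1) is the third diagonal entry of the full matrix, because
    rows and columns sum to zero. It restores the symmetry among the three vertices. *)
Lemma guo33 : guo11 + 2 * guo12 + guo22 =
  - ((z + x - y) / (2 * x) * p32) - (z + y - x) / (2 * y) * p31.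
Proof.
have := lt0r_neq0 x0; have := lt0r_neq0 y0; have := lt0r_neq0 z0.
rewrite /guo11 /guo12 /guo22 /x /y /z p31E => z1 y1 x1.
by field; rewrite x1 y1 z1.
Qed.

(** The entries (1, 2) and (2, 1) of the scaled Jacobian differ by half of p12 + p23 + p31 - p21 -
    p32 - p13, so Carnot's condition is what makes the matrix symmetric. *)
Lemma guo_formE (d1 d2 d3 : R) :
  let X := p23 * d2 + p32 * d3 in let Y := p31 * d3 + p13 * d1 in let Z := p12 * d1 + p21 * d2 in
  angle_form x y z X Y Z * d1 + angle_form y z x Y Z X * d2 + angle_form z x y Z X Y * d3 =
  guo11 * (d1 - d3) ^+ 2 + 2 * guo12 * (d1 - d3) * (d2 - d3) + guo22 * (d2 - d3) ^+ 2.
Proof.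
have := lt0r_neq0 x0; have := lt0r_neq0 y0; have := lt0r_neq0 z0.
rewrite /guo11 /guo12 /guo22 /angle_form /x /y /z p31E => z1 y1 x1 /=.
by field; rewrite x1 y1 z1.
Qed.

(* The diagonal entry at the vertex opposite to the longest side is negative, as
   the other two angles are acute; with the determinant this forces definiteness. *)
Lemma guo_negdef : 0 < heron x y z -> 
  0 < guo11 * guo22 - guo12 ^+ 2 /\ guo11 + guo22 < 0.
Proof.
move=> h0.
have det : 0 < guo11 * guo22 - guo12 ^+ 2.
  by rewrite guo_det; apply: divr_gt0; rewrite ?mulr_gt0 // addr_gt0 // ?mulr_gt0.
split=> //.
suff /(negdef2 det)[a0 c0] : guo11 < 0 \/ guo22 < 0 \/ guo11 + 2 * guo12 + guo22 < 0.
  by rewrite -(addr0 0) ltrD.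
have neg (a b c d p q : R) : 0 < a -> 0 < b -> 0 < c -> 0 < d -> 0 < p -> 0 < q ->
    - (a / (2 * b) * p) - c / (2 * d) * q < 0.
  by move=> *; rewrite -opprD oppr_lt0 addr_gt0 // mulr_gt0 // divr_gt0 // mulr_gt0.
have x1 := x0; have y1 := y0; have z1 := z0.
have [yx|/ltW xy] := leP y x; have [zx|/ltW xz] := leP z x.
- by left; apply: neg => //; lra.
- by right; right; rewrite guo33; apply: neg => //; lra.
- by right; left; apply: neg => //; lra.
- have [zy|/ltW yz] := leP z y.
  + by right; left; apply: neg => //; lra.
  + by right; right; rewrite guo33; apply: neg => //; lra.
Qed.

End Coefficients.
End GuoForm.

(** * Angles and their variation in logarithmic coordinates *)

Section AngleFunctions.
Variable R : realType.
Implicit Types (w u v d : R).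

Definition sqlen w u v := expR u + expR v + 2 * w * expR ((u + v) / 2).

(* The derivative of [sqlen w u v] in [u]; divided by [sqlen w u v], it is the
   relative position at which the radical axis of the two circles cuts the edge. *)
Definition sqlen_part w u v := expR u + w * expR ((u + v) / 2).

(* Extended angle at the first vertex; w1 is the weight of the opposite edge. *)
Definition tri_angle w1 w2 w3 u1 u2 u3 :=
  clamped_acos (cos_law (sqlen w1 u2 u3) (sqlen w2 u3 u1) (sqlen w3 u1 u2)).

Definition tri_heron w1 w2 w3 u1 u2 u3 :=
  heron (sqlen w1 u2 u3) (sqlen w2 u3 u1) (sqlen w3 u1 u2).

Lemma sqlenC w u v : sqlen w u v = sqlen w v u.
Proof. by rewrite /sqlen (addrC (expR u)) (addrC u). Qed.

Lemma sqlenE w u v : sqlen w u v = sqlen_part w u v + sqlen_part w v u.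
Proof. by rewrite /sqlen_part /sqlen (addrC v u); ring. Qed.

Lemma sqlen_part_gt0 w u v : 0 <= w -> 0 < sqlen_part w u v.
Proof. by move=> w0; rewrite ltr_pwDl ?expR_gt0 // mulr_ge0 ?expR_ge0. Qed.

Lemma sqlen_gt0 w u v : 0 <= w -> 0 < sqlen w u v.
Proof. by move=> w0; rewrite sqlenE addr_gt0 ?sqlen_part_gt0. Qed.

Lemma tri_angle_ge0 w1 w2 w3 u1 u2 u3 : 0 <= tri_angle w1 w2 w3 u1 u2 u3.
Proof. exact: clamped_acos_ge0. Qed.

Lemma tri_angle_lepi w1 w2 w3 u1 u2 u3 : tri_angle w1 w2 w3 u1 u2 u3 <= pi.
Proof. exact: clamped_acos_lepi. Qed.

Lemma tri_angleC w1 w2 w3 u1 u2 u3 : tri_angle w1 w2 w3 u1 u2 u3 = tri_angle w1 w3 w2 u1 u3 u2.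
Proof. by rewrite /tri_angle cos_lawC (sqlenC w1) (sqlenC w2) (sqlenC w3). Qed.

Lemma tri_angle_sum w1 w2 w3 u1 u2 u3 : 0 <= w1 -> 0 <= w2 -> 0 <= w3 ->
  tri_angle w1 w2 w3 u1 u2 u3 + tri_angle w2 w3 w1 u2 u3 u1 + tri_angle w3 w1 w2 u3 u1 u2 = pi.
Proof. by move=> *; rewrite angle_sum // sqlen_gt0. Qed.

Lemma tri_heronC w1 w2 w3 u1 u2 u3 : tri_heron w1 w2 w3 u1 u2 u3 = tri_heron w2 w3 w1 u2 u3 u1.
Proof. exact: heronC. Qed.

Lemma tri_angle_degenerate w1 w2 w3 u1 u2 u3 : 0 <= w2 -> 0 <= w3 ->
  tri_heron w1 w2 w3 u1 u2 u3 <= 0 -> tri_angle w1 w2 w3 u1 u2 u3 = 0 \/ tri_angle w1 w2 w3 u1 u2 u3 = pi.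
Proof.
move=> w2_ge0 w3_ge0; rewrite leNgt -cos_law_lt1 ?sqlen_gt0 // negb_and -!leNgt => /orP[H|H].
  by right; apply: clamped_acos_le.
by left; apply: clamped_acos_ge.
Qed.

Lemma has_deriv_within_sqlen (A : set R) (fu fv : R -> R) w t d e :
  has_deriv_within A fu t d -> has_deriv_within A fv t e ->
  has_deriv_within A (fun s => sqlen w (fu s) (fv s)) t
    (sqlen_part w (fu t) (fv t) * d + sqlen_part w (fv t) (fu t) * e).
Proof.
move=> Hu Hv.
have H := has_deriv_withinD (has_deriv_withinD (has_deriv_within_exp Hu) (has_deriv_within_exp Hv))
  (has_deriv_withinZ (c := 2 * w) (has_deriv_within_exp
     (has_deriv_withinZ (c := 2^-1) (has_deriv_withinD Hu Hv)))).
have E : (fun s => expR (fu s) + expR (fv s) + 2 * w * expR (2^-1 * (fu s + fv s)))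
   = (fun s => sqlen w (fu s) (fv s)).
  by apply/funext => s; rewrite /sqlen (mulrC 2^-1).
rewrite E in H; congr (has_deriv_within _ _ _ _) : H.
by rewrite /sqlen_part (addrC (fv t)) (mulrC 2^-1 (fu t + _)); field.
Qed.

Definition tri_form w1 w2 w3 u1 u2 u3 d1 d2 d3 :=
  angle_form (sqlen w1 u2 u3) (sqlen w2 u3 u1) (sqlen w3 u1 u2)
    (sqlen_part w1 u2 u3 * d2 + sqlen_part w1 u3 u2 * d3)
    (sqlen_part w2 u3 u1 * d3 + sqlen_part w2 u1 u3 * d1)
    (sqlen_part w3 u1 u2 * d1 + sqlen_part w3 u2 u1 * d2)
  / Num.sqrt (tri_heron w1 w2 w3 u1 u2 u3).

Lemma has_deriv_within_tri_angle (A : set R) (f1 f2 f3 : R -> R) w1 w2 w3 t d1 d2 d3 :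
  0 <= w2 -> 0 <= w3 -> 0 < tri_heron w1 w2 w3 (f1 t) (f2 t) (f3 t) ->
  has_deriv_within A f1 t d1 -> has_deriv_within A f2 t d2 -> has_deriv_within A f3 t d3 ->
  has_deriv_within A (fun s => tri_angle w1 w2 w3 (f1 s) (f2 s) (f3 s)) t
    (tri_form w1 w2 w3 (f1 t) (f2 t) (f3 t) d1 d2 d3).
Proof.
move=> w2_ge0 w3_ge0 h0 H1 H2 H3.
apply: (@has_deriv_within_angle R A (fun s => sqlen w1 (f2 s) (f3 s))
  (fun s => sqlen w2 (f3 s) (f1 s)) (fun s => sqlen w3 (f1 s) (f2 s))) => //;
  by [exact: sqlen_gt0|exact: has_deriv_within_sqlen].
Qed.

Lemma tri_form_lin w1 w2 w3 u1 u2 u3 d1 d2 d3 e1 e2 e3 c :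
  tri_form w1 w2 w3 u1 u2 u3 (c * d1 + e1) (c * d2 + e2) (c * d3 + e3) =
  c * tri_form w1 w2 w3 u1 u2 u3 d1 d2 d3 + tri_form w1 w2 w3 u1 u2 u3 e1 e2 e3.
Proof. by rewrite /tri_form /angle_form; ring. Qed.

Lemma tri_form_cst w1 w2 w3 u1 u2 u3 d : 0 <= w1 -> 0 <= w2 -> 0 <= w3 ->
  tri_form w1 w2 w3 u1 u2 u3 d d d = 0.
Proof.
move=> w1_ge0 w2_ge0 w3_ge0; rewrite /tri_form -!mulrDl -!sqlenE /angle_form.
have := lt0r_neq0 (sqlen_gt0 u3 u1 w2_ge0); have := lt0r_neq0 (sqlen_gt0 u1 u2 w3_ge0).
move: (sqlen w1 _ _) (sqlen w2 _ _) (sqlen w3 _ _) => x y z z0 y0.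
rewrite (_ : _ - _ - _ = 0) ?mul0r //.
by field; rewrite y0 z0.
Qed.

(* Rate at which the pairing of the angle variation with its direction decreases. *)
Definition tri_rate w1 w2 w3 u1 u2 u3 :=
  let p12 := sqlen_part w3 u1 u2 in let p21 := sqlen_part w3 u2 u1 in
  let p23 := sqlen_part w1 u2 u3 in let p32 := sqlen_part w1 u3 u2 in
  let p31 := sqlen_part w2 u3 u1 in let p13 := sqlen_part w2 u1 u3 in
  (guo11 p12 p21 p23 p32 p31 p13 * guo22 p12 p21 p23 p32 p31 p13 - guo12 p12 p21 p23 p32 p31 p13 ^+ 2)
  / (- (guo11 p12 p21 p23 p32 p31 p13 + guo22 p12 p21 p23 p32 p31 p13))
  / Num.sqrt (tri_heron w1 w2 w3 u1 u2 u3).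

(** The mixed term of [sqlen_part] is symmetric in its endpoints, and each expR u_i occurs once on
    either side. *)
Lemma sqlen_part_carnot w1 w2 w3 u1 u2 u3 :
  sqlen_part w3 u1 u2 + sqlen_part w1 u2 u3 + sqlen_part w2 u3 u1 =
  sqlen_part w3 u2 u1 + sqlen_part w1 u3 u2 + sqlen_part w2 u1 u3.
Proof. by rewrite /sqlen_part (addrC u2 u1) (addrC u3 u2) (addrC u1 u3); ring. Qed.

Section Weights.
Variables (w1 w2 w3 : R).
Hypotheses (w1_ge0 : 0 <= w1) (w2_ge0 : 0 <= w2) (w3_ge0 : 0 <= w3).

Lemma tri_rate_gt0 u1 u2 u3 : 0 < tri_heron w1 w2 w3 u1 u2 u3 -> 0 < tri_rate w1 w2 w3 u1 u2 u3.
Proof.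
move=> h0; have := guo_negdef (sqlen_part_gt0 u1 u2 w3_ge0) (sqlen_part_gt0 u2 u1 w3_ge0)
  (sqlen_part_gt0 u2 u3 w1_ge0) (sqlen_part_gt0 u3 u2 w1_ge0)
  (sqlen_part_gt0 u3 u1 w2_ge0) (sqlen_part_gt0 u1 u3 w2_ge0) (sqlen_part_carnot w1 w2 w3 u1 u2 u3).
rewrite -!sqlenE => /(_ h0)[].
by move=> det tr; rewrite !divr_gt0 ?sqrtr_gt0 // oppr_gt0.
Qed.

(** If the scaled reduced matrix has eigenvalues -a and -b, then det / (- tr) = a b / (a + b) lies
    below both. This makes it a valid rate which, unlike the exact smallest eigenvalue, is a
    rational expression of the entries. *)
Lemma tri_form_le u1 u2 u3 d1 d2 d3 : 0 < tri_heron w1 w2 w3 u1 u2 u3 ->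
  tri_form w1 w2 w3 u1 u2 u3 d1 d2 d3 * d1 + tri_form w2 w3 w1 u2 u3 u1 d2 d3 d1 * d2
   + tri_form w3 w1 w2 u3 u1 u2 d3 d1 d2 * d3
  <= - tri_rate w1 w2 w3 u1 u2 u3 * ((d1 - d3) ^+ 2 + (d2 - d3) ^+ 2).
Proof.
move=> h0; have := guo_negdef (sqlen_part_gt0 u1 u2 w3_ge0) (sqlen_part_gt0 u2 u1 w3_ge0)
  (sqlen_part_gt0 u2 u3 w1_ge0) (sqlen_part_gt0 u3 u2 w1_ge0)
  (sqlen_part_gt0 u3 u1 w2_ge0) (sqlen_part_gt0 u1 u3 w2_ge0) (sqlen_part_carnot w1 w2 w3 u1 u2 u3).
rewrite -!sqlenE => /(_ h0)[].
move=> det tr.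
rewrite /tri_form -!(tri_heronC w3) -!(tri_heronC w2) -!(tri_heronC w1) /tri_rate.
have s0 : 0 < Num.sqrt (tri_heron w1 w2 w3 u1 u2 u3) by rewrite sqrtr_gt0.
rewrite !(mulrAC _ _^-1 d1) !(mulrAC _ _^-1 d2) !(mulrAC _ _^-1 d3) -!mulrDl.
rewrite ler_pdivrMr // !sqlenE (guo_formE (sqlen_part_gt0 u1 u2 w3_ge0) (sqlen_part_gt0 u2 u1 w3_ge0)
  (sqlen_part_gt0 u2 u3 w1_ge0) (sqlen_part_gt0 u3 u2 w1_ge0)
  (sqlen_part_gt0 u3 u1 w2_ge0) (sqlen_part_gt0 u1 u3 w2_ge0) (sqlen_part_carnot w1 w2 w3 u1 u2 u3)).
move: det tr; set a := guo11 _ _ _ _ _ _; set c := guo22 _ _ _ _ _ _; set b := guo12 _ _ _ _ _ _.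
move=> det tr; have T0 : 0 < - (a + c) by rewrite oppr_gt0.
rewrite -(ler_pM2l T0) (le_trans (negdef2_bound _ _ _ _ _)) //.
rewrite le_eqVlt; apply/orP; left; apply/eqP; field.
by rewrite (gt_eqF s0) lt_eqF // -oppr_gt0.
Qed.

End Weights.

Section Limits.
Context {T : Type} {F : set_system T} {FF : Filter F}.

Lemma cvg_sqlen_part w (f g : T -> R) (a b : R) : f x @[x --> F] --> a -> g x @[x --> F] --> b ->
  sqlen_part w (f x) (g x) @[x --> F] --> sqlen_part w a b.
Proof.
move=> fa gb; apply: cvgD; first by apply: continuous_cvg fa; exact: continuous_expR.
apply: cvgM; first exact: cvg_cst.
apply: (@continuous_cvg _ _ _ _ _ (fun x => (f x + g x) / 2) expR); first exact: continuous_expR.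
by apply: cvgM; [exact: cvgD|exact: cvg_cst].
Qed.

Lemma cvg_sqlen w (f g : T -> R) (a b : R) : f x @[x --> F] --> a -> g x @[x --> F] --> b ->
  sqlen w (f x) (g x) @[x --> F] --> sqlen w a b.
Proof.
move=> fa gb; rewrite sqlenE (_ : (fun x => _) = (fun x => sqlen_part w (f x) (g x) + sqlen_part w (g x) (f x))).
  by apply: cvgD; exact: cvg_sqlen_part.
by apply/funext => x; rewrite sqlenE.
Qed.

Lemma cvg_heron (f g h : T -> R) (a b c : R) : f x @[x --> F] --> a -> g x @[x --> F] --> b ->
  h x @[x --> F] --> c -> heron (f x) (g x) (h x) @[x --> F] --> heron a b c.
Proof.
move=> fa gb hc; have c2 : (2 : R) @[_ --> F] --> (2 : R) by exact: cvg_cst.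
exact: (cvgB (cvgB (cvgB (cvgD (cvgD (cvgM (cvgM c2 fa) gb) (cvgM (cvgM c2 gb) hc)) (cvgM (cvgM c2 hc) fa))
  (cvgM fa fa)) (cvgM gb gb)) (cvgM hc hc)).
Qed.

Lemma cvg_cos_law (f g h : T -> R) (a b c : R) : f x @[x --> F] --> a -> g x @[x --> F] --> b ->
  h x @[x --> F] --> c -> 0 < b -> 0 < c -> cos_law (f x) (g x) (h x) @[x --> F] --> cos_law a b c.
Proof.
move=> fa gb hc b0 c0; rewrite /cos_law; apply: cvgM; first by apply: cvgB => //; exact: cvgD.
apply: cvgV; first by rewrite !mulf_neq0 // gt_eqF ?sqrtr_gt0.
apply: cvgM; last by apply: continuous_cvg hc; exact: sqrt_continuous.
apply: cvgM; first exact: cvg_cst.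
by apply: continuous_cvg gb; exact: sqrt_continuous.
Qed.

Lemma cvg_guo_term (f g h k : T -> R) (a b c e : R) : f x @[x --> F] --> a -> g x @[x --> F] --> b ->
  h x @[x --> F] --> c -> k x @[x --> F] --> e -> b != 0 ->
  ((f x + g x - h x) / (2 * g x) * k x) @[x --> F] --> (a + b - c) / (2 * b) * e.
Proof.
move=> fa gb hc ke b0; apply: cvgM => //; apply: cvgM; first exact: (cvgB (cvgD fa gb) hc).
by apply: cvgV; [rewrite mulf_neq0|apply: cvgM => //; exact: cvg_cst].
Qed.

Variables (w1 w2 w3 : R).
Hypotheses (w1_ge0 : 0 <= w1) (w2_ge0 : 0 <= w2) (w3_ge0 : 0 <= w3).
Variables (f1 f2 f3 : T -> R) (u1 u2 u3 : R).
Hypotheses (f1u : f1 x @[x --> F] --> u1) (f2u : f2 x @[x --> F] --> u2) (f3u : f3 x @[x --> F] --> u3).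

Lemma cvg_tri_heron :
  tri_heron w1 w2 w3 (f1 x) (f2 x) (f3 x) @[x --> F] --> tri_heron w1 w2 w3 u1 u2 u3.
Proof. by apply: cvg_heron; exact: cvg_sqlen. Qed.

Lemma cvg_tri_angle :
  tri_angle w1 w2 w3 (f1 x) (f2 x) (f3 x) @[x --> F] --> tri_angle w1 w2 w3 u1 u2 u3.
Proof.
apply: continuous_cvg; first exact: clamped_acos_continuous.
by apply: cvg_cos_law; first [exact: cvg_sqlen|exact: sqlen_gt0].
Qed.

Lemma cvg_tri_rate : 0 < tri_heron w1 w2 w3 u1 u2 u3 ->
  tri_rate w1 w2 w3 (f1 x) (f2 x) (f3 x) @[x --> F] --> tri_rate w1 w2 w3 u1 u2 u3.
Proof.
move=> h0.
have := guo_negdef (sqlen_part_gt0 u1 u2 w3_ge0) (sqlen_part_gt0 u2 u1 w3_ge0)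
  (sqlen_part_gt0 u2 u3 w1_ge0) (sqlen_part_gt0 u3 u2 w1_ge0)
  (sqlen_part_gt0 u3 u1 w2_ge0) (sqlen_part_gt0 u1 u3 w2_ge0) (sqlen_part_carnot w1 w2 w3 u1 u2 u3).
rewrite -!sqlenE => /(_ h0)[det tr].
rewrite /tri_rate /=; apply: cvgM; last first.
  apply: cvgV; first by rewrite gt_eqF // sqrtr_gt0.
  by apply: continuous_cvg cvg_tri_heron; exact: sqrt_continuous.
have s1 := cvg_sqlen_part (w := w3) f1u f2u; have s2 := cvg_sqlen_part (w := w3) f2u f1u.
have s3 := cvg_sqlen_part (w := w1) f2u f3u; have s4 := cvg_sqlen_part (w := w1) f3u f2u.
have s5 := cvg_sqlen_part (w := w2) f3u f1u; have s6 := cvg_sqlen_part (w := w2) f1u f3u.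
have x0 : sqlen_part w1 u2 u3 + sqlen_part w1 u3 u2 != 0 by rewrite -sqlenE gt_eqF // sqlen_gt0.
have y0 : sqlen_part w2 u3 u1 + sqlen_part w2 u1 u3 != 0 by rewrite -sqlenE gt_eqF // sqlen_gt0.
have z0 : sqlen_part w3 u1 u2 + sqlen_part w3 u2 u1 != 0 by rewrite -sqlenE gt_eqF // sqlen_gt0.
have sx := cvgD (FF := FF) s3 s4; have sy := cvgD (FF := FF) s5 s6; have sz := cvgD (FF := FF) s1 s2.
have c11 := cvgB (FF := FF) (cvgN (FF := FF) (cvg_guo_term sx sy sz s6 y0)) (cvg_guo_term sx sz sy s1 z0).
have c12 := cvgB (FF := FF) s3 (cvg_guo_term sx sz sy s2 z0).
have c22 := cvgB (FF := FF) (cvgN (FF := FF) (cvg_guo_term sy sz sx s2 z0)) (cvg_guo_term sy sx sz s3 x0).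
have T0 : - (guo11 (sqlen_part w3 u1 u2) (sqlen_part w3 u2 u1) (sqlen_part w1 u2 u3)
   (sqlen_part w1 u3 u2) (sqlen_part w2 u3 u1) (sqlen_part w2 u1 u3) + guo22 (sqlen_part w3 u1 u2) (sqlen_part w3 u2 u1) (sqlen_part w1 u2 u3)
   (sqlen_part w1 u3 u2) (sqlen_part w2 u3 u1) (sqlen_part w2 u1 u3)) != 0 by rewrite gt_eqF // oppr_gt0.
exact: (cvgM (cvgB (cvgM c11 c22) (cvgM c12 c12)) (cvgV T0 (cvgN (cvgD c11 c22)))).
Qed.

End Limits.
End AngleFunctions.

(** * Monotonicity of the extended angles *)

Section Monotonicity.
Variable R : realType.

Lemma exists_between_notin (s : seq R) (a b : R) : a < b -> exists y, [/\ a < y, y < b & y \notin s].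
Proof.
elim: s a b => [|v s IHs] a b ab; first by exists ((a + b) / 2); rewrite midf_lt // ; split => //; lra.
have [/andP[av vb]|nv] := boolP (a < v < b).
  have [y [ay yv ys]] := IHs _ _ av.
  by exists y; rewrite inE negb_or ys (lt_trans yv vb) lt_eqF.
have [y [ay yb ys]] := IHs _ _ ab.
exists y; split => //; rewrite inE negb_or ys andbT.
by apply: contraNneq nv => <-; rewrite ay yb.
Qed.

(* A continuous function whose values off an open set form a finite set and
   which decreases on that open set cannot increase across the gaps. *)
Lemma gap_nonincreasing (h h' : R -> R) (U : set R) (s : seq R) :
  continuous h -> open U ->
  (forall t, U t -> has_deriv_within setT h t (h' t)) -> (forall t, U t -> h' t <= 0) ->
  (forall t, ~ U t -> h t \in s) ->
  forall a b, a <= b -> h b <= h a.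
Proof.
move=> hc oU hd hn hs a b ab; rewrite leNgt; apply/negP => hab.
(* The level y avoids the exceptional values, so h can meet it only inside U, where it cannot cross
   upwards. *)
have [y [ay yb ys]] := exists_between_notin s hab.
suff : h (a + (b - a)) <= y by rewrite addrCA subrr addr0 leNgt yb.
apply: (@real_induction R setT (fun t => h (a + t) <= y)) => //; last by rewrite subr_ge0.
- by move=> _; rewrite addr0 ltW.
- move=> t t0 _ /(_ t); rewrite t0 lexx => /(_ isT); rewrite le_eqVlt => /predU1P[hy|hy].
    have Ut : U (a + t) by apply: contrapT => /hs; rewrite hy; apply/negP.
    have /nbhs_normP[d /= d0 Hd] : nbhs (a + t) U by apply: open_nbhs_nbhs.
    exists d => // r _ tr rd.
    have Hin x : a + t <= x <= a + r -> U x.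
      by move=> /andP[x1 x2]; apply: Hd; rewrite /ball_/= distrC ger0_norm ?subr_ge0 //; lra.
    have : h (a + r) - h (a + t) <= 0 * ((a + r) - (a + t)).
      apply: (@has_deriv_within_le R setT h h') => // [|x /Hin/hd //|x /Hin/hn //].
      by rewrite lerD2l ltW.
    by rewrite mul0r subr_le0 hy.
  have /cvgrPdist_lt /(_ (y - h (a + t))) := hc (a + t).
  rewrite subr_gt0 => /(_ hy)/nbhs_normP[d /= d0 Hd]; exists d => // r _ tr rd.
  have : `|h (a + t) - h (a + r)| < y - h (a + t).
    by apply: Hd; rewrite /ball_/= distrC ger0_norm; lra.
  by rewrite ltr_norml => /andP[] *; lra.
- move=> t t0 _ H; rewrite leNgt; apply/negP => yh.
  have /cvgrPdist_lt /(_ (h (a + t) - y)) := hc (a + t).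
  rewrite subr_gt0 => /(_ yh)/nbhs_normP[d /= d0 Hd].
  pose r := Num.max 0 (t - d / 2).
  have r0 : 0 <= r < t by rewrite le_max lexx gt_max t0 /=; lra.
  have := H _ r0; have : `|h (a + t) - h (a + r)| < h (a + t) - y.
    apply: Hd; rewrite /ball_/= ger0_norm; last by lra.
    have : t - d / 2 <= r by rewrite le_max lexx orbT.
    by lra.
  by rewrite ltr_norml => /andP[] *; lra.
Qed.

Lemma nbhs_prod3_ball (P : set ((R * R) * R)) (p : (R * R) * R) : nbhs p P ->
  exists2 r : R, 0 < r & ball p r `<=` P.
Proof. by move/nbhs_ballP. Qed.

Variables (w1 w2 w3 : R).
Hypotheses (w1_ge0 : 0 <= w1) (w2_ge0 : 0 <= w2) (w3_ge0 : 0 <= w3).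

Definition tri_pairing u1 u2 u3 d1 d2 d3 : R :=
  tri_angle w1 w2 w3 u1 u2 u3 * d1 + tri_angle w2 w3 w1 u2 u3 u1 * d2 + tri_angle w3 w1 w2 u3 u1 u2 * d3.

Section Line.
Variables (u1 u2 u3 d1 d2 d3 : R).
Let h t := tri_pairing (u1 + t * d1) (u2 + t * d2) (u3 + t * d3) d1 d2 d3.
Let U := [set t | 0 < tri_heron w1 w2 w3 (u1 + t * d1) (u2 + t * d2) (u3 + t * d3)].

Let hdl (u d t : R) : has_deriv_within setT (fun t => u + t * d) t d.
Proof.
have := has_deriv_withinD (has_deriv_within_cst setT u t)
  (has_deriv_withinM (has_deriv_within_id setT t) (has_deriv_within_cst setT d t)).
by rewrite mul1r mulr0 addr0 add0r.
Qed.

Let cl (u d t : R) : u + x * d @[x --> t] --> u + t * d.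
Proof. by apply: cvgD; [exact: cvg_cst|apply: cvgM; [exact: cvg_id|exact: cvg_cst]]. Qed.

Let oU : open U.
Proof.
have -> : U = (fun t => tri_heron w1 w2 w3 (u1 + t * d1) (u2 + t * d2) (u3 + t * d3)) @^-1` [set x | 0 < x] by [].
apply: open_comp; last exact: open_gt.
by move=> t _; apply: cvg_tri_heron; exact: cl.
Qed.

Let h' t :=
  tri_form w1 w2 w3 (u1 + t * d1) (u2 + t * d2) (u3 + t * d3) d1 d2 d3 * d1 +
  tri_form w2 w3 w1 (u2 + t * d2) (u3 + t * d3) (u1 + t * d1) d2 d3 d1 * d2 +
  tri_form w3 w1 w2 (u3 + t * d3) (u1 + t * d1) (u2 + t * d2) d3 d1 d2 * d3.

Let hd t : U t -> has_deriv_within setT h t (h' t).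
Proof.
move=> Ut.
have hM (f : R -> R) (a d : R) : has_deriv_within setT f t a -> has_deriv_within setT (fun s => f s * d) t (a * d).
  by move=> H; have := has_deriv_withinM H (has_deriv_within_cst setT d t); rewrite mulr0 addr0.
apply: has_deriv_withinD; first apply: has_deriv_withinD; apply: hM.
- exact: (@has_deriv_within_tri_angle R setT (fun t => u1 + t * d1) (fun t => u2 + t * d2) (fun t => u3 + t * d3)).
- apply: (@has_deriv_within_tri_angle R setT (fun t => u2 + t * d2) (fun t => u3 + t * d3) (fun t => u1 + t * d1)) => //.
  by rewrite -tri_heronC.
- apply: (@has_deriv_within_tri_angle R setT (fun t => u3 + t * d3) (fun t => u1 + t * d1) (fun t => u2 + t * d2)) => //.
  by rewrite tri_heronC.
Qed.

Let h'_le t : U t ->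
  h' t <= - tri_rate w1 w2 w3 (u1 + t * d1) (u2 + t * d2) (u3 + t * d3) * ((d1 - d3) ^+ 2 + (d2 - d3) ^+ 2).
Proof. by move=> Ut; exact: tri_form_le. Qed.

Lemma tri_pairing_nonincreasing a b : a <= b ->
  tri_pairing (u1 + b * d1) (u2 + b * d2) (u3 + b * d3) d1 d2 d3 <=
  tri_pairing (u1 + a * d1) (u2 + a * d2) (u3 + a * d3) d1 d2 d3.
Proof.
(* In a degenerate triangle each angle is 0 or pi, which leaves the eight values listed here. *)
move: a b; apply: (@gap_nonincreasing h h' U [seq x + y | x <- [seq x + y | x <- [:: 0; pi * d1], y <- [:: 0; pi * d2]], y <- [:: 0; pi * d3]]) => //.
- move=> t; apply: cvgD; first apply: cvgD; apply: cvgM; try exact: cvg_cst; apply: cvg_tri_angle => //; exact: cl.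
- move=> t Ut; apply: le_trans (h'_le Ut) _.
  by rewrite mulNr oppr_le0 mulr_ge0 ?addr_ge0 ?sqr_ge0 // ltW // tri_rate_gt0.
- move=> t /negP; rewrite -leNgt => H; rewrite /h /tri_pairing.
  have two (x d : R) : x = 0 \/ x = pi -> x * d \in [:: 0; pi * d].
    by move=> [] ->; rewrite ?mul0r !inE eqxx ?orbT.
  apply: allpairs_f; first apply: allpairs_f; apply: two; apply: tri_angle_degenerate => //.
  - by rewrite -tri_heronC.
  - by rewrite tri_heronC.
Qed.

Lemma tri_pairing_strict_line m :
  (forall t, 0 <= t <= 1 -> U t /\ m <= tri_rate w1 w2 w3 (u1 + t * d1) (u2 + t * d2) (u3 + t * d3)) ->
  tri_pairing (u1 + d1) (u2 + d2) (u3 + d3) d1 d2 d3 - tri_pairing u1 u2 u3 d1 d2 d3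
   <= - m * ((d1 - d3) ^+ 2 + (d2 - d3) ^+ 2).
Proof.
move=> H.
have : h 1 - h 0 <= - m * ((d1 - d3) ^+ 2 + (d2 - d3) ^+ 2) * (1 - 0).
  apply: (@has_deriv_within_le R setT h h') => // [t /H[+ _]|t /H[Ut mt]]; first exact: hd.
  by apply: le_trans (h'_le Ut) _; rewrite ler_wpM2r ?addr_ge0 ?sqr_ge0 // lerN2.
by rewrite /h !mul1r !mul0r !addr0 subr0 mulr1.
Qed.

End Line.

(** Only the base point is assumed nondegenerate. The initial piece of the segment gains strictly,
    the rest loses nothing by monotonicity; the bound B fixes how large a fraction of the segment
    the initial piece is. *)
Lemma tri_pairing_strict u1 u2 u3 B : 0 < tri_heron w1 w2 w3 u1 u2 u3 -> 0 < B ->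
  exists2 m, 0 < m & forall d1 d2 d3, `|d1| <= B -> `|d2| <= B -> `|d3| <= B ->
  tri_pairing (u1 + d1) (u2 + d2) (u3 + d3) d1 d2 d3 - tri_pairing u1 u2 u3 d1 d2 d3
   <= - m * ((d1 - d3) ^+ 2 + (d2 - d3) ^+ 2).
Proof.
move=> h0 B0.
have k0 := tri_rate_gt0 w1_ge0 w2_ge0 w3_ge0 h0; set k := tri_rate w1 w2 w3 u1 u2 u3 in k0.
have [r r0 Hr] : exists2 r, 0 < r & forall d1 d2 d3, `|d1| < r -> `|d2| < r -> `|d3| < r ->
   0 < tri_heron w1 w2 w3 (u1 + d1) (u2 + d2) (u3 + d3) /\ k / 2 <= tri_rate w1 w2 w3 (u1 + d1) (u2 + d2) (u3 + d3).
  pose F := nbhs ((0 : R, 0 : R), 0 : R).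
  have c1 : u1 + v.1.1 @[v --> F] --> u1.
    rewrite -[X in _ --> X]addr0; apply: cvgD; first exact: cvg_cst.
    by apply: (@cvg_comp _ _ _ (fun v : (R * R) * R => v.1) fst); exact: cvg_fst.
  have c2 : u2 + v.1.2 @[v --> F] --> u2.
    rewrite -[X in _ --> X]addr0; apply: cvgD; first exact: cvg_cst.
    by apply: (@cvg_comp _ _ _ (fun v : (R * R) * R => v.1) snd); [exact: cvg_fst|exact: cvg_snd].
  have c3 : u3 + v.2 @[v --> F] --> u3.
    rewrite -[X in _ --> X]addr0; apply: cvgD; first exact: cvg_cst.
    exact: cvg_snd.
  have FF : Filter F by exact: nbhs_filter.
  have hh := cvg_tri_heron (FF := FF) (w1 := w1) (w2 := w2) (w3 := w3) c1 c2 c3.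
  have hk := cvg_tri_rate (FF := FF) w1_ge0 w2_ge0 w3_ge0 c1 c2 c3 h0.
  have k2 : k / 2 < k by rewrite ltr_pdivrMr // ltr_pMr // ltr1n.
  move/cvgr_gt : hh => /(_ _ h0) n1; move/cvgr_ge : hk => /(_ _ k2) n2.
  have [r r0 Hr] := nbhs_prod3_ball (filterI n1 n2); exists r => // d1 d2 d3 e1 e2 e3.
  have := Hr ((d1, d2), d3); apply.
  by split; first split; rewrite /ball/= sub0r normrN.
(* Up to time t the segment stays in the ball where the rate is at least k / 2. The gain there is
   quadratic in t d while the pairing is with t d, so after division one factor t remains in the
   constant. *)
pose t := Num.min 1 (r / (2 * B)).
have t0 : 0 < t by rewrite lt_min ltr01 divr_gt0 // mulr_gt0.
have t1 : t <= 1 by rewrite ge_min lexx.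
have tB : t * B < r.
  apply: (@le_lt_trans _ _ (r / (2 * B) * B)); first by rewrite ler_wpM2r ?(ltW B0) // ge_min lexx orbT.
  by rewrite invfM mulrA divfK ?gt_eqF // ltr_pdivrMr // ltr_pMr // ltr1n.
exists (k / 2 * t); first by apply: mulr_gt0 => //; apply: divr_gt0.
move=> d1 d2 d3 e1 e2 e3.
have small (d s : R) : `|d| <= B -> 0 <= s <= 1 -> `|s * (t * d)| < r.
  move=> dB /andP[s0 s1]; apply: le_lt_trans tB; rewrite !normrM (ger0_norm s0) (gtr0_norm t0).
  apply: (@le_trans _ _ (t * `|d|)); last by rewrite ler_pM2l.
  by rewrite ler_piMl // mulr_ge0 // ltW.
have H1 : tri_pairing (u1 + t * d1) (u2 + t * d2) (u3 + t * d3) (t * d1) (t * d2) (t * d3)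
    - tri_pairing u1 u2 u3 (t * d1) (t * d2) (t * d3) <=
   - (k / 2) * ((t * d1 - t * d3) ^+ 2 + (t * d2 - t * d3) ^+ 2).
  by apply: tri_pairing_strict_line => s s01; apply: Hr; exact: small.
have H2 := tri_pairing_nonincreasing u1 u2 u3 d1 d2 d3 t1; rewrite !mul1r in H2.
have H3 : tri_pairing (u1 + t * d1) (u2 + t * d2) (u3 + t * d3) d1 d2 d3
    - tri_pairing u1 u2 u3 d1 d2 d3 <=
   - (k / 2 * t) * ((d1 - d3) ^+ 2 + (d2 - d3) ^+ 2).
  rewrite -(ler_pM2l t0); move: H1; rewrite /tri_pairing.
  by congr (_ <= _); ring.
lra.
Qed.

End Monotonicity.

(** * Counting faces; Gauss-Bonnet *)

Section Combinatorics.
Variables (N : nat) (T : triangulated_surface N).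
Implicit Types (i j k : 'I_N).

Definition is_face i j k := [set i; j; k]%SET \in faces T.

Lemma is_faceC i j k : is_face i j k = is_face i k j.
Proof. by rewrite /is_face -!finset.setUA (finset.setUC [set j]%SET). Qed.

Lemma is_face_rot i j k : is_face i j k = is_face j k i.
Proof.
rewrite /is_face (_ : [set i; j; k]%SET = [set j; k; i]%SET) //.
by apply/finset.setP => x; rewrite !inE -orbA orbC.
Qed.

Lemma is_face_uniq i j k : is_face i j k -> [/\ i != j, j != k & i != k].
Proof.
move=> /card_face; rewrite -finset.setUA cardsU1 cards2 !inE negb_or.
by case: (i == j); case: (i == k); case: (j == k).
Qed.

Lemma is_face_edge i j k : is_face i j k -> [set i; j]%SET \in edges T.
Proof.
move=> f; have [ij _ _] := is_face_uniq f; apply: (face_edge f); last by rewrite cards2 ij.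
exact: finset.subsetUl.
Qed.

Lemma edge_face i j : [set i; j]%SET \in edges T -> exists k, is_face i j k.
Proof.
have [s [_ _ sE fE]] := link_cycle T i; rewrite -sE => js.
by exists (next s j); rewrite /is_face fE js eqxx.
Qed.

Lemma prev_at_last (x y0 y : 'I_N) p : x \notin p -> x = y0 -> prev_at x y0 y p = last y p.
Proof.
elim: p y => [|z p IHp] y /=; first by move=> _ ->; rewrite eqxx.
by rewrite inE negb_or => /andP[/negPf -> xp] e; exact: IHp.
Qed.

(** With j rotated to the front its neighbours are the second and the last entry, distinct as soon
    as the cycle has three elements. *)
Lemma next_neq_prev (s : seq 'I_N) j : uniq s -> (2 < size s)%N -> j \in s -> next s j != prev s j.
Proof.
move=> us ss js; have [n s' e] := rot_to js.
rewrite -(next_rot n us) -(prev_rot n us) e.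
have : uniq (j :: s') by rewrite -e rot_uniq.
have : (2 < size (j :: s'))%N by rewrite -e size_rot.
case: s' {e} => [|a [|b t]] // _ /andP[jn /andP[an _]].
rewrite /prev (prev_at_last _ jn) //= eqxx.
by apply: contraNneq an => ->; rewrite mem_last.
Qed.

Section Sums.
Variable R : realType.

Lemma face_sum_rot (G : 'I_N -> 'I_N -> 'I_N -> R) :
  \sum_i \sum_j \sum_(k | is_face i j k) G i j k = \sum_i \sum_j \sum_(k | is_face i j k) G j k i.
Proof.
rewrite [RHS]exchange_big /=; apply: eq_bigr => j _.
rewrite [RHS](exchange_big_dep predT) //=; apply: eq_bigr => k _; apply: eq_bigl => i.
by rewrite (is_face_rot i).
Qed.

Lemma face_sum_half (i : 'I_N) (G : 'I_N -> 'I_N -> R) : (forall j k, G j k = G k j) ->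
  \sum_(p : 'I_N * 'I_N | (p.1 < p.2)%N && is_face i p.1 p.2) G p.1 p.2 =
  2^-1 * \sum_j \sum_(k | is_face i j k) G j k.
Proof.
move=> GC; rewrite (pair_big_dep predT (fun j k => is_face i j k)) /=.
rewrite [in RHS](bigID (fun p : 'I_N * 'I_N => (p.1 < p.2)%N)) /=.
set A := \sum_(p | _) _.
have -> : \sum_(p : 'I_N * 'I_N | is_face i p.1 p.2 && ~~ (p.1 < p.2)%N) G p.1 p.2 = A.
  rewrite (reindex_inj (h := fun p : 'I_N * 'I_N => (p.2, p.1))) /=; last by move=> [a b] [c d] [-> ->].
  rewrite /A; apply: eq_big => [p|p _]; last exact: GC.
  rewrite is_faceC andbC; case f : is_face; rewrite ?andbF // !andbT.
  have [_ + _] := is_face_uniq f; rewrite -leqNgt leq_eqVlt -val_eqE => /negPf.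
  by rewrite eq_sym => ->.
have -> : \sum_(p : 'I_N * 'I_N | is_face i p.1 p.2 && (p.1 < p.2)%N) G p.1 p.2 = A.
  by apply: eq_bigl => p; rewrite andbC.
by field.
Qed.

Lemma card_ordered_edges : (\sum_i \sum_(j | [set i; j]%SET \in edges T) 1 = 2 * #|edges T|)%N.
Proof.
rewrite (pair_big_dep predT (fun i j => [set i; j]%SET \in edges T)) /=.
rewrite (partition_big (fun p : 'I_N * 'I_N => [set p.1; p.2]%SET) (mem (edges T))) //=.
rewrite (eq_bigr (fun=> 2%N)); first by rewrite sum_nat_const mulnC.
move=> e eE; have ce := card_edge eE.
rewrite (eq_bigl (fun p : 'I_N * 'I_N => (p.1 \in e) && (p.2 \in e :\ p.1)%SET)); last first.
  move=> [i j] /=; apply/andP/andP => [[_ /eqP E]|[ie /setD1P[ji je]]].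
    rewrite -E !inE !eqxx orbT andbT /=; split => //.
    by move: ce; rewrite -E cards2 eq_sym; case: eqP.
  have E : [set i; j]%SET == e.
    by rewrite finset.eqEcard finset.subUset !finset.sub1set ie je ce cards2 eq_sym ji.
  by rewrite E (eqP E).
rewrite -(pair_big_dep (fun i : 'I_N => i \in e) (fun i j => j \in (e :\ i)%SET) (fun _ _ => 1%N)) /=.
rewrite (eq_bigr (fun=> 1%N)); first by rewrite sum_nat_const ce.
by move=> i ie; rewrite sum1_card; have := cardsD1 i e; rewrite ce ie => -[].
Qed.

Lemma card_ordered_faces :
  (\sum_i \sum_j \sum_(k | is_face i j k) 1 = 6 * #|faces T|)%N.
Proof.
under eq_bigr do rewrite (pair_big_dep predT (is_face _)) /=.
rewrite (pair_big_dep predT (fun i (p : 'I_N * 'I_N) => is_face i p.1 p.2)) /=.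
rewrite (partition_big (fun p : 'I_N * ('I_N * 'I_N) => [set p.1; p.2.1; p.2.2]%SET) (mem (faces T))) //=.
rewrite (eq_bigr (fun=> 6%N)); first by rewrite sum_nat_const mulnC.
move=> f fF; have cf := card_face fF.
rewrite (eq_bigl (fun p : 'I_N * ('I_N * 'I_N) => (p.1 \in f) &&
    ((p.2.1 \in f :\ p.1)%SET && (p.2.2 \in f :\ p.1 :\ p.2.1)%SET))); last first.
  move=> [i [j k]] /=; apply/andP/andP => [[/is_face_uniq[ij jk ik] /eqP E]|[fi /andP[/setD1P[ji fj] /setD1P[kj /setD1P[ki fk]]]]].
    by rewrite -E !inE !eqxx (eq_sym j i) ij (eq_sym k j) jk (eq_sym k i) ik !orbT.
  have E : [set i; j; k]%SET == f.
    rewrite finset.eqEcard !finset.subUset !finset.sub1set fi fj fk cf -finset.setUA cardsU1 cards2 !inE.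
    by rewrite negb_or (eq_sym i) ji (eq_sym i) ki (eq_sym j) kj.
  by rewrite /is_face E (eqP E).
rewrite -(pair_big_dep (fun i : 'I_N => i \in f)
  (fun i (p : 'I_N * 'I_N) => (p.1 \in f :\ i)%SET && (p.2 \in f :\ i :\ p.1)%SET) (fun _ _ => 1%N)) /=.
rewrite (eq_bigr (fun=> 2%N)); first by rewrite sum_nat_const cf.
move=> i fi.
have c2 : #|(f :\ i)%SET| = 2%N by have := cardsD1 i f; rewrite cf fi => -[].
rewrite -(pair_big_dep (fun j : 'I_N => j \in (f :\ i)%SET)
  (fun j k => (k \in f :\ i :\ j)%SET) (fun _ _ => 1%N)) /=.
rewrite (eq_bigr (fun=> 1%N)); first by rewrite sum_nat_const c2.
by move=> j fj; rewrite sum1_card; have := cardsD1 j (f :\ i)%SET; rewrite c2 fj => -[].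
Qed.

(* Each edge at [v] lies in exactly two faces. *)
Lemma card_faces_edges :
  (\sum_i \sum_j \sum_(k | is_face i j k) 1 = 2 * \sum_i \sum_(j | [set i; j]%SET \in edges T) 1)%N.
Proof.
rewrite big_distrr /=; apply: eq_bigr => v _.
have [s [us ss sE fE]] := link_cycle T v.
rewrite big_distrr /= [RHS]big_mkcond /=; apply: eq_bigr => j _.
rewrite -sE (eq_bigl (fun k => (j \in s) && (k \in [set next s j; prev s j])%SET)); last first.
  by move=> k; rewrite /is_face fE !inE.
case: ifP => js; last by rewrite big1.
by rewrite sum1_card cards2 next_neq_prev.
Qed.

(** Every edge lies in two faces, so 2 #E = 3 #F and 12 chi = 12 N - 6 #F. Edges are eliminated
    because angle sums see only vertices and faces. *)
Lemma euler_char_count :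
  (12 * N%:Z - (\sum_i \sum_j \sum_(k | is_face i j k) 1)%N%:Z = 12 * euler_char T)%R.
Proof.
rewrite /euler_char; have := card_faces_edges.
rewrite card_ordered_edges card_ordered_faces; lia.
Qed.


Definition face_sum (G : 'I_N -> 'I_N -> 'I_N -> R) : R := \sum_i \sum_j \sum_(k | is_face i j k) G i j k.

(* Summation by faces: every face occurs six times among the ordered triples. *)
Lemma sum_vertex_curv (th : 'I_N -> 'I_N -> 'I_N -> R) (w : 'I_N -> R) :
  (forall i j k, th i j k = th i k j) ->
  \sum_i vertex_curv T th i * w i = 2 * pi * \sum_i w i -
    6^-1 * face_sum (fun i j k => th i j k * w i + th j k i * w j + th k i j * w k).
Proof.
move=> thC; rewrite (_ : face_sum _ = 3 * face_sum (fun i j k => th i j k * w i)); last first.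
  have r1 := face_sum_rot (fun i j k => th i j k * w i).
  have r2 := face_sum_rot (fun i j k => th j k i * w j).
  transitivity (face_sum (fun i j k => th i j k * w i) + face_sum (fun i j k => th j k i * w j)
     + face_sum (fun i j k => th k i j * w k)).
    rewrite /face_sum -!big_split; apply: eq_bigr => i _; rewrite -!big_split; apply: eq_bigr => j _.
    by rewrite -!big_split.
  by rewrite /face_sum -r2 -r1; ring.
rewrite mulr_sumr /vertex_curv (_ : 6^-1 * (3 * _) = \sum_i (2^-1 * \sum_j \sum_(k | is_face i j k) th i j k) * w i).
  rewrite -sumrB; apply: eq_bigr => i _; rewrite -mulrBl; congr ((_ - _) * _).
  by rewrite -(@face_sum_half i (th i)).
rewrite mulrA [X in X * _](_ : _ = 2^-1); last by field.
rewrite mulr_sumr; apply: eq_bigr => i _; rewrite -mulrA; congr (_ * _).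
rewrite mulr_suml; apply: eq_bigr => j _; by rewrite mulr_suml.
Qed.

(** Nothing but the sum pi on each face enters, so degenerate faces with extended angles are covered
    as well. *)
Lemma gauss_bonnet (th : 'I_N -> 'I_N -> 'I_N -> R) :
  (forall i j k, th i j k = th i k j) ->
  (forall i j k, is_face i j k -> th i j k + th j k i + th k i j = pi) ->
  \sum_i vertex_curv T th i = 2 * pi * (euler_char T)%:~R.
Proof.
move=> thC th_pi; have := sum_vertex_curv (fun=> 1) thC.
under eq_bigr do rewrite mulr1; move=> ->.
have -> : face_sum (fun i j k => th i j k * 1 + th j k i * 1 + th k i j * 1) =
  pi * (\sum_i \sum_j \sum_(k | is_face i j k) 1)%N%:R.
  rewrite natr_sum mulr_sumr; apply: eq_bigr => i _; rewrite natr_sum mulr_sumr; apply: eq_bigr => j _.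
  rewrite natr_sum mulr_sumr; apply: eq_bigr => k f; rewrite !mulr1; exact: th_pi.
have /(congr1 (fun z : int => z%:~R : R)) := euler_char_count.
rewrite !rmorphB !rmorphM /= sumr_const card_ord => H.
have -> : (euler_char T)%:~R = 12^-1 * (12%:~R * (euler_char T)%:~R) :> R by rewrite mulrA mulVf ?mul1r.
by rewrite -H -!pmulrn; field.
Qed.

End Sums.
End Combinatorics.

(** * The curvature map *)

(** The minimum of finitely many constants; the default 1 keeps it positive when J is empty. *)
Lemma uniform_pos (R : realType) (J : finType) (P : J -> R -> Prop) :
  (forall j, exists2 m : R, 0 < m & P j m) -> (forall j (m m' : R), 0 < m' -> m' <= m -> P j m -> P j m') ->
  exists2 m : R, 0 < m & forall j, P j m.
Proof.
move=> /(_ _)/cid2 => H mono; pose f j := projT1 (H j).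
have m0 : 0 < \big[Order.min/1]_j f j.
  by apply: lt_bigmin => // j _; rewrite /f; case: (H j).
exists (\big[Order.min/1]_j f j) => // j.
apply: (mono _ (f j)) => //; last by rewrite /f; case: (H j).
exact: bigmin_le_cond.
Qed.

Lemma cvg_sumr (R : realType) (S J : Type) (F : set_system S) (FF : Filter F) (s : seq J) (P : pred J)
    (f : J -> S -> R) (a : J -> R) :
  (forall j, P j -> f j x @[x --> F] --> a j) ->
  \sum_(j <- s | P j) f j x @[x --> F] --> \sum_(j <- s | P j) a j.
Proof.
move=> H; elim: s => [|j s IHs].
  by rewrite big_nil; under eq_cvg do rewrite big_nil; exact: cvg_cst.
rewrite big_cons; under eq_cvg do rewrite big_cons.
by have [Pj|_] := boolP (P j) => //; apply: cvgD => //; exact: H.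
Qed.

Section CurvatureMap.
Variables (R : realType) (N : nat) (T : triangulated_surface N) (I : {set 'I_N} -> R).
Hypothesis I_ge0 : weight_nonneg T I.
Implicit Types (i j k : 'I_N) (u v d : 'rV[R]_N).

Definition face_angle u i j k :=
  tri_angle (I [set j; k]%SET) (I [set k; i]%SET) (I [set i; j]%SET) (u 0 i) (u 0 j) (u 0 k).

Definition face_heron u i j k :=
  tri_heron (I [set j; k]%SET) (I [set k; i]%SET) (I [set i; j]%SET) (u 0 i) (u 0 j) (u 0 k).

Definition log_curv u i := vertex_curv T (face_angle u) i.

Lemma face_weight i j k : is_face T i j k ->
  [/\ 0 <= I [set j; k]%SET, 0 <= I [set k; i]%SET & 0 <= I [set i; j]%SET].
Proof.
move=> f; have f1 : is_face T j k i by rewrite -is_face_rot.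
have f2 : is_face T k i j by rewrite -is_face_rot.
by split; apply: I_ge0; apply: is_face_edge; eassumption.
Qed.

Lemma radii_gt0 u : positive_radii (radii u).
Proof. by move=> i; rewrite mxE expR_gt0. Qed.

Lemma log_coordK (r : 'rV[R]_N) : positive_radii r -> radii (log_coord r) = r.
Proof.
move=> r0; apply/rowP => i; rewrite !mxE lnXn // mulr2n -mulr2n -[_ *+ 2]mulr_natr mulfK //.
by rewrite lnK // posrE.
Qed.

Lemma radii_sqr u i : radii u 0 i ^+ 2 = expR (u 0 i).
Proof. by rewrite mxE -expRM_natl mulrC divfK. Qed.

Lemma elen_radii u i j : elen I (radii u) i j = Num.sqrt (sqlen (I [set i; j]%SET) (u 0 i) (u 0 j)).
Proof.
rewrite /elen !radii_sqr !mxE /sqlen; congr (Num.sqrt (_ + _)).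
have -> : expR ((u 0 i + u 0 j) / 2) = expR (u 0 i / 2) * expR (u 0 j / 2) by rewrite mulrDl expRD.
by ring.
Qed.

Lemma elenC (r : 'rV[R]_N) i j : elen I r i j = elen I r j i.
Proof. by rewrite /elen finset.setUC (addrC (r 0 i ^+ 2)) -!mulrA (mulrCA (r 0 i)). Qed.

Lemma face_angleC u i j k : face_angle u i j k = face_angle u i k j.
Proof.
rewrite /face_angle tri_angleC (finset.setUC [set k]%SET [set j]%SET).
by rewrite (finset.setUC [set j]%SET [set i]%SET) (finset.setUC [set i]%SET [set k]%SET).
Qed.

Lemma face_angle_sum u i j k : is_face T i j k ->
  face_angle u i j k + face_angle u j k i + face_angle u k i j = pi.
Proof. by move=> /face_weight[w1 w2 w3]; exact: tri_angle_sum. Qed.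

Lemma angle_radiiE u i j k : is_face T i j k ->
  angle I (radii u) i j k = acos (cos_law (sqlen (I [set j; k]%SET) (u 0 j) (u 0 k))
   (sqlen (I [set k; i]%SET) (u 0 k) (u 0 i)) (sqlen (I [set i; j]%SET) (u 0 i) (u 0 j))).
Proof.
move=> /face_weight[w1 w2 w3]; rewrite /angle (elenC _ i k) !elen_radii.
by rewrite !sqr_sqrtr ?ltW ?sqlen_gt0 // cos_lawC.
Qed.

Let heron_lengths u i j k : is_face T i j k ->
  (0 < face_heron u i j k) =
  [&& elen I (radii u) j k < elen I (radii u) i k + elen I (radii u) i j,
      elen I (radii u) i k < elen I (radii u) j k + elen I (radii u) i j &
      elen I (radii u) i j < elen I (radii u) j k + elen I (radii u) i k].
Proof.
move=> /face_weight[w1 w2 w3].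
have x0 := sqlen_gt0 (u 0 j) (u 0 k) w1; have y0 := sqlen_gt0 (u 0 k) (u 0 i) w2.
have z0 := sqlen_gt0 (u 0 i) (u 0 j) w3.
rewrite (elenC _ i k) !elen_radii /face_heron /tri_heron -cos_law_lt1 //.
move: x0 y0 z0; set x := sqlen _ _ _; set y := sqlen _ _ _; set z := sqlen _ _ _ => x0 y0 z0.
have [H1 H2] := cos_law_degenerate x y0 z0.
have sx : x = Num.sqrt x ^+ 2 by rewrite sqr_sqrtr // ltW.
have p0 := sqrtr_ge0 x; have q0 := sqrtr_ge0 y; have s0 := sqrtr_ge0 z.
have e1 : ((Num.sqrt y + Num.sqrt z) ^+ 2 <= x) = (Num.sqrt y + Num.sqrt z <= Num.sqrt x).
  by rewrite [in LHS]sx ler_sqr ?nnegrE // addr_ge0.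
have e2 : (x <= (Num.sqrt y - Num.sqrt z) ^+ 2) =
    (Num.sqrt x + Num.sqrt z <= Num.sqrt y) || (Num.sqrt x + Num.sqrt y <= Num.sqrt z).
  rewrite [in LHS]sx -(real_normK (x := Num.sqrt y - Num.sqrt z)) ?num_real //.
  by rewrite ler_sqr ?nnegrE // ler_normr opprB !lerBrDr.
by rewrite !ltNge H1 H2 e1 e2 negb_or.
Qed.

Lemma ext_angle_radii u i j k : is_face T i j k ->
  ext_angle I (radii u) i j k = face_angle u i j k.
Proof.
move=> f; have [w1 w2 w3] := face_weight f.
have [h|] := boolP (0 < face_heron u i j k).
  move: (h); rewrite heron_lengths // /ext_angle !ltNge => /and3P[/negPf -> /negPf -> /negPf ->] /=.
  rewrite angle_radiiE // /face_angle /tri_angle clamped_acosE //.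
  by move: h; rewrite /face_heron /tri_heron -cos_law_lt1 ?sqlen_gt0 // => /andP[c1 c2]; rewrite !ltW.
have x0 := sqlen_gt0 (u 0 j) (u 0 k) w1; have y0 := sqlen_gt0 (u 0 k) (u 0 i) w2.
have z0 := sqlen_gt0 (u 0 i) (u 0 j) w3.
rewrite heron_lengths // /ext_angle (elenC _ i k) !elen_radii /face_angle /tri_angle.
move: x0 y0 z0; set x := sqlen _ _ _; set y := sqlen _ _ _; set z := sqlen _ _ _ => x0 y0 z0.
have [H1 H2] := cos_law_degenerate x y0 z0.
have sx : x = Num.sqrt x ^+ 2 by rewrite sqr_sqrtr // ltW.
have p0 := sqrtr_ge0 x; have q0 := sqrtr_ge0 y; have s0 := sqrtr_ge0 z.
rewrite !negb_and -!leNgt; case: ifP => [c1 _|_ /= c2].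
  by rewrite clamped_acos_le // H2 [leRHS]sx ler_sqr ?nnegrE // addr_ge0.
rewrite c2 clamped_acos_ge // H1 [leLHS]sx.
by case/orP: c2 => c2; nra.
Qed.

Lemma admissible_radii u :
  admissible T I (radii u) <-> forall i j k, is_face T i j k -> 0 < face_heron u i j k.
Proof.
split=> [[_ H] i j k f|H].
  have f1 : is_face T j k i by rewrite -is_face_rot.
  have f2 : is_face T k i j by rewrite -is_face_rot.
  rewrite heron_lengths //; apply/and3P; split.
  - by have := H j k i; rewrite -/(is_face T j k i) (elenC _ i k) (elenC _ i j) => /(_ f1); rewrite addrC.
  - by have := H i k j; rewrite -/(is_face T i k j) -is_faceC => /(_ f); rewrite addrC (elenC _ j k).
  - by have := H i j k f; rewrite addrC (elenC _ j k).
split=> [|i j k f]; first exact: radii_gt0.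
by have := H _ _ _ f; rewrite heron_lengths // => /and3P[_ _]; rewrite addrC (elenC _ j k).
Qed.

Lemma angle_radii u i j k : admissible T I (radii u) -> is_face T i j k ->
  angle I (radii u) i j k = face_angle u i j k.
Proof.
move=> /admissible_radii H f; have [w1 w2 w3] := face_weight f.
rewrite angle_radiiE // /face_angle /tri_angle clamped_acosE //.
by have := H _ _ _ f; rewrite /face_heron /tri_heron -cos_law_lt1 ?sqlen_gt0 // => /andP[c1 c2]; rewrite !ltW.
Qed.

Lemma ext_Kcurv_radii u i : ext_Kcurv T I (radii u) i = log_curv u i.
Proof.
by congr (_ - _); apply: eq_bigr => p /andP[_ f]; exact: ext_angle_radii.
Qed.

Lemma Kcurv_radii u i : admissible T I (radii u) -> Kcurv T I (radii u) i = log_curv u i.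
Proof.
by move=> au; congr (_ - _); apply: eq_bigr => p /andP[_ f]; exact: angle_radii.
Qed.

Lemma log_curv_sum u : \sum_i log_curv u i = 2 * pi * (euler_char T)%:~R.
Proof.
by apply: gauss_bonnet; [exact: face_angleC|move=> i j k; exact: face_angle_sum].
Qed.

Definition face_pairing u i j k (w : 'I_N -> R) :=
  face_angle u i j k * w i + face_angle u j k i * w j + face_angle u k i j * w k.

Lemma log_curv_pairing u (w : 'I_N -> R) :
  \sum_i log_curv u i * w i = 2 * pi * \sum_i w i - 6^-1 * face_sum T (fun i j k => face_pairing u i j k w).
Proof. by rewrite sum_vertex_curv //; exact: face_angleC. Qed.

Lemma face_sumB (G1 G2 : 'I_N -> 'I_N -> 'I_N -> R) :
  face_sum T G1 - face_sum T G2 = face_sum T (fun i j k => G1 i j k - G2 i j k).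
Proof.
rewrite /face_sum -sumrB; apply: eq_bigr => i _; rewrite -sumrB; apply: eq_bigr => j _.
by rewrite -sumrB.
Qed.

Lemma face_sumZ c (G : 'I_N -> 'I_N -> 'I_N -> R) :
  face_sum T (fun i j k => c * G i j k) = c * face_sum T G.
Proof.
rewrite /face_sum mulr_sumr; apply: eq_bigr => i _; rewrite mulr_sumr; apply: eq_bigr => j _.
by rewrite mulr_sumr.
Qed.

Lemma face_sum_le (G1 G2 : 'I_N -> 'I_N -> 'I_N -> R) :
  (forall i j k, is_face T i j k -> G1 i j k <= G2 i j k) -> face_sum T G1 <= face_sum T G2.
Proof. by move=> H; apply: ler_sum => i _; apply: ler_sum => j _; apply: ler_sum => k; exact: H. Qed.

Lemma face_sum_ge1 (G : 'I_N -> 'I_N -> 'I_N -> R) i j k :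
  (forall i j k, is_face T i j k -> 0 <= G i j k) -> is_face T i j k -> G i j k <= face_sum T G.
Proof.
move=> G0 f; rewrite /face_sum (bigD1 i) //= (bigD1 j) //= (bigD1 k) //= -!addrA lerDl.
rewrite addr_ge0 ?sumr_ge0 // => [x /andP[fx _]|]; first exact: G0.
rewrite addr_ge0 ?sumr_ge0 // => [x _|x _].
  by apply: sumr_ge0 => y; exact: G0.
by apply: sumr_ge0 => y _; apply: sumr_ge0 => z; exact: G0.
Qed.

Lemma cvg_log_curv (S : Type) (F : set_system S) (FF : Filter F) (f : S -> 'rV[R]_N) u i :
  (forall j, f x 0 j @[x --> F] --> u 0 j) -> log_curv (f x) i @[x --> F] --> log_curv u i.
Proof.
move=> fu; apply: cvgB; first exact: cvg_cst.
apply: cvg_sumr => p /andP[_ fp]; have [w1 w2 w3] := face_weight fp.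
exact: cvg_tri_angle.
Qed.

Let pairing_alg (a c x y : R) : (a - c * x) - (a - c * y) = c * (y - x).
Proof. by ring. Qed.

Definition dirichlet d : R :=
  face_sum T (fun i j k => (d 0 i - d 0 k) ^+ 2 + (d 0 j - d 0 k) ^+ 2).

Lemma dirichlet_ge0 d : 0 <= dirichlet d.
Proof.
by apply: sumr_ge0 => i _; apply: sumr_ge0 => j _; apply: sumr_ge0 => k _; rewrite addr_ge0 ?sqr_ge0.
Qed.

(** The constant 2 pi cancels and each face contributes its own strict rate. The rate depends on B
    because strictness is available only near u. *)
Lemma log_curv_coercive u B : admissible T I (radii u) -> 0 < B ->
  exists2 m, 0 < m & forall d, (forall i, `|d 0 i| <= B) ->
    m * dirichlet d <= \sum_i (log_curv (u + d) i - log_curv u i) * d 0 i.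
Proof.
move=> /admissible_radii au B0.
pose P (p : 'I_N * 'I_N * 'I_N) (m : R) := is_face T p.1.1 p.1.2 p.2 -> forall d, (forall i, `|d 0 i| <= B) ->
  face_pairing (u + d) p.1.1 p.1.2 p.2 (d 0) - face_pairing u p.1.1 p.1.2 p.2 (d 0) <=
  - m * ((d 0 p.1.1 - d 0 p.2) ^+ 2 + (d 0 p.1.2 - d 0 p.2) ^+ 2).
have [] := @uniform_pos R _ P.
- move=> [[i j] k]; rewrite /P /=; have [f|] := boolP (is_face T i j k); last by exists 1.
  have [w1 w2 w3] := face_weight f.
  have [m m0 Hm] := tri_pairing_strict w1 w2 w3 (au _ _ _ f) B0.
  exists m => // _ d dB; have := Hm (d 0 i) (d 0 j) (d 0 k) (dB i) (dB j) (dB k).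
  by rewrite /face_pairing /face_angle !mxE.
- move=> p m m' m'0 mm H f d dB; apply: le_trans (H f d dB) _.
  by rewrite ler_wpM2r ?addr_ge0 ?sqr_ge0 // lerN2.
move=> m m0 Hm; exists (6^-1 * m); first by rewrite mulr_gt0.
move=> d dB; under eq_bigr do rewrite mulrBl.
rewrite sumrB !log_curv_pairing pairing_alg -mulrA ler_wpM2l //.
rewrite face_sumB /dirichlet -face_sumZ; apply: face_sum_le => i j k f.
by rewrite -lerN2 opprB -mulNr; exact: (Hm (i, j, k)).
Qed.

Lemma edge_path_dist d m i (p : seq 'I_N) : (forall a b, [set a; b]%SET \in edges T -> `|d 0 a - d 0 b| <= m) ->
  path (fun a b => [set a; b]%SET \in edges T) i p -> `|d 0 i - d 0 (last i p)| <= (size p)%:R * m.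
Proof.
move=> H; elim: p i => [|a p IHp] i /=; first by rewrite subrr normr0 mul0r.
move=> /andP[ia pp]; rewrite -natr1 mulrDl mul1r [leRHS]addrC.
rewrite (_ : d 0 i - _ = (d 0 i - d 0 a) + (d 0 a - d 0 (last a p))); last by ring.
by apply: le_trans (ler_normD _ _) _; rewrite lerD ?H // IHp.
Qed.

(** Along an edge d varies by at most the square root of [dirichlet], and a simple path has fewer
    than N edges. The sign condition, which plays the part of zero mean, then bounds every |d_i| by
    N times that root; squaring and summing over N vertices gives the cube. *)
Lemma poincare d : (exists i, d 0 i <= 0) -> (exists i, 0 <= d 0 i) ->
  \sum_i d 0 i ^+ 2 <= N%:R ^+ 3 * dirichlet d.
Proof.
move=> [a a0] [b b0]; set S := dirichlet d; have S0 : 0 <= S := dirichlet_ge0 d.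
have E x y : [set x; y]%SET \in edges T -> `|d 0 x - d 0 y| <= Num.sqrt S.
  move=> /edge_face[z f].
  rewrite -sqrtr_sqr ler_sqrt //.
  have f' : is_face T x z y by rewrite -is_faceC.
  pose G i j k := (d 0 i - d 0 k) ^+ 2 + (d 0 j - d 0 k) ^+ 2.
  have G0 i j k : is_face T i j k -> 0 <= G i j k by rewrite addr_ge0 ?sqr_ge0.
  by apply: le_trans (face_sum_ge1 G0 f'); rewrite /G lerDl sqr_ge0.
have D x y : `|d 0 x - d 0 y| <= N%:R * Num.sqrt S.
  have /connectP[p pp ->] := surface_connected T x y.
  case/shortenP: pp => p' pp' up' _.
  apply: le_trans (edge_path_dist E pp') _; rewrite ler_wpM2r ?sqrtr_ge0 // ler_nat.
  rewrite -[X in (_ <= X)%N](card_ord N) (leq_trans _ (max_card (mem (x :: p')))) //.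
  by rewrite (card_uniqP up') /=.
have B x : `|d 0 x| <= N%:R * Num.sqrt S.
  have := D x a; have := D b x; rewrite !ler_norml => /andP[h1 h2] /andP[h3 h4].
  by apply/andP; split; lra.
apply: (@le_trans _ _ (\sum_(i < N) (N%:R ^+ 2 * S))); last first.
  by rewrite sumr_const card_ord -[leLHS]mulr_natl [in leRHS]exprS -[leRHS]mulrA.
apply: ler_sum => i _; rewrite -(sqr_sqrtr S0) -exprMn -real_normK ?num_real //.
by rewrite ler_pXn2r ?nnegrE // mulr_ge0 ?sqrtr_ge0.
Qed.

End CurvatureMap.

(** * Collapsing sets of vertices *)

Section Collapse.
Variable R : realType.
Implicit Types (a b w u v : R).

Definition radius_ratio u v : R := expR ((u - v) / 2).

(* The cosine of the angle at a vertex, written with the ratios of its radius to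
   the two others (resp. of the two others to its radius). *)
Definition cos_small w1 w2 w3 a b :=
  (a * b + w2 * a + w3 * b - w1) / (Num.sqrt (b * b + 1 + 2 * w2 * b) * Num.sqrt (a * a + 1 + 2 * w3 * a)).
Definition cos_large w1 w2 w3 a b :=
  (1 + w2 * b + w3 * a - w1 * (a * b)) / (Num.sqrt (b * b + 1 + 2 * w2 * b) * Num.sqrt (a * a + 1 + 2 * w3 * a)).

Let quad_gt0 w a : 0 <= w -> 0 < a -> 0 < a * a + 1 + 2 * w * a.
Proof. by move=> w0 a0; rewrite ltr_wpDr ?addr_gt0 ?mulr_gt0 // !mulr_ge0 // ltW. Qed.

Let exp_half u : expR u = expR (u / 2) * expR (u / 2).
Proof. by rewrite -expRD; congr expR; field. Qed.

Let sqlen_split w u v : sqlen w u v =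
  expR (u / 2) * expR (u / 2) + expR (v / 2) * expR (v / 2) + 2 * w * (expR (u / 2) * expR (v / 2)).
Proof. by rewrite /sqlen (exp_half u) (exp_half v) [(u + v) / 2]mulrDl expRD. Qed.

Let radius_ratioE u v : radius_ratio u v = expR (u / 2) / expR (v / 2).
Proof. by rewrite /radius_ratio mulrBl expRD expRN. Qed.

Lemma cos_law_small w1 w2 w3 u1 u2 u3 : 0 <= w2 -> 0 <= w3 ->
  cos_law (sqlen w1 u2 u3) (sqlen w2 u3 u1) (sqlen w3 u1 u2) =
  cos_small w1 w2 w3 (radius_ratio u1 u2) (radius_ratio u1 u3).
Proof.
move=> w2_ge0 w3_ge0; rewrite /cos_law /cos_small !sqlen_split !radius_ratioE.
have := expR_gt0 (u1 / 2); have := expR_gt0 (u2 / 2); have := expR_gt0 (u3 / 2).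
move: (expR (u1 / 2)) (expR (u2 / 2)) (expR (u3 / 2)) => x y z z0 y0 x0.
have P0 := quad_gt0 w2_ge0 (divr_gt0 x0 z0); have Q0 := quad_gt0 w3_ge0 (divr_gt0 x0 y0).
have -> : z * z + x * x + 2 * w2 * (z * x) = z ^+ 2 * (x / z * (x / z) + 1 + 2 * w2 * (x / z)).
  by field; rewrite gt_eqF.
have -> : x * x + y * y + 2 * w3 * (x * y) = y ^+ 2 * (x / y * (x / y) + 1 + 2 * w3 * (x / y)).
  by field; rewrite gt_eqF.
rewrite !(sqrtrM _ (sqr_ge0 _)) !sqrtr_sqr !gtr0_norm //.
move: P0 Q0; rewrite -sqrtr_gt0 => P0; rewrite -sqrtr_gt0 => Q0; move: P0 Q0.
set p := Num.sqrt _; set q := Num.sqrt (x / y * _ + _ + _) => p0 q0.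
have -> : z ^+ 2 * (x / z * (x / z) + 1 + 2 * w2 * (x / z)) + y ^+ 2 * (x / y * (x / y) + 1 + 2 * w3 * (x / y)) -
   (y * y + z * z + 2 * w1 * (y * z)) = 2 * y * z * (x / y * (x / z) + w2 * (x / y) + w3 * (x / z) - w1).
  by field; rewrite !gt_eqF.
by field; rewrite !gt_eqF.
Qed.

Lemma cos_law_large w1 w2 w3 u1 u2 u3 : 0 <= w2 -> 0 <= w3 ->
  cos_law (sqlen w1 u2 u3) (sqlen w2 u3 u1) (sqlen w3 u1 u2) =
  cos_large w1 w2 w3 (radius_ratio u2 u1) (radius_ratio u3 u1).
Proof.
move=> w2_ge0 w3_ge0; rewrite /cos_law /cos_large !sqlen_split !radius_ratioE.
have := expR_gt0 (u1 / 2); have := expR_gt0 (u2 / 2); have := expR_gt0 (u3 / 2).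
move: (expR (u1 / 2)) (expR (u2 / 2)) (expR (u3 / 2)) => x y z z0 y0 x0.
have P0 := quad_gt0 w2_ge0 (divr_gt0 z0 x0); have Q0 := quad_gt0 w3_ge0 (divr_gt0 y0 x0).
have -> : z * z + x * x + 2 * w2 * (z * x) = x ^+ 2 * (z / x * (z / x) + 1 + 2 * w2 * (z / x)).
  by field; rewrite gt_eqF.
have -> : x * x + y * y + 2 * w3 * (x * y) = x ^+ 2 * (y / x * (y / x) + 1 + 2 * w3 * (y / x)).
  by field; rewrite gt_eqF.
rewrite !(sqrtrM _ (sqr_ge0 _)) !sqrtr_sqr !gtr0_norm //.
move: P0 Q0; rewrite -sqrtr_gt0 => P0; rewrite -sqrtr_gt0 => Q0; move: P0 Q0.
set p := Num.sqrt _; set q := Num.sqrt (y / x * _ + _ + _) => p0 q0.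
have -> : x ^+ 2 * (z / x * (z / x) + 1 + 2 * w2 * (z / x)) + x ^+ 2 * (y / x * (y / x) + 1 + 2 * w3 * (y / x)) -
   (y * y + z * z + 2 * w1 * (y * z)) = 2 * x * x * (1 + w2 * (z / x) + w3 * (y / x) - w1 * (y / x * (z / x))).
  by field; rewrite !gt_eqF.
by field; rewrite !gt_eqF.
Qed.

Let cf : x.1 @[x --> nbhs (0 : R, 0 : R)] --> (0 : R).
Proof. exact: cvg_fst. Qed.

Let cs : x.2 @[x --> nbhs (0 : R, 0 : R)] --> (0 : R).
Proof. exact: cvg_snd. Qed.

Let cvg_den w2 w3 :
  (Num.sqrt (x.2 * x.2 + 1 + 2 * w2 * x.2) * Num.sqrt (x.1 * x.1 + 1 + 2 * w3 * x.1))^-1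
   @[x --> nbhs (0 : R, 0 : R)] --> (1 : R).
Proof.
have cq w (f : R * R -> R) : f x @[x --> nbhs (0 : R, 0 : R)] --> (0 : R) ->
    Num.sqrt (f x * f x + 1 + 2 * w * f x) @[x --> nbhs (0 : R, 0 : R)] --> (1 : R).
  move=> f0; rewrite -[X in _ --> X]sqrtr1.
  apply: (@continuous_cvg _ _ _ _ _ (fun x => f x * f x + 1 + 2 * w * f x) Num.sqrt); first exact: sqrt_continuous.
  rewrite [X in _ --> X](_ : (1 : R) = 0 * 0 + 1 + 2 * w * 0); last by rewrite !mulr0 add0r addr0.
  apply: cvgD; first by apply: cvgD; [exact: cvgM|exact: cvg_cst].
  by apply: cvgM => //; exact: cvg_cst.
rewrite -[X in _ --> X]invr1 -[X in X^-1]mulr1; apply: cvgV; first by rewrite mulr1 oner_neq0.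
by apply: cvgM; [exact: (cq w2 snd)|exact: (cq w3 fst)].
Qed.

Lemma cvg_cos_small w1 w2 w3 :
  cos_small w1 w2 w3 x.1 x.2 @[x --> nbhs (0 : R, 0 : R)] --> - w1.
Proof.
rewrite -[X in _ --> X]mulr1; apply: cvgM; last exact: cvg_den.
rewrite [X in _ --> X](_ : - w1 = 0 * 0 + w2 * 0 + w3 * 0 - w1); last by rewrite !mulr0 !add0r.
apply: cvgB; last exact: cvg_cst.
apply: cvgD; [apply: cvgD; first exact: cvgM|]; by apply: cvgM => //; exact: cvg_cst.
Qed.

Lemma cvg_cos_large w1 w2 w3 :
  cos_large w1 w2 w3 x.1 x.2 @[x --> nbhs (0 : R, 0 : R)] --> (1 : R).
Proof.
rewrite -[X in _ --> X]mulr1; apply: cvgM; last exact: cvg_den.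
rewrite [X in _ --> X](_ : (1 : R) = 1 + w2 * 0 + w3 * 0 - w1 * (0 * 0)); last by rewrite !mulr0 !addr0 subr0.
apply: cvgB; last by apply: cvgM; [exact: cvg_cst|exact: cvgM].
apply: cvgD; first apply: cvgD; first exact: cvg_cst.
  by apply: cvgM => //; exact: cvg_cst.
by apply: cvgM => //; exact: cvg_cst.
Qed.

Let prod_ball (P : set (R * R)) : nbhs (0 : R, 0 : R) P ->
  exists2 r : R, 0 < r & forall a b, 0 < a <= r -> 0 < b <= r -> P (a, b).
Proof.
move=> /nbhs_ballP[r /= r0 Hr]; exists (r / 2); first by rewrite divr_gt0.
move=> a b /andP[a0 ar] /andP[b0 br]; apply: Hr.
have r2 : r / 2 < r by rewrite ltr_pdivrMr // ltr_pMr // ltr1n.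
by split; rewrite /ball/= sub0r normrN gtr0_norm //; [apply: le_lt_trans ar _|apply: le_lt_trans br _].
Qed.

Section Weights.
Variables (w1 w2 w3 v1 v2 v3 : R).
Hypotheses (w1_ge0 : 0 <= w1) (w2_ge0 : 0 <= w2) (w3_ge0 : 0 <= w3).
Hypothesis nondeg : 0 < tri_heron w1 w2 w3 v1 v2 v3.

(* The limit angle has cosine [- w1], below the cosine of the given angle because
   both sides at the vertex are longer than the opposite radii. *)
Lemma tri_angle_small : exists2 e, 0 < e & forall u1 u2 u3, radius_ratio u1 u2 <= e -> radius_ratio u1 u3 <= e ->
  tri_angle w1 w2 w3 v1 v2 v3 + e <= tri_angle w1 w2 w3 u1 u2 u3.
Proof.
pose c := cos_law (sqlen w1 v2 v3) (sqlen w2 v3 v1) (sqlen w3 v1 v2).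
have /andP[c1 c2] : -1 < c < 1 by rewrite cos_law_lt1 // sqlen_gt0.
have cw : - w1 < c.
  rewrite /c cos_law_small // /cos_small; set a := radius_ratio v1 v2; set b := radius_ratio v1 v3.
  have a0 : 0 < a by exact: expR_gt0.
  have b0 : 0 < b by exact: expR_gt0.
  have p1 : 1 <= Num.sqrt (b * b + 1 + 2 * w2 * b).
    rewrite -[leLHS]sqrtr1 ler_sqrt; last by rewrite ltW // quad_gt0.
    by rewrite addrAC lerDr addr_ge0 ?mulr_ge0 // ltW.
  have q1 : 1 <= Num.sqrt (a * a + 1 + 2 * w3 * a).
    rewrite -[leLHS]sqrtr1 ler_sqrt; last by rewrite ltW // quad_gt0.
    by rewrite addrAC lerDr addr_ge0 ?mulr_ge0 // ltW.
  have pq1 : 1 <= Num.sqrt (b * b + 1 + 2 * w2 * b) * Num.sqrt (a * a + 1 + 2 * w3 * a) by rewrite mulr_ege1.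
  rewrite ltr_pdivlMr ?(lt_le_trans _ pq1) //.
  apply: (@le_lt_trans _ _ (- w1)); first by rewrite mulNr lerN2 ler_peMr.
  have h1 : 0 < a * b by exact: mulr_gt0.
  have h2 : 0 <= w2 * a by rewrite mulr_ge0 // ltW.
  have h3 : 0 <= w3 * b by rewrite mulr_ge0 // ltW.
  by lra.
have Hlt := clamped_acos_lt cw c1 c2.
have Hc : clamped_acos (cos_small w1 w2 w3 x.1 x.2) @[x --> nbhs (0 : R, 0 : R)] --> clamped_acos (- w1).
  by apply: continuous_cvg; [exact: clamped_acos_continuous|exact: cvg_cos_small].
pose D := (clamped_acos (- w1) - clamped_acos c) / 2.
have D0 : 0 < D by rewrite divr_gt0 // subr_gt0.
have Dm : clamped_acos c + D < clamped_acos (- w1) by rewrite /D; lra.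
move/cvgr_ge : Hc => /(_ _ Dm)/prod_ball[r r0 Hr].
exists (Num.min r D); first by rewrite lt_min r0.
move=> u1 u2 u3; rewrite !le_min => /andP[a1 _] /andP[b1 _].
apply: (@le_trans _ _ (clamped_acos c + D)); first by rewrite lerD2l ge_min lexx orbT.
rewrite /tri_angle cos_law_small //.
by apply: (Hr (radius_ratio u1 u2) (radius_ratio u1 u3)); rewrite expR_gt0.
Qed.

(** When the two other radii become negligible the cosine tends to 1 and the angle to 0, whereas the
    given angle is positive. *)
Lemma tri_angle_large : exists2 e, 0 < e & forall u1 u2 u3, radius_ratio u2 u1 <= e -> radius_ratio u3 u1 <= e ->
  tri_angle w1 w2 w3 u1 u2 u3 + e <= tri_angle w1 w2 w3 v1 v2 v3.
Proof.
pose c := cos_law (sqlen w1 v2 v3) (sqlen w2 v3 v1) (sqlen w3 v1 v2).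
have /andP[c1 c2] : -1 < c < 1 by rewrite cos_law_lt1 // sqlen_gt0.
have Hlt := clamped_acos_gt0 c2.
have Hc : clamped_acos (cos_large w1 w2 w3 x.1 x.2) @[x --> nbhs (0 : R, 0 : R)] --> (0 : R).
  rewrite -[X in _ --> X](clamped_acos_ge (lexx 1)).
  by apply: continuous_cvg; [exact: clamped_acos_continuous|exact: cvg_cos_large].
pose D := clamped_acos c / 2.
have D0 : 0 < D by rewrite divr_gt0.
move/cvgr_le : Hc => /(_ _ D0)/prod_ball[r r0 Hr].
exists (Num.min r D); first by rewrite lt_min r0.
move=> u1 u2 u3; rewrite !le_min => /andP[a1 _] /andP[b1 _].
rewrite /tri_angle cos_law_large //.
have H : clamped_acos (cos_large w1 w2 w3 (radius_ratio u2 u1) (radius_ratio u3 u1)) <= D.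
  by apply: (Hr (radius_ratio u2 u1) (radius_ratio u3 u1)); rewrite expR_gt0.
have H2 : Num.min r D <= D by rewrite ge_min lexx orbT.
by rewrite -/c; apply: (le_trans (lerD H H2)); rewrite /D; lra.
Qed.

End Weights.
End Collapse.

(** * Total curvature of a collapsing set of vertices *)

Section Barrier.
Variables (R : realType) (N : nat) (T : triangulated_surface N) (I : {set 'I_N} -> R).
Hypothesis I_ge0 : weight_nonneg T I.
Implicit Types (i j k : 'I_N) (u v : 'rV[R]_N) (A : {set 'I_N}).

Definition far_below A (e : R) u := forall a b, a \in A -> b \notin A -> radius_ratio (u 0 a) (u 0 b) <= e.

Lemma connected_boundary A : A != finset.set0 -> A != [set: 'I_N]%SET ->
  exists a b, [/\ a \in A, b \notin A & [set a; b]%SET \in edges T].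
Proof.
move=> /set0Pn[x xA] nT; apply: contrapT => H.
have nx a b : a \in A -> [set a; b]%SET \in edges T -> b \in A.
  by move=> aA ab; apply: contrapT => /negP bA; apply: H; exists a, b.
case/negP: nT; apply/eqP/finset.setP => y; rewrite !inE.
have /connectP[p pp ->] := surface_connected T x y.
elim: p x xA pp => [|z p IHp] x xA //= /andP[xz pp]; apply: IHp pp.
exact: nx xz.
Qed.

Let ind A i : R := (i \in A)%:R.

Variable v : 'rV[R]_N.
Hypothesis v_adm : admissible T I (radii v).

Let vh i j k : is_face T i j k -> 0 < face_heron I v i j k.
Proof. by move/(admissible_radii I_ge0) : v_adm => + f => /(_ _ _ _ f). Qed.

Let one A i j k : is_face T i j k -> i \in A -> j \notin A -> k \notin A ->
  exists2 e, 0 < e & forall u, far_below A e u -> face_angle I v i j k + e <= face_angle I u i j k.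
Proof.
move=> f iA jA kA; have [w1 w2 w3] := face_weight I_ge0 f.
have [e e0 He] := tri_angle_small w1 w2 w3 (vh f).
by exists e => // u Au; apply: He; apply: Au.
Qed.

Let two A i j k : is_face T i j k -> i \notin A -> j \in A -> k \in A ->
  exists2 e, 0 < e & forall u, far_below A e u -> face_angle I u i j k + e <= face_angle I v i j k.
Proof.
move=> f iA jA kA; have [w1 w2 w3] := face_weight I_ge0 f.
have [e e0 He] := tri_angle_large w2 w3 (vh f).
by exists e => // u Au; apply: He; apply: Au.
Qed.

(** With one vertex in A its angle grows; with two, the pairing is pi minus the angle at the third
    vertex, which shrinks; with none or three it is 0 or pi for u and v alike. Recording the gain
    only when A separates i from j is enough, since a boundary edge of A can be listed first in its
    face. *)
Lemma face_pairing_collapse A i j k : is_face T i j k ->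
  exists2 e, 0 < e & forall u, far_below A e u ->
    face_pairing I v i j k (ind A) + e * (~~ ((i \in A) == (j \in A)) )%:R <=
    face_pairing I u i j k (ind A).
Proof.
move=> f; have f1 : is_face T j k i by rewrite -is_face_rot.
have f2 : is_face T k i j by rewrite -is_face_rot.
have sv := face_angle_sum I_ge0 v f.
have su u := face_angle_sum I_ge0 u f.
rewrite /face_pairing /ind.
have [iA|iA] := boolP (i \in A); have [jA|jA] := boolP (j \in A); have [kA|kA] := boolP (k \in A);
  rewrite /=.
- by exists 1 => // u _; have := su u; lra.
- have [e e0 He] := two f2 kA iA jA; exists e => // u /He H.
  by have := su u; lra.
- have [e e0 He] := two f1 jA kA iA; exists e => // u /He H.
  by have := su u; lra.
- have [e e0 He] := one f iA jA kA; exists e => // u /He H; lra.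
- have [e e0 He] := two f iA jA kA; exists e => // u /He H.
  by have := su u; lra.
- have [e e0 He] := one f1 jA kA iA; exists e => // u /He H; lra.
- have [e e0 He] := one f2 kA iA jA; exists e => // u /He H; lra.
- by exists 1 => // u _; lra.
Qed.

Lemma far_below_le A e e' u : e' <= e -> far_below A e' u -> far_below A e u.
Proof. by move=> ee H a b aA bA; apply: le_trans (H a b aA bA) ee. Qed.

Lemma log_curv_collapse A : A != finset.set0 -> A != [set: 'I_N]%SET ->
  exists2 e, 0 < e & forall u, far_below A e u ->
    \sum_(i in A) log_curv T I u i <= \sum_(i in A) log_curv T I v i - e.
Proof.
move=> A0 AT; have [a [b [aA bA ab]]] := connected_boundary A0 AT.
have [c fabc] := edge_face ab.
pose P (p : 'I_N * 'I_N * 'I_N) (e : R) := is_face T p.1.1 p.1.2 p.2 -> forall u, far_below A e u ->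
    face_pairing I v p.1.1 p.1.2 p.2 (ind A) + e * (~~ ((p.1.1 \in A) == (p.1.2 \in A)) )%:R <=
    face_pairing I u p.1.1 p.1.2 p.2 (ind A).
have [] := @uniform_pos R _ P.
- move=> [[i j] k]; rewrite /P /=; have [f|] := boolP (is_face T i j k); last by exists 1.
  by have [e e0 He] := face_pairing_collapse A f; exists e.
- move=> p e e' e'0 ee H f u Au; have := H f u (far_below_le ee Au).
  by apply: le_trans; rewrite lerD2l ler_wpM2r.
(* The first bound makes the collapse hypothesis strong enough for He; the second is the gain left
   after the factor 1/6 of the sum over ordered triples. *)
move=> e e0 He; exists (Num.min e (6^-1 * e)); first by rewrite lt_min e0 mulr_gt0.
move=> u /(far_below_le (e := e)); rewrite ge_min lexx => /(_ isT) Au.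
have E x : \sum_(i in A) log_curv T I x i = \sum_i log_curv T I x i * ind A i.
  rewrite big_mkcond; apply: eq_bigr => i _; rewrite /ind.
  by case: ifP => _; rewrite ?mulr1 ?mulr0.
rewrite !E !log_curv_pairing -addrA lerD2l -opprD lerN2.
apply: (@le_trans _ _ (6^-1 * (face_sum T (fun i j k => face_pairing I v i j k (ind A)) + e))).
  by rewrite mulrDr lerD2l ge_min lexx orbT.
rewrite ler_wpM2l // addrC -lerBrDr face_sumB.
apply: (@le_trans _ _ (face_sum T (fun i j k => e * (~~ ((i \in A) == (j \in A)))%:R))).
  have := face_sum_ge1 (T := T) (G := fun i j k => e * (~~ ((i \in A) == (j \in A)))%:R) _ fabc.
  rewrite aA (negPf bA) /= mulr1; apply => i j k _.
  by rewrite mulr_ge0 // ltW.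
apply: face_sum_le => i j k f; rewrite lerBrDl.
exact: (He (i, j, k)).
Qed.

Lemma barrier_curv : (forall A, \sum_(i in A) log_curv T I v i <= 0) ->
  exists2 e, 0 < e & forall A, A != finset.set0 -> A != [set: 'I_N]%SET -> forall u, far_below A e u ->
    \sum_(i in A) log_curv T I u i <= - e.
Proof.
move=> v0; apply: uniform_pos => [A|A e e' _ ee H A0 AT u Au].
  have [A0|A0] := boolP (A != finset.set0); last by exists 1.
  have [AT|AT] := boolP (A != [set: 'I_N]%SET); last by exists 1.
  have [e e0 He] := log_curv_collapse A0 AT; exists e => // _ _ u Au.
  by apply: le_trans (He u Au) _; rewrite gerDr.
by apply: le_trans (H A0 AT u (far_below_le ee Au)) _; rewrite lerN2.
Qed.

End Barrier.

(** * Peano's theorem *)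

Section Peano.
Variable R : realType.

(* A cluster point of a pointwise bounded sequence of functions in the topology of
   pointwise convergence, obtained as a limit along an ultrafilter. *)
Lemma pointwise_cluster (S : eqType) (a : nat -> S -> R) (B : S -> R) :
  (forall n s, `|a n s| <= B s) ->
  exists b : S -> R, forall (l : seq S) (e : R) (n0 : nat), 0 < e ->
    exists2 n, (n0 <= n)%N & forall s, s \in l -> `|a n s - b s| < e.
Proof.
move=> aB; have [U [UU sU]] := @ultraFilterLemma nat \oo _.
have PU : ProperFilter U by exact: ultra_proper.
have lim s : exists p : R, a n s @[n --> U] --> p.
  have [|p [_ cp]] := @segment_compact R (- B s) (B s) (a n s @[n --> U]).
    by apply: (@filterE _ U) => n; rewrite /= in_itv/= -ler_norml; exact: aB.
  exists p; apply/cvgrPdist_lt => e e0.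
  have [//|nU] := in_ultra_setVsetC [set n | `|p - a n s| < e] UU.
  have [x [/= H1 H2]] := cp _ _ (nU : (a n s @[n --> U]) [set x | ~ `|p - x| < e]) (nbhsx_ballx p e e0).
  by [].
exists (fun s => projT1 (cid (lim s))) => l e n0 e0.
have H1 : U [set n | (n0 <= n)%N] by exact: (sU _ (nbhs_infty_ge n0)).
have H2 : U [set n | forall s, s \in l -> `|a n s - projT1 (cid (lim s))| < e].
  elim: l => [|s l IHl]; first by apply: (@filterE _ U) => n s.
  have Hs : U [set n | `|a n s - projT1 (cid (lim s))| < e].
    case: (cid (lim s)) => p /= /cvgrPdist_lt /(_ _ e0); apply: filterS => n; by rewrite /= distrC.
  apply: filterS (filterI Hs IHl) => n [/= K1 K2] t; rewrite inE => /predU1P[->|]; first exact: K1.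
  exact: K2.
by have [n [/= h1 h2]] := filter_ex (filterI H1 H2); exists n.
Qed.

Section Euler.
Variables (N : nat) (F : 'rV[R]_N -> 'I_N -> R) (u0 : 'rV[R]_N).

Fixpoint euler (n k : nat) : 'rV[R]_N :=
  if k is k'.+1 then \row_i (euler n k' 0 i + F (euler n k') i / n.+1%:R) else u0.

(** Taken with y = 0 it is a Lipschitz bound for the polygons, with y the field at a limit point it
    becomes the derivative estimate. *)
Lemma euler_dist (y : 'I_N -> R) e n l m : (l <= m)%N ->
  (forall q i, (l <= q < m)%N -> `|F (euler n q) i - y i| <= e) ->
  forall i, `|euler n m 0 i - euler n l 0 i - (m - l)%:R / n.+1%:R * y i| <= (m - l)%:R / n.+1%:R * e.
Proof.
elim: m => [|m IHm] lm H i.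
  by move: lm; rewrite leqn0 => /eqP ->; rewrite subrr !mul0r subrr normr0.
move: lm; rewrite leq_eqVlt => /predU1P[->|lm].
  by rewrite subnn subrr !mul0r subrr normr0.
have H' q j : (l <= q < m)%N -> `|F (euler n q) j - y j| <= e.
  by move=> /andP[lq qm]; apply: H; rewrite lq (ltn_trans qm).
have lm' : (l <= m)%N := lm.
have := IHm lm H' i; have := H m i; rewrite lm' ltnSn => /(_ isT) h1 h2.
rewrite subSn // /= mxE -(natr1 (m - l)%N).
set E := euler n m 0 i in h2 *; set d := (m - l)%:R / _ in h2; set c : R := n.+1%:R.
have c0 : 0 < c by rewrite ltr0n.
rewrite (_ : _ - _ - _ = (E - euler n l 0 i - d * y i) + (F (euler n m) i - y i) / c); last first.
  by rewrite /d -/c; field; rewrite gt_eqF.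
rewrite (_ : ((m - l)%:R + 1) / c * e = d * e + c^-1 * e); last by rewrite /d -/c; ring.
apply: le_trans (ler_normD _ _) _; rewrite lerD //.
by rewrite normrM (gtr0_norm (x := c^-1)) ?invr_gt0 // mulrC ler_wpM2l // invr_ge0 ltW.
Qed.

End Euler.

Definition coord_continuous_at (N : nat) (F : 'rV[R]_N -> 'I_N -> R) (y : 'rV[R]_N) :=
  forall e : R, 0 < e -> exists2 d : R, 0 < d & forall z : 'rV[R]_N,
    (forall j, `|z 0 j - y 0 j| < d) -> forall i, `|F z i - F y i| <= e.

Lemma peano (N : nat) (F : 'rV[R]_N -> 'I_N -> R) (u0 : 'rV[R]_N) :
  (forall y, coord_continuous_at F y) ->
  exists2 h, 0 < h & exists2 u : R -> 'rV[R]_N, u 0 = u0 &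
    forall t i, 0 <= t < h -> has_deriv_within [set s | 0 <= s < h] (fun s => u s 0 i) t (F (u t) i).
Proof.
move=> Fc; have [r r0 Hr] := Fc u0 1 ltr01.
pose M := 1 + \sum_i `|F u0 i|.
have M0 : 0 < M by rewrite ltr_pwDl // sumr_ge0.
have FM (z : 'rV[R]_N) : (forall j, `|z 0 j - u0 0 j| < r) -> forall i, `|F z i| <= M.
  move=> /Hr H i; have := H i; rewrite /M (bigD1 i) //= => Hi.
  have : 0 <= \sum_(j | j != i) `|F u0 j| by exact: sumr_ge0.
  have := ler_normD (F z i - F u0 i) (F u0 i); rewrite subrK; lra.
(* Up to time h a polygon of speed at most M stays within r / 2 of u0, inside the ball where the
   bound M holds. *)
pose h := r / (2 * M); have h0 : 0 < h by rewrite divr_gt0 // mulr_gt0.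
have hM : h * M = r / 2 by rewrite /h; field; rewrite gt_eqF.
pose c n : R := n.+1%:R.
have c0 n : 0 < c n by rewrite ltr0n.
have near n k : k%:R / c n <= h -> forall i, `|euler F u0 n k 0 i - u0 0 i| <= k%:R / c n * M.
  elim: k => [|k IHk] kh i; first by rewrite subrr normr0 mul0r mul0r.
  have kle : k%:R / c n <= h.
    by apply: le_trans kh; rewrite ler_pM2r ?invr_gt0 ?c0 // ler_nat.
  have Fk : `|F (euler F u0 n k) i| <= M.
    apply: FM => j; apply: le_lt_trans (IHk kle j) _.
    apply: (@le_lt_trans _ _ (h * M)); first by rewrite ler_pM2r.
    by rewrite hM ltr_pdivrMr // ltr_pMr // ltr1n.
  rewrite /= mxE addrAC -(natr1 k) (_ : (k%:R + 1) / c n * M = k%:R / c n * M + (c n)^-1 * M); last by ring.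
  apply: le_trans (ler_normD _ _) _; rewrite lerD ?IHk //.
  by rewrite normrM (gtr0_norm (x := _^-1)) ?invr_gt0 ?c0 // mulrC ler_pM2l ?invr_gt0 ?c0.
have near' n k : k%:R / c n <= h -> forall i, `|euler F u0 n k 0 i - u0 0 i| < r.
  move=> kh i; apply: le_lt_trans (near n k kh i) _.
  apply: (@le_lt_trans _ _ (h * M)); first by rewrite ler_pM2r.
  by rewrite hM ltr_pdivrMr // ltr_pMr // ltr1n.
have lip n l m : (l <= m)%N -> m%:R / c n <= h ->
    forall i, `|euler F u0 n m 0 i - euler F u0 n l 0 i| <= (m - l)%:R / c n * M.
  move=> lm mh i; have := @euler_dist N F u0 (fun=> 0) M n l m lm _ i.
  rewrite mulr0 subr0; apply => q j /andP[_ qm]; rewrite subr0; apply: FM; apply: near'.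
  by apply: le_trans mh; rewrite ler_pM2r ?invr_gt0 ?c0 // ler_nat ltnW.
(* Index of the last step before time t: polygons are used as step functions, at the price of a time
   error of at most one step. *)
pose k n t := Num.truncn (t * c n).
have kP n t : 0 <= t -> (k n t)%:R <= t * c n < (k n t)%:R + 1.
  by move=> t0; rewrite natr1 truncn_itv // mulr_ge0 // ltW.
have kh n t : 0 <= t <= h -> (k n t)%:R / c n <= h.
  move=> /andP[t0 th]; rewrite ler_pdivrMr //; have /andP[k1 _] := kP n t t0.
  by apply: le_trans k1 _; rewrite ler_pM2r.
(* The cluster lemma asks for a bound at every real time; clipping keeps the argument in [0, h]. *)
pose clip t := Num.max 0 (Num.min h t).
have clipP t : 0 <= clip t <= h.
  by rewrite /clip le_max lexx ge_max ge_min lexx (ltW h0).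
have clipE t : 0 <= t <= h -> clip t = t.
  by move=> /andP[t0 th]; rewrite /clip (min_idPr th) (max_idPr t0).
pose a n (s : R * 'I_N) := euler F u0 n (k n (clip s.1)) 0 s.2.
have [b bP] : exists b : R * 'I_N -> R, forall (l : seq (R * 'I_N)) (e : R) (n0 : nat), 0 < e ->
    exists2 n, (n0 <= n)%N & forall s, s \in l -> `|a n s - b s| < e.
  apply: (@pointwise_cluster _ a (fun s => `|u0 0 s.2| + r)) => n s.
  have := near' n _ (kh n _ (clipP s.1)) s.2; rewrite -/(a n s) => H.
  by have := ler_normD (a n s - u0 0 s.2) (u0 0 s.2); rewrite subrK; lra.
exists h => //; exists (fun t => \row_i b (t, i)).
  apply/rowP => i; rewrite mxE; apply/eqP; rewrite -subr_eq0 -normr_le0 leNgt; apply/negP => e0.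
  have [n _ /(_ (0, i))] := bP [:: (0, i)] _ 0%N e0.
  rewrite inE eqxx => /(_ isT); rewrite /a /= clipE ?lexx ?ltW // /k mul0r truncn0 /=.
  by rewrite distrC ltxx.
pose u t : 'rV[R]_N := \row_i b (t, i).
move=> t i /andP[t0 th]; rewrite -/(u t); apply/has_deriv_withinP => e e0.
have [d d0 Hd] := Fc (u t) e e0.
exists (Num.min d (d / (4 * M))); first by rewrite lt_min d0 divr_gt0 // mulr_gt0.
move=> s /= /andP[s0 sh]; rewrite lt_min => /andP[_ sd].
(* The polygon is chosen after s, so the estimate is proved up to an arbitrary eta. The constant C
   below collects the errors: twice the distance z to the polygon, and the time error weighted by e
   and by the field. *)
apply/ler_addgt0Pr => eta eta0.
pose C := 2 + e + `|F (u t) i|.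
have C0 : 0 < C by rewrite /C ltr_pwDl // addr_gt0.
pose z := Num.min (d / 4) (eta / C).
have z0 : 0 < z by rewrite lt_min !divr_gt0.
have [n0 n0P] : exists n0 : nat, forall n, (n0 <= n)%N -> (c n)^-1 < Num.min (d / (4 * M)) (eta / C).
  have w0 : 0 < Num.min (d / (4 * M)) (eta / C) by rewrite lt_min !divr_gt0 // mulr_gt0.
  exists (Num.truncn (Num.min (d / (4 * M)) (eta / C))^-1) => n nn.
  rewrite invf_plt ?posrE // /c; apply: lt_le_trans (truncnS_gt _) _.
  by rewrite ler_nat.
have [n nn0 Hn] := bP ([seq (t, j) | j : 'I_N] ++ [:: (s, i)]) z n0 z0.
have cn := n0P n nn0; move: cn; rewrite lt_min => /andP[cn1 cn2].
have Ht j : `|a n (t, j) - u t 0 j| < z.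
  by rewrite mxE; apply: Hn; rewrite mem_cat map_f // mem_enum.
have Hs : `|a n (s, i) - b (s, i)| < z by apply: Hn; rewrite mem_cat !inE eqxx orbT.
have at_ j : a n (t, j) = euler F u0 n (k n t) 0 j by rewrite /a /= clipE // t0 ltW.
have as_ : a n (s, i) = euler F u0 n (k n s) 0 i by rewrite /a /= clipE // s0 ltW.
have zd : z <= d / 4 by rewrite ge_min lexx.
have ze : z <= eta / C by rewrite ge_min lexx orbT.
have khs : (k n s)%:R / c n <= h by apply: kh; rewrite s0 ltW.
have kht : (k n t)%:R / c n <= h by apply: kh; rewrite t0 ltW.
have /andP[ks1 ks2] := kP n s s0; have /andP[kt1 kt2] := kP n t t0.
have steps x y : 0 <= x -> x <= y -> (k n x <= k n y)%N /\ `|(k n y - k n x)%:R / c n - (y - x)| <= (c n)^-1.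
  move=> x0 xy; have xyc : x * c n <= y * c n by rewrite ler_pM2r.
  have kk : (k n x <= k n y)%N by apply: le_truncn.
  split=> //; have /andP[h1 h2] := kP n x x0; have /andP[h3 h4] := kP n y (le_trans x0 xy).
  rewrite natrB // (_ : _ - _ = ((k n y)%:R - (k n x)%:R - (y * c n - x * c n)) / c n); last first.
    by field; rewrite gt_eqF.
  rewrite normrM (gtr0_norm (x := _^-1)) ?invr_gt0 // -[leRHS]mul1r ler_pM2r ?invr_gt0 //.
  by rewrite ler_norml; apply/andP; split; lra.
have kappa x y : 0 <= x -> x <= y -> `|y - x| < d / (4 * M) -> (k n y - k n x)%:R / c n * M < d / 2.
  move=> x0 xy yx; have [_ st] := steps x y x0 xy.
  have : (k n y - k n x)%:R / c n < d / (4 * M) + d / (4 * M).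
    rewrite (ger0_norm (x := y - x)) ?subr_ge0 // in yx.
    have /andP[_ st'] : - (c n)^-1 <= (k n y - k n x)%:R / c n - (y - x) <= (c n)^-1 by rewrite -ler_norml.
    apply: (@le_lt_trans _ _ ((y - x) + (c n)^-1)); first by rewrite addrC -lerBlDr.
    exact: ltrD.
  rewrite -(ltr_pM2r M0) => H; apply: lt_le_trans H _.
  by rewrite le_eqVlt; apply/orP; left; apply/eqP; field; rewrite gt_eqF.
(* One end lies within d / 4 of u t and the polygon moves by less than d / 2, so all vertices in
   between stay where the field is e-close. The alternative tells whether t is the left or the right
   end. *)
have between l m q : (l <= q <= m)%N -> m%:R / c n <= h -> (m - l)%:R / c n * M < d / 2 ->
    (forall j, `|euler F u0 n l 0 j - u t 0 j| < z) \/ (forall j, `|euler F u0 n m 0 j - u t 0 j| < z) ->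
    forall j, `|euler F u0 n q 0 j - u t 0 j| < d.
  move=> /andP[lq qm] mh ml H j.
  have qh : q%:R / c n <= h by apply: le_trans mh; rewrite ler_pM2r ?invr_gt0 // ler_nat.
  have mono p : (p <= m - l)%N -> p%:R / c n * M < d / 2.
    by move=> pm; apply: le_lt_trans ml; rewrite ler_pM2r // ler_pM2r ?invr_gt0 // ler_nat.
  case: H => /(_ j) H.
    have h1 := le_lt_trans (lip n l q lq qh j) (mono (q - l)%N (leq_sub2r _ qm)).
    have := ler_distD (euler F u0 n l 0 j) (euler F u0 n q 0 j) (u t 0 j).
    lra.
  have h1 := le_lt_trans (lip n q m qm mh j) (mono (m - q)%N (leq_sub2l _ lq)).
  have := ler_distD (euler F u0 n m 0 j) (euler F u0 n q 0 j) (u t 0 j).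
  by rewrite (distrC (euler F u0 n q 0 j) (euler F u0 n m 0 j)); lra.
have arith (X Y x y kap D f : R) : `|X - Y - kap * f| <= kap * e -> `|kap - D| <= (c n)^-1 ->
    `|X - x| < z -> `|Y - y| < z -> 0 <= D -> `|f| <= `|F (u t) i| -> `|x - y - f * D| <= e * D + eta.
  move=> H1 H2 H3 H4 D0 fF.
  have E : x - y - f * D = (X - Y - kap * f) - (X - x) + (Y - y) + f * (kap - D) by ring.
  have H5 : `|f * (kap - D)| <= `|F (u t) i| * (c n)^-1 by rewrite normrM ler_pM.
  have H6 : kap * e <= e * D + e * (c n)^-1.
    by rewrite -mulrDr mulrC ler_wpM2l ?(ltW e0) //; by move: H2; rewrite ler_norml => /andP[_]; rewrite lerBlDl.
  have H7 : 2 * z + e * (c n)^-1 + `|F (u t) i| * (c n)^-1 <= eta.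
    apply: (@le_trans _ _ (C * (eta / C))); last by rewrite mulrCA divff ?gt_eqF // mulr1.
    move: ze (ltW cn2); move: (eta / C) => w ze' cn'; rewrite /C.
    rewrite (_ : (2 + e + `|F (u t) i|) * w = 2 * w + e * w + `|F (u t) i| * w); last by ring.
    apply: lerD; last by apply: ler_wpM2l.
    by apply: lerD; [apply: ler_wpM2l|apply: ler_wpM2l => //; exact: ltW].
  have n2 := ler_normD (X - Y - kap * f - (X - x)) (Y - y).
  have n3 := ler_normB (X - Y - kap * f) (X - x).
  rewrite E; apply: le_trans (ler_normD _ _) _.
  apply: (@le_trans _ _ ((kap * e + z + z) + `|F (u t) i| * (c n)^-1)).
    rewrite lerD // (le_trans n2) // lerD ?(ltW H4) // (le_trans n3) // lerD // ltW //.
  by move: H6 H7; move: (c n)^-1 => ci; lra.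
suff : `|b (s, i) - b (t, i) - F (u t) i * (s - t)| <= e * `|s - t| + eta by rewrite !mxE.
have [ts|/ltW st] := leP t s.
  have [kk kst] := steps t s t0 ts.
  rewrite (ger0_norm (x := s - t)) ?subr_ge0 //.
  apply: (arith (a n (s, i)) (a n (t, i)) _ _ ((k n s - k n t)%:R / c n)) => //.
  - rewrite as_ at_; apply: euler_dist => // q j /andP[lq qm]; apply: Hd => x.
    apply: (between (k n t) (k n s)) => //; first by rewrite lq ltnW.
      exact: kappa.
    by left => y; rewrite -at_.
  - by have := Ht i; rewrite mxE.
  - by rewrite subr_ge0.
have [kk kst] := steps s t s0 st.
rewrite distrC in sd; rewrite (distrC s) (ger0_norm (x := t - s)) ?subr_ge0 //.
rewrite (_ : b (s, i) - b (t, i) - F (u t) i * (s - t) = - (b (t, i) - b (s, i) - F (u t) i * (t - s))); last by ring.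
rewrite normrN; apply: (arith (a n (t, i)) (a n (s, i)) _ _ ((k n t - k n s)%:R / c n)) => //.
- rewrite as_ at_; apply: euler_dist => // q j /andP[lq qm]; apply: Hd => x.
  apply: (between (k n s) (k n t)) => //; first by rewrite lq ltnW.
    exact: kappa.
  by right => y; rewrite -at_.
- by have := Ht i; rewrite mxE.
- by rewrite subr_ge0.
Qed.

End Peano.

(** * The flow in logarithmic coordinates *)

Section TimeDomain.
Variables (R : realType) (tau : \bar R).

Lemma time_domain_le (s t : R) : 0 <= s -> s <= t -> time_domain tau t -> time_domain tau s.
Proof. by move=> s0 st [_ tt]; split => //; apply: le_lt_trans tt; rewrite lee_fin. Qed.

End TimeDomain.

Section LogFlow.
Variables (R : realType) (N : nat) (T : triangulated_surface N) (I : {set 'I_N} -> R).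
Hypothesis I_ge0 : weight_nonneg T I.
Implicit Types (i j k : 'I_N) (A : {set 'I_N}) (x : 'rV[R]_N).

Definition area (x : 'rV[R]_N) : R := \sum_i expR (x 0 i).

(* The extended flow in the coordinates u_i = ln r_i^2. *)
Definition log_field (x : 'rV[R]_N) i : R :=
  2 * pi * (euler_char T)%:~R / area x - log_curv T I x i / expR (x 0 i).

Definition log_flow (tau : \bar R) (u : R -> 'rV[R]_N) := forall t i, time_domain tau t ->
  has_deriv_within (time_domain tau) (fun s => u s 0 i) t (log_field (u t) i).

Let i0 : 'I_N := Ordinal (vertex_nonempty T).

Lemma area_ge x i : expR (x 0 i) <= area x.
Proof. by rewrite /area (bigD1 i) //= lerDl sumr_ge0 // => j _; exact: expR_ge0. Qed.

Lemma area_gt0 x : 0 < area x.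
Proof. by apply: lt_le_trans (area_ge x i0); exact: expR_gt0. Qed.

(** This is the derivative of [area] along the field: 2 pi chi minus the total curvature. *)
Lemma log_field_sum x : \sum_i expR (x 0 i) * log_field x i = 0.
Proof.
under eq_bigr do rewrite /log_field mulrBr.
rewrite sumrB -mulr_suml -/(area x) mulrCA divff ?gt_eqF ?area_gt0 // mulr1.
rewrite -(log_curv_sum I_ge0 x) -sumrB big1 // => i _.
by rewrite mulrCA divff ?mulr1 ?subrr // gt_eqF // expR_gt0.
Qed.

Lemma log_curv_bound : exists2 B : R, 0 < B & forall x i, `|log_curv T I x i| <= B.
Proof.
exists (2 * pi + \sum_(p : 'I_N * 'I_N) pi).
  by rewrite ltr_pwDl ?mulr_gt0 ?pi_gt0 // sumr_ge0 // => p _; exact: pi_ge0.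
move=> x i; rewrite /log_curv /vertex_curv; apply: le_trans (ler_normB _ _) _.
rewrite ger0_norm ?mulr_ge0 ?pi_ge0 // lerD2l (le_trans (ler_norm_sum _ _ _)) //.
rewrite big_mkcond; apply: ler_sum => p _; case: ifP => _; last exact: pi_ge0.
by rewrite ger0_norm ?tri_angle_ge0 // tri_angle_lepi.
Qed.

Lemma cvg_log_field (S : Type) (F : set_system S) (FF : Filter F) (f : S -> 'rV[R]_N) x i :
  (forall j, f s 0 j @[s --> F] --> x 0 j) -> log_field (f s) i @[s --> F] --> log_field x i.
Proof.
move=> fx; have fe j : expR (f s 0 j) @[s --> F] --> expR (x 0 j).
  by apply: (@continuous_cvg _ _ _ _ _ (fun s => f s 0 j) expR); [exact: continuous_expR|exact: fx].
apply: cvgB; apply: cvgM.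
- exact: cvg_cst.
- by apply: cvgV; [rewrite gt_eqF // area_gt0|apply: cvg_sumr => j _; exact: fe].
- exact: cvg_log_curv.
- by apply: cvgV; [rewrite gt_eqF // expR_gt0|exact: fe].
Qed.

Lemma log_field_continuous x : coord_continuous_at log_field x.
Proof.
move=> e e0.
have H i : exists2 d : R, 0 < d & forall z : 'rV[R]_N, (forall j, `|z 0 j - x 0 j| < d) -> `|log_field z i - log_field x i| <= e.
  have /cvgrPdist_le /(_ _ e0) := @cvg_log_field _ (nbhs x) (nbhs_filter x) id x i (fun j => @coord_continuous _ _ _ 0 j x).
  move=> /nbhs_ballP[d /= d0 Hd]; exists d => // z Hz; rewrite distrC; apply: Hd.
  by split => // a b; rewrite (ord1 a) /ball/= distrC.
have [|d d0 Hd] := uniform_pos H.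
  by move=> i m m' _ mm Hm z Hz; apply: Hm => j; apply: lt_le_trans mm.
by exists d => // z Hz i; exact: Hd.
Qed.

Section OneFlow.
Variables (tau : \bar R) (u : R -> 'rV[R]_N).
Hypothesis uflow : log_flow tau u.
Let D := time_domain tau.

Lemma has_deriv_within_expu t i : D t ->
  has_deriv_within D (fun s => expR (u s 0 i)) t (expR (u t 0 i) * log_field (u t) i).
Proof. by move=> Dt; apply: has_deriv_within_exp; exact: uflow. Qed.

Lemma area_conserved t : D t -> area (u t) = area (u 0).
Proof.
move=> Dt; have [t0 _] := Dt.
have Hd s : 0 <= s <= t -> has_deriv_within D (fun s => area (u s)) s (\sum_i expR (u s 0 i) * log_field (u s) i).
  move=> /andP[s0 st]; apply: has_deriv_within_sum => i _; apply: has_deriv_within_expu.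
  exact: time_domain_le Dt.
have HD s : 0 <= s <= t -> D s by move=> /andP[s0 st]; exact: time_domain_le Dt.
have := has_deriv_within_dist (v := 0) (m := 0) t0 HD Hd.
rewrite !mul0r subr0 normr_le0 subr_eq0 => H; apply/eqP/H => s _.
by rewrite log_field_sum subr0 normr0.
Qed.

Section Comparison.
Variable v : 'rV[R]_N.
Hypothesis v_adm : admissible T I (radii v).
Variable c : R.
Hypotheses (cE : c = 2 * pi * (euler_char T)%:~R / area v) (c_le0 : c <= 0).
Hypothesis v_cst : forall i, log_curv T I v i = c * expR (v 0 i).
Hypothesis uv_area : area (u 0) = area v.

Let areaE t : D t -> area (u t) = area v.
Proof. by move=> Dt; rewrite area_conserved. Qed.

Let fieldE t i : D t -> expR (u t 0 i) * log_field (u t) i = c * expR (u t 0 i) - log_curv T I (u t) i.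
Proof.
move=> Dt; rewrite /log_field areaE // -cE mulrBr mulrC; congr (_ - _).
by rewrite mulrCA divff ?mulr1 // gt_eqF // expR_gt0.
Qed.

Let mass A t := \sum_(i in A) expR (u t 0 i).

Let mass_deriv A t : D t ->
  has_deriv_within D (mass A) t (c * mass A t - \sum_(i in A) log_curv T I (u t) i).
Proof.
move=> Dt; rewrite /mass mulr_sumr -sumrB.
have H : has_deriv_within D (fun s => \sum_(i in A) expR (u s 0 i)) t (\sum_(i in A) expR (u t 0 i) * log_field (u t) i).
  by apply: has_deriv_within_sum => i _; exact: has_deriv_within_expu.
by congr (has_deriv_within _ _ _ _) : H; apply: eq_bigr => i _; rewrite fieldE.
Qed.

(* The set of u with mass A >= thr A for all A is forward invariant: when a subset
   first reaches its threshold it lies far below its complement, whose members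
   are controlled by the much larger thresholds of A with one more vertex. *)
Lemma log_flow_lower : D 0 -> exists2 c1, 0 < c1 & forall t i, D t -> c1 <= expR (u t 0 i).
Proof.
move=> D0.
have vneg A : \sum_(i in A) log_curv T I v i <= 0.
  by under eq_bigr do rewrite v_cst; apply: sumr_le0 => i _; rewrite mulr_le0_ge0 // expR_ge0.
have [e e0 He] := barrier_curv I_ge0 v_adm vneg.
have [m0 m00 Hm0] : exists2 m : R, 0 < m & forall i, m <= expR (u 0 0 i).
  apply: uniform_pos => [i|i m m' _ mm H]; first by exists (expR (u 0 0 i)) => //; exact: expR_gt0.
  exact: le_trans H.
(* The first term handles the full vertex set, whose mass is the conserved area; the second the
   initial time; the third bounds |c| times a threshold by e / 2, below the curvature gap e. The
   divisor 1 - c, unlike - c, cannot vanish. *)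
pose eta := Num.min (area v) (Num.min m0 (e / (2 * (1 - c)))).
have c1 : 0 < 1 - c by move: c_le0; lra.
have eta0 : 0 < eta by rewrite !lt_min area_gt0 m00 divr_gt0 // mulr_gt0.
(* The bound 1/2 absorbs thr A when it is subtracted from the threshold of A with one more vertex b.
   The squared radius ratio between A and b is then at most 2 kap, hence at most e ^+ 2. *)
pose kap := Num.min (2^-1) (e ^+ 2 / 2).
have k0 : 0 < kap by rewrite lt_min invr_gt0 ltr0n divr_gt0 // exprn_gt0.
have k1 : kap <= 2^-1 by rewrite ge_min lexx.
have ke : kap <= e ^+ 2 / 2 by rewrite ge_min lexx orbT.
have k1' : kap <= 1 by lra.
(* Counting the complement in the exponent makes adding one vertex multiply the threshold by 1 /
   kap. *)
pose thr A := eta * kap ^+ (N - #|A|).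
have thr0 A : 0 < thr A by rewrite mulr_gt0 // exprn_gt0.
have thr_eta A : thr A <= eta by rewrite ler_piMr ?(ltW eta0) // exprn_ile1 // ltW.
have main t : 0 <= t -> D t -> forall A, A != finset.set0 -> thr A <= mass A t.
  apply: (@real_induction R D (fun t => forall A, A != finset.set0 -> thr A <= mass A t)).
  - by move=> s t' s0 st; exact: time_domain_le.
  - move=> _ A /set0Pn[i iA]; apply: le_trans (thr_eta A) _.
    apply: (@le_trans _ _ m0); first by rewrite /eta !ge_min lexx orbT.
    apply: le_trans (Hm0 i) _; by rewrite /mass (bigD1 i) //= lerDl sumr_ge0.
  - move=> t' t0 Dt Hs.
    suff [d d0 Hd] : exists2 d : R, 0 < d & forall A, A != finset.set0 -> forall s, D s -> t' < s -> s < t' + d -> thr A <= mass A s.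
      by exists d => // s Ds ts sd A A0; exact: (Hd A A0 s).
    apply: uniform_pos => [A|A m m' _ mm H A0 s Ds ts sm]; last first.
      by apply: H => //; apply: lt_le_trans sm _; rewrite lerD2l.
    have [A0|A0] := boolP (A != finset.set0); last by exists 1.
    have [AT|AT] := eqVneq A [set: 'I_N]%SET.
      exists 1 => // _ s Ds _ _; apply: le_trans (thr_eta A) _.
      have -> : mass A s = area (u s) by rewrite /mass /area AT; apply: eq_bigl => i; rewrite inE.
      by rewrite areaE // /eta ge_min lexx.
    have := Hs t'; rewrite t0 lexx => /(_ isT) Ht.
    have /has_deriv_withinP Hder := @mass_deriv A _ Dt.
    have := Ht A A0; rewrite le_eqVlt => /predU1P[eA|gA]; last first.
      have cA := has_deriv_within_cvg (@mass_deriv A _ Dt).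
      move/cvgr_gt : cA => /(_ _ gA)/nbhs_normP[d /= d0 Hd]; exists d => // _ s Ds ts sd.
      apply: ltW; apply: Hd => //; last by rewrite gt_eqF.
      by rewrite /ball_/= distrC gtr0_norm ?subr_gt0 //; lra.
    have far : far_below A e (u t').
      move=> a b aA bA; have ga : expR (u t' 0 a) <= thr A.
        by rewrite eA /mass (bigD1 a) //= lerDl sumr_ge0 // => j _; exact: expR_ge0.
      have cA : (#|A| < N)%N.
        rewrite -[X in (_ < X)%N](card_ord N) ltn_neqAle max_card andbT.
        apply: contra AT => /eqP cA; rewrite finset.eqEcard finset.subsetT cardsT cA.
        exact: leqnn.
      have gb : thr (b |: A)%SET <= expR (u t' 0 b) + thr A.
        have := Ht (b |: A)%SET; rewrite /mass big_setU1 //= -/(mass A t') -eA; apply.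
        by apply/set0Pn; exists b; rewrite setU11.
      have thrE : thr A = kap * thr (b |: A)%SET.
        rewrite /thr cardsU1 bA add1n mulrCA -exprS -subSn //.
      have gb' : thr A <= 2 * kap * expR (u t' 0 b).
        have h1 : kap * thr (b |: A)%SET <= kap * (expR (u t' 0 b) + thr A) by rewrite ler_pM2l.
        have h2 : kap * thr A <= 2^-1 * thr A by rewrite ler_pM2r.
        by move: h1; rewrite -thrE mulrDr; lra.
      have r2 : radius_ratio (u t' 0 a) (u t' 0 b) ^+ 2 <= e ^+ 2.
        rewrite /radius_ratio -expRM_natl mulrC divfK // expRD expRN ler_pdivrMr ?expR_gt0 //.
        apply: le_trans ga _; apply: le_trans gb' _; rewrite ler_pM2r ?expR_gt0 //; lra.
      by rewrite -ler_sqr ?nnegrE ?(ltW e0) // expR_ge0.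
    have lpos : 0 < c * mass A t' - \sum_(i in A) log_curv T I (u t') i.
      have h1 := He A A0 AT _ far.
      have h2 : (1 - c) * eta <= e / 2.
        rewrite mulrC -ler_pdivlMr // (_ : e / 2 / (1 - c) = e / (2 * (1 - c))); last by rewrite invfM mulrA.
        by rewrite /eta !ge_min lexx !orbT.
      have h3 : - c * thr A <= - c * eta by rewrite ler_wpM2l ?thr_eta // oppr_ge0.
      rewrite -eA; lra.
    set l := (X in 0 < X) in lpos.
    have [d d0 Hd] := Hder _ lpos; exists d => // _ s Ds ts sd.
    have st0 : 0 < s - t' by rewrite subr_gt0.
    have := Hd s Ds; rewrite gtr0_norm // => H; have {H} : `|mass A s - mass A t' - l * (s - t')| <= l * (s - t').
      by apply: H; lra.
    by rewrite ler_norml => /andP[H _]; rewrite eA; lra.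
  - move=> t' t0 Dt Hs A A0; rewrite leNgt; apply/negP => lA.
    have cA := has_deriv_within_cvg (@mass_deriv A _ Dt).
    move/cvgr_lt : cA => /(_ _ lA)/nbhs_normP[d /= d0 Hd].
    pose s := Num.max 0 (t' - d / 2).
    have st : s < t' by rewrite /s gt_max t0; lra.
    have s0 : 0 <= s by rewrite le_max lexx.
    have : mass A s < thr A.
      apply: Hd; last 2 first.
      - by rewrite lt_eqF.
      - exact: time_domain_le (ltW st) Dt.
      rewrite /ball_/= gtr0_norm ?subr_gt0 //.
      have : t' - d / 2 <= s by rewrite le_max lexx orbT.
      lra.
    by rewrite ltNge Hs // s0 st.
exists (eta * kap ^+ (N - 1)); first by rewrite mulr_gt0 // exprn_gt0.
move=> t i Dt; have [t0 _] := Dt.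
have := main t t0 Dt [set i]%SET; rewrite /thr cards1 /mass big_set1; apply.
by apply/set0Pn; exists i; rewrite set11.
Qed.


Let entropy t : R := \sum_i (expR (u t 0 i) * (u t 0 i - v 0 i) - expR (u t 0 i) + expR (v 0 i)).

Let entropy_deriv t : D t -> has_deriv_within D entropy t
  (\sum_i (expR (u t 0 i) * log_field (u t) i) * (u t 0 i - v 0 i)).
Proof.
move=> Dt; apply: has_deriv_within_sum => i _.
have He := @has_deriv_within_expu t i Dt.
have Hu := has_deriv_withinD (@uflow t i Dt) (has_deriv_within_cst D (- v 0 i) t).
have H := has_deriv_withinD (has_deriv_withinD (has_deriv_withinM He Hu)
  (has_deriv_withinZ (c := -1) He)) (has_deriv_within_cst D (expR (v 0 i)) t).
rewrite (_ : (fun s => _) = (fun s => expR (u s 0 i) * (u s 0 i + - v 0 i) + -1 * expR (u s 0 i) + expR (v 0 i))); last first.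
  by apply/funext => s; rewrite mulN1r.
by congr (has_deriv_within _ _ _ _) : H; ring.
Qed.

(** Both bounds rest on 1 + z <= expR z. The lower one leaves the remainder 2 expR x (q - 1 - (y -
    x) / 2) with q = expR ((y - x) / 2); the upper one passes through (expR x - expR y) (x - y) and
    bounds the slope of exp by M. *)
Let entropy_term (x y M : R) : expR x <= M -> expR y <= M ->
  (expR (x / 2) - expR (y / 2)) ^+ 2 <= expR x * (x - y) - expR x + expR y <= M * (x - y) ^+ 2.
Proof.
move=> xM yM; apply/andP; split.
  have ex : expR x = expR (x / 2) ^+ 2 by rewrite -expRM_natl mulrC divfK.
  have ey : expR y = expR (x / 2) ^+ 2 * expR ((y - x) / 2) ^+ 2.
    by rewrite -!expRM_natl ![2 * _]mulrC !divfK // -expRD addrC subrK.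
  have ey2 : expR (y / 2) = expR (x / 2) * expR ((y - x) / 2) by rewrite -expRD -mulrDl addrC subrK.
  rewrite ey2 ey ex; set p := expR (x / 2); set q := expR ((y - x) / 2).
  have h : 1 + (y - x) / 2 <= q by exact: expR_ge1Dx.
  rewrite -subr_ge0 (_ : _ - _ = p ^+ 2 * (2 * (q - (1 + (y - x) / 2)))); last by field.
  by rewrite mulr_ge0 ?sqr_ge0 // mulr_ge0 // subr_ge0.
have h : expR x * (1 + (y - x)) <= expR y.
  have -> : expR y = expR x * expR (y - x) by rewrite -expRD addrC subrK.
  by rewrite ler_pM2l ?expR_gt0 // expR_ge1Dx.
have h' : expR y * (1 + (x - y)) <= expR x.
  have -> : expR x = expR y * expR (x - y) by rewrite -expRD addrC subrK.
  by rewrite ler_pM2l ?expR_gt0 // expR_ge1Dx.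
have ex := expR_gt0 x; have ey := expR_gt0 y.
apply: (@le_trans _ _ ((expR x - expR y) * (x - y))); first lra.
have [xy|/ltW yx] := leP x y.
  rewrite (_ : _ * _ = (expR y - expR x) * (y - x)); last by ring.
  have k : expR y - expR x <= expR y * (y - x) by lra.
  apply: le_trans (ler_wpM2r _ k) _; first by rewrite subr_ge0.
  by rewrite -mulrA -expr2 -(sqrrN (y - x)) opprB ler_wpM2r // sqr_ge0.
have k : expR x - expR y <= expR x * (x - y) by lra.
apply: le_trans (ler_wpM2r _ k) _; first by rewrite subr_ge0.
by rewrite -mulrA -expr2 ler_wpM2r // sqr_ge0.
Qed.

Lemma log_flow_decay : D 0 -> exists2 lam, 0 < lam & exists2 C, 0 < C & forall t, D t ->
  \sum_i (radii (u t) 0 i - radii v 0 i) ^+ 2 <= C * expR (- lam * t).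
Proof.
move=> D0; have [c1 c10 Hc1] := log_flow_lower D0.
pose S := area v; have S0 : 0 < S := area_gt0 v.
have uS t i : D t -> expR (u t 0 i) <= S by move=> Dt; rewrite /S -(areaE Dt) area_ge.
pose B := 1 + \sum_i (`|ln c1| + `|ln S| + `|v 0 i|).
have B0 : 0 < B by rewrite ltr_pwDl // sumr_ge0 // => i _; rewrite !addr_ge0.
have uB t i : D t -> `|u t 0 i - v 0 i| <= B.
  move=> Dt; have h1 : ln c1 <= u t 0 i by rewrite -ler_expR lnK ?posrE // Hc1.
  have h2 : u t 0 i <= ln S by rewrite -ler_expR lnK ?posrE // uS.
  have h3 : `|ln c1| + `|ln S| + `|v 0 i| <= B.
    rewrite /B (bigD1 i) //= addrCA lerDl; apply: addr_ge0 => //; apply: sumr_ge0 => j _.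
    by rewrite !addr_ge0.
  have h4 := ler_norm (ln S); have h5 := ler_norm (- ln c1); rewrite normrN in h5.
  have h6 := ler_norm (v 0 i); have h7 := ler_norm (- v 0 i); rewrite normrN in h7.
  have h8 := normr_ge0 (ln S); have h9 := normr_ge0 (ln c1).
  by rewrite ler_norml; apply/andP; split; lra.
have [m m0 Hm] := log_curv_coercive I_ge0 v_adm B0.
pose n3 : R := N%:R ^+ 3.
have n30 : 0 < n3 by rewrite exprn_gt0 // ltr0n (vertex_nonempty T).
(* One factor for each inequality of the chain: coercivity, Poincare, and entropy against the
   squared distance in u. *)
pose lam := m / n3 / S.
have lam0 : 0 < lam by rewrite !divr_gt0.
have key t : D t -> \sum_i (expR (u t 0 i) * log_field (u t) i) * (u t 0 i - v 0 i) <= - lam * entropy t.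
  move=> Dt; pose d := u t - v.
  have dE i : d 0 i = u t 0 i - v 0 i by rewrite !mxE.
  have h1 : m * dirichlet T d <= \sum_i (log_curv T I (u t) i - log_curv T I v i) * d 0 i.
    have ud : v + d = u t by rewrite /d addrC subrK.
    by have := Hm d; rewrite ud; apply=> i; rewrite dE; exact: uB.
  (* Equal areas forbid u - v to have a strict constant sign, which is the hypothesis of the
     Poincare inequality. *)
  have h2 : \sum_i d 0 i ^+ 2 <= n3 * dirichlet T d.
    have eA : area (u t) = area v := areaE Dt.
    apply: poincare; apply: contrapT => H.
    - suff : area v < area (u t) by rewrite eA ltxx.
      rewrite /area; apply: ltr_sum => [|i _]; first by apply/hasP; exists i0; rewrite ?mem_index_enum.
      by rewrite ltr_expR -subr_gt0 -dE ltNge; apply/negP => di; apply: H; exists i.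
    - suff : area (u t) < area v by rewrite eA ltxx.
      rewrite /area; apply: ltr_sum => [|i _]; first by apply/hasP; exists i0; rewrite ?mem_index_enum.
      by rewrite ltr_expR -subr_lt0 -dE ltNge; apply/negP => di; apply: H; exists i.
  have h3 : entropy t <= S * \sum_i d 0 i ^+ 2.
    rewrite /entropy mulr_sumr; apply: ler_sum => i _; rewrite dE.
    by have /andP[] := entropy_term (uS t i Dt) (area_ge v i).
  have h4 : \sum_i (expR (u t 0 i) * log_field (u t) i) * (u t 0 i - v 0 i) <=
      - \sum_i (log_curv T I (u t) i - log_curv T I v i) * d 0 i.
    rewrite -sumrN; apply: ler_sum => i _; rewrite fieldE // v_cst dE.
    have : 0 <= (expR (u t 0 i) - expR (v 0 i)) * (u t 0 i - v 0 i).
      by have [uv|/ltW uv] := leP (u t 0 i) (v 0 i);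
        [rewrite mulr_le0 // subr_le0 ?ler_expR|rewrite mulr_ge0 // subr_ge0 ?ler_expR].
    move/(ler_wnM2l c_le0); rewrite mulr0 => h.
    rewrite -subr_ge0; move: h; rewrite -oppr_ge0; congr (0 <= _); ring.
  apply: le_trans h4 _; rewrite mulNr lerN2.
  apply: le_trans h1; rewrite /lam.
  apply: (@le_trans _ _ (m / n3 / S * (S * \sum_i d 0 i ^+ 2))); first by rewrite ler_pM2l.
  rewrite mulrA divfK ?gt_eqF // -mulrA ler_pM2l // mulrC ler_pdivrMr // mulrC.
  by [].
(* The added 1 keeps the constant positive when the flow starts at v. *)
exists lam => //; exists (entropy 0 + 1).
  rewrite ltr_wpDl // /entropy sumr_ge0 // => i _.
  have /andP[h _] := entropy_term (uS 0 i D0) (area_ge v i).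
  by apply: le_trans h; rewrite sqr_ge0.
move=> t Dt; have [t0 _] := Dt.
have HD s : 0 <= s <= t -> D s by move=> /andP[s0 st]; exact: time_domain_le Dt.
have decay : entropy t * expR (lam * t) <= entropy 0.
  have Hd s : 0 <= s <= t -> has_deriv_within D (fun s => entropy s * expR (lam * s)) s
     ((\sum_i (expR (u s 0 i) * log_field (u s) i) * (u s 0 i - v 0 i)) * expR (lam * s) +
      entropy s * (expR (lam * s) * (lam * 1))).
    move=> /HD Ds; apply: has_deriv_withinM; first exact: entropy_deriv.
    by apply: has_deriv_within_exp; apply: has_deriv_withinZ; exact: has_deriv_within_id.
  have := has_deriv_within_le (m := 0) t0 HD Hd.
  rewrite mulr0 expR0 mul0r subr_le0 [X in _ <= X]mulr1; apply=> s /HD Ds.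
  have h := key s Ds; set X := \sum_i _ in h *.
  rewrite (_ : _ + _ = (X + lam * entropy s) * expR (lam * s)); last by ring.
  by rewrite mulr_le0_ge0 ?expR_ge0 //; move: h; rewrite mulNr; lra.
apply: (@le_trans _ _ (entropy t)).
  rewrite /entropy; apply: ler_sum => i _; rewrite !mxE.
  by have /andP[] := entropy_term (uS t i Dt) (area_ge v i).
rewrite mulNr expRN -ler_pdivrMr ?invr_gt0 ?expR_gt0 // invrK.
by apply: le_trans decay _; rewrite lerDl.
Qed.

End Comparison.
End OneFlow.
End LogFlow.

(** * Continuation past a finite time *)

Section Extension.
Variables (R : realType) (N : nat) (T : triangulated_surface N) (I : {set 'I_N} -> R).
Hypothesis I_ge0 : weight_nonneg T I.
Implicit Types (i j k : 'I_N).
Variables (T0 : R) (u : R -> 'rV[R]_N).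
Hypotheses (T0_gt0 : 0 < T0) (uflow : log_flow T I T0%:E u).

Let DE t : time_domain T0%:E t <-> 0 <= t < T0.
Proof. by rewrite /time_domain/= lte_fin; split=> [[-> ->]|/andP[-> ->]]. Qed.

(** Conserved area and the lower bound make the field bounded, hence u Lipschitz. The second
    conclusion says that the limit also has the left derivative prescribed by the field, as needed
    to glue a continuation differentiably. *)
Lemma log_flow_endpoint (c1 : R) : 0 < c1 -> (forall t i, 0 <= t < T0 -> c1 <= expR (u t 0 i)) ->
  exists uT : 'rV[R]_N,
    (exists M : R, forall t i, 0 <= t < T0 -> `|u t 0 i - uT 0 i| <= M * (T0 - t)) /\
    (forall i (e : R), 0 < e -> exists2 d : R, 0 < d & forall s, 0 <= s < T0 -> T0 - s < d ->
      `|u s 0 i - uT 0 i - log_field T I uT i * (s - T0)| <= e * (T0 - s)).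
Proof.
move=> c10 Hc1; have [B B0 HB] := log_curv_bound T I.
pose M := `|2 * pi * (euler_char T)%:~R / area (u 0)| + B / c1.
have M0 : 0 < M by rewrite ltr_wpDl // divr_gt0.
have D0 : time_domain T0%:E 0 by apply/DE; rewrite lexx.
have fM t i : 0 <= t < T0 -> `|log_field T I (u t) i - 0| <= M.
  move=> tT; rewrite subr0 /log_field (area_conserved I_ge0 uflow) ?DE //.
  apply: le_trans (ler_normB _ _) _; rewrite lerD2l normrM (gtr0_norm (x := _^-1)) ?invr_gt0 ?expR_gt0 //.
  by rewrite ler_pM // ?invr_ge0 ?expR_ge0 // lef_pV2 ?posrE ?expR_gt0 // Hc1.
have lip s t i : 0 <= s -> s <= t -> t < T0 -> `|u t 0 i - u s 0 i| <= M * (t - s).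
  move=> s0 st tT; have HD x : s <= x <= t -> time_domain T0%:E x.
    by move=> /andP[sx xt]; apply/DE; rewrite (le_trans s0 sx) (le_lt_trans xt tT).
  have := has_deriv_within_dist (v := 0) (m := M) st HD (fun x Hx => @uflow _ i (HD x Hx)).
  rewrite mul0r subr0; apply=> x /HD/DE; exact: fM.
(* The function u + M t is nondecreasing, so its supremum serves as its limit at T0. *)
pose E i := [set x | exists t, 0 <= t < T0 /\ x = u t 0 i + M * t].
have Eub i t x : 0 <= t < T0 -> E i x -> x <= u t 0 i + M * (T0 - t) + M * T0.
  move=> /andP[t0 tT] [s [/andP[s0 sT] ->]].
  have MT : M * s <= M * T0 by rewrite ler_pM2l // ltW.
  have [st|ts] := leP s t.
    have := lip s t i s0 st tT; rewrite ler_norml => /andP[h1 h2].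
    have h3 : M * (t - s) <= M * (T0 - s) by rewrite ler_pM2l // lerD2r ltW.
    have h4 : 0 <= M * (T0 - t) by rewrite mulr_ge0 ?(ltW M0) // subr_ge0 ltW.
    have h5 : M * t <= M * T0 by rewrite ler_pM2l // ltW.
    lra.
  have := lip t s i t0 (ltW ts) sT; rewrite ler_norml => /andP[h1 h2].
  have h3 : M * (s - t) <= M * (T0 - t) by rewrite ler_pM2l // lerD2r ltW.
  lra.
have E0 i : E i (u 0 0 i + M * 0) by exists 0; rewrite lexx.
have supE i : has_sup (E i).
  split; first by exists (u 0 0 i + M * 0).
  by exists (u 0 0 i + M * (T0 - 0) + M * T0) => x; apply: Eub; rewrite lexx.
pose uT : 'rV[R]_N := \row_i (sup (E i) - M * T0).
have near t i : 0 <= t < T0 -> `|u t 0 i - uT 0 i| <= M * (T0 - t).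
  move=> tT; rewrite mxE ler_norml.
  have h1 : sup (E i) <= u t 0 i + M * (T0 - t) + M * T0.
    by apply: ge_sup; [exists (u 0 0 i + M * 0)|move=> x; exact: Eub].
  have h2 : u t 0 i + M * t <= sup (E i) by apply: sup_upper_bound => //; exists t.
  by apply/andP; split; lra.
exists uT; split; first by exists M.
move=> i e e0; have [d d0 Hd] := log_field_continuous I_ge0 uT e0.
exists (d / M); first by rewrite divr_gt0.
move=> s /andP[s0 sT] sd; apply/ler_addgt0Pr => eta eta0.
set f := log_field T I uT i.
have C0 : 0 < M + `|f| by rewrite ltr_pwDl.
(* The flow is not defined at T0, so the mean value estimate is applied up to b, close enough that
   the remaining interval costs at most eta. *)
pose b := Num.max s (T0 - eta / (M + `|f|)).
have sb : s <= b by rewrite le_max lexx.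
have bT : b < T0 by rewrite gt_max sT ltrBlDr ltrDl divr_gt0.
have HD x : s <= x <= b -> 0 <= x < T0.
  by move=> /andP[sx xb]; rewrite (le_trans s0 sx) (le_lt_trans xb bT).
have h1 : `|u b 0 i - u s 0 i - f * (b - s)| <= e * (b - s).
  apply: (has_deriv_within_dist sb (fun x Hx => (DE x).2 (HD x Hx)) (fun x Hx => @uflow _ i ((DE x).2 (HD x Hx)))).
  move=> x /[dup]/andP[sx xb] /HD xT; apply: Hd => j; apply: le_lt_trans (near x j xT) _.
  rewrite mulrC -ltr_pdivlMr //; apply: le_lt_trans sd; lra.
have h2 := near b i (HD b (ltac:(by rewrite sb lexx))).
have h3 : (T0 - b) * (M + `|f|) <= eta.
  rewrite -ler_pdivlMr // lerBlDr addrC -lerBlDr le_max lexx orbT //.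
have h4 : `|f * (T0 - b)| = `|f| * (T0 - b) by rewrite normrM (gtr0_norm (x := T0 - b)) // subr_gt0.
rewrite (_ : _ - _ = - (u b 0 i - u s 0 i - f * (b - s)) + (u b 0 i - uT 0 i) + f * (T0 - b)); last by ring.
apply: le_trans (ler_normD _ _) _; rewrite h4.
apply: (@le_trans _ _ ((e * (b - s) + M * (T0 - b)) + `|f| * (T0 - b))).
  by rewrite lerD2r (le_trans (ler_normD _ _)) // normrN lerD.
have h5 : e * (b - s) <= e * (T0 - s) by rewrite ler_pM2l // lerD2r ltW.
by move: h3; rewrite mulrDr (mulrC _ M) (mulrC _ `|f|); lra.
Qed.

(* The extended field is merely continuous, so that the continuation past the
   endpoint comes from Peano's theorem rather than Picard-Lindelof. *)
Lemma log_flow_extend (uT : 'rV[R]_N) :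
  (forall i (e : R), 0 < e -> exists2 d : R, 0 < d & forall s, 0 <= s < T0 -> T0 - s < d ->
      `|u s 0 i - uT 0 i - log_field T I uT i * (s - T0)| <= e * (T0 - s)) ->
  exists2 h : R, 0 < h & exists w : R -> 'rV[R]_N,
    [/\ w T0 = uT, forall t, 0 <= t < T0 -> w t = u t & log_flow T I (T0 + h)%:E w].
Proof.
move=> HT; have [h h0 [z z0 Hz]] := peano uT (log_field_continuous I_ge0).
exists h => //; pose w t := if t < T0 then u t else z (t - T0).
have wT : w T0 = uT by rewrite /w ltxx subrr.
exists w; split => // [t /andP[_ tT]|]; first by rewrite /w tT.
move=> t i [t0]; rewrite lte_fin => th.
have dom s : time_domain (T0 + h)%:E s -> 0 <= s < T0 + h by move=> [s0]; rewrite lte_fin s0.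
have [tT|Tt|tT] := ltgtP t T0.
- have tD : time_domain T0%:E t by apply/DE; rewrite t0.
  have wt : w t = u t by rewrite /w tT.
  rewrite wt; have /has_deriv_withinP H := @uflow _ i tD; apply/has_deriv_withinP => e /H[d d0 Hd].
  exists (Num.min d (T0 - t)); first by rewrite lt_min d0 subr_gt0.
  move=> s /dom/andP[s0 sh]; rewrite lt_min => /andP[sd st].
  have sT : s < T0 by move: st; rewrite ltr_norml => /andP[_]; lra.
  by rewrite wt /w sT; apply: Hd => //; apply/DE; rewrite s0.
- have tD : 0 <= t - T0 < h by rewrite subr_ge0 ltW //= ltrBlDl.
  have wt : w t = z (t - T0) by rewrite /w ltNge ltW.
  rewrite wt; have /has_deriv_withinP H := Hz _ i tD; apply/has_deriv_withinP => e /H[d d0 Hd].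
  exists (Num.min d (t - T0)); first by rewrite lt_min d0 subr_gt0.
  move=> s /dom/andP[s0 sh]; rewrite lt_min => /andP[sd st].
  have sT : T0 <= s by move: st; rewrite ltr_norml => /andP[]; lra.
  rewrite wt /w ltNge sT /=.
  have E : s - T0 - (t - T0) = s - t by ring.
  have := Hd (s - T0); rewrite /= E; apply => //.
  by rewrite subr_ge0 sT ltrBlDl.
- rewrite tT wT; apply/has_deriv_withinP => e e0.
  have [d1 d10 H1] := HT i e e0.
  have tD : 0 <= (0 : R) < h by rewrite lexx.
  have /has_deriv_withinP /(_ e e0)[d2 d20 H2] := Hz _ i tD.
  exists (Num.min d1 d2); first by rewrite lt_min d10.
  move=> s /dom/andP[s0 sh]; rewrite lt_min => /andP[sd1 sd2].
  rewrite wT; have [sT|Ts] := ltP s T0.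
    rewrite /w sT (ltr0_norm (x := s - T0)) ?subr_lt0 // opprB; apply: H1; first by rewrite s0.
    by move: sd1; rewrite (ltr0_norm (x := s - T0)) ?subr_lt0 // opprB.
  rewrite /w ltNge Ts /=; have := H2 (s - T0); rewrite subr0 z0 /=; apply => //.
  by rewrite subr_ge0 Ts ltrBlDl.
Qed.

End Extension.

(** * From logarithmic coordinates to the flow *)

Section Flows.
Variables (R : realType) (N : nat) (T : triangulated_surface N) (I : {set 'I_N} -> R).
Hypothesis I_ge0 : weight_nonneg T I.
Implicit Types (i j k : 'I_N) (r x : 'rV[R]_N).

Lemma norm2_radii x : norm2 (radii x) ^+ 2 = area x.
Proof.
rewrite /norm2 sqr_sqrtr; last by apply: sumr_ge0 => i _; exact: sqr_ge0.
by apply: eq_bigr => i _; rewrite radii_sqr.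
Qed.

Lemma Rav_radii x : Rav T (radii x) = 2 * pi * (euler_char T)%:~R / area x.
Proof. by rewrite /Rav norm2_radii. Qed.

Lemma ext_Rcurv_radii x i : ext_Rcurv T I (radii x) i = log_curv T I x i / expR (x 0 i).
Proof. by rewrite /ext_Rcurv ext_Kcurv_radii // radii_sqr. Qed.

Lemma Rcurv_radii x i : admissible T I (radii x) -> Rcurv T I (radii x) i = log_curv T I x i / expR (x 0 i).
Proof. by move=> ax; rewrite /Rcurv Kcurv_radii // radii_sqr. Qed.

Lemma log_coordE r i : 0 < r 0 i -> expR (log_coord r 0 i) = r 0 i ^+ 2.
Proof. by move=> r0; rewrite mxE lnK // posrE exprn_gt0. Qed.

Lemma admissible_open x : admissible T I (radii x) -> exists2 d : R, 0 < d &
  forall y : 'rV[R]_N, (forall j, `|y 0 j - x 0 j| < d) -> admissible T I (radii y).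
Proof.
move=> /(admissible_radii I_ge0) ax.
have [||d d0 Hd] := @uniform_pos R ('I_N * 'I_N * 'I_N)%type (fun p d => is_face T p.1.1 p.1.2 p.2 ->
   forall y : 'rV[R]_N, (forall j, `|y 0 j - x 0 j| < d) -> 0 < face_heron I y p.1.1 p.1.2 p.2).
- move=> [[i j] k] /=; have [f|] := boolP (is_face T i j k); last by exists 1.
  have H : face_heron I y i j k @[y --> nbhs x] --> face_heron I x i j k.
    by apply: cvg_tri_heron; exact: coord_continuous.
  move/cvgr_gt : H => /(_ _ (ax _ _ _ f))/nbhs_ballP[d /= d0 Hd]; exists d => // _ y Hy.
  by apply: Hd; split => // a b; rewrite (ord1 a) /ball/= distrC.
- by move=> p m m' _ mm H f y Hy; apply: H => // j; apply: lt_le_trans mm.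
exists d => // y Hy; apply/(admissible_radii I_ge0) => i j k f.
exact: (Hd (i, j, k)).
Qed.

(** Summing over the vertices, Gauss-Bonnet leaves [Rav] as the only possible constant. *)
Lemma constant_metric_log r : constant_R_metric T I r ->
  admissible T I (radii (log_coord r)) /\
  forall i, log_curv T I (log_coord r) i =
    2 * pi * (euler_char T)%:~R / area (log_coord r) * expR (log_coord r 0 i).
Proof.
move=> [ar [c Hc]]; have [r0 _] := ar; set v := log_coord r.
have rv : radii v = r by exact: log_coordK.
have av : admissible T I (radii v) by rewrite rv.
split => // i; have Hv j : log_curv T I v j = c * expR (v 0 j).
  by have := Hc j; rewrite -rv Rcurv_radii // => <-; rewrite divfK // gt_eqF // expR_gt0.
rewrite Hv; congr (_ * _); have := log_curv_sum I_ge0 v.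
under eq_bigr do rewrite Hv.
by rewrite -mulr_sumr -/(area v) => <-; rewrite mulfK // gt_eqF // (area_gt0 T).
Qed.

(** * The flow in the admissible space and the extended flow, treated together *)

Section GeneralFlow.
Variables (X : set 'rV[R]_N) (C : 'rV[R]_N -> 'I_N -> R).
Hypothesis X_pos : forall r, X r -> positive_radii r.
Hypothesis X_open : forall x, X (radii x) -> exists2 d : R, 0 < d &
  forall y : 'rV[R]_N, (forall j, `|y 0 j - x 0 j| < d) -> X (radii y).
Hypothesis C_ext : forall r i, X r -> C r i = ext_Rcurv T I r i.

Lemma flow_log tau (r : R -> 'rV[R]_N) : flow_solution T X C tau r -> log_flow T I tau (fun t => log_coord (r t)).
Proof.
move=> [_ H] t i Dt; have [Xt Ht] := H t Dt; have rt := X_pos Xt.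
have g0 : 0 < r t 0 i ^+ 2 by rewrite exprn_gt0.
have := has_deriv_within_ln (f := fun s => r s 0 i ^+ 2) g0 (Ht i).
rewrite mulfK ?gt_eqF // C_ext // -{1 2}(log_coordK rt) Rav_radii ext_Rcurv_radii => Hd.
apply: has_deriv_within_eq Hd => // s _.
by rewrite mxE.
Qed.

Lemma log_flow_solution tau (u : R -> 'rV[R]_N) : (0 < tau)%E -> log_flow T I tau u ->
  (forall t, time_domain tau t -> X (radii (u t))) -> flow_solution T X C tau (fun t => radii (u t)).
Proof.
move=> tau0 uflow uX; split => // t Dt; split => [|i]; first exact: uX.
rewrite C_ext ?Rav_radii ?ext_Rcurv_radii ?radii_sqr; last exact: uX.
have := has_deriv_within_exp (@uflow t i Dt); rewrite mulrC => H.
apply: has_deriv_within_eq H => // s _; by rewrite radii_sqr.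
Qed.

(** Were the limit in the open set X, the continuation would stay in X for a short time and
    contradict maximality. *)
Lemma maximal_flow_endpoint (T0 : R) (r : R -> 'rV[R]_N) (c1 : R) :
  maximal_flow_solution T X C T0%:E r -> 0 < c1 ->
  (forall t i, time_domain T0%:E t -> c1 <= expR (log_coord (r t) 0 i)) ->
  exists xT : 'rV[R]_N, ~ X (radii xT) /\
    exists M : R, forall t i, time_domain T0%:E t -> `|log_coord (r t) 0 i - xT 0 i| <= M * (T0 - t).
Proof.
move=> [fl nmax] c10 Hc1; have [T00 Hfl] := fl; have T0_gt0 : 0 < T0 by rewrite -lte_fin.
have uflow := flow_log fl.
have DE t : 0 <= t < T0 -> time_domain T0%:E t by move=> /andP[t0 tT]; split.
have [xT [[M HM] HT]] := log_flow_endpoint I_ge0 T0_gt0 uflow c10 (fun t i Ht => Hc1 t i (DE t Ht)).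
exists xT; split; last by exists M => t i [t0]; rewrite lte_fin => tT; apply: HM; rewrite t0.
move=> XT; apply: nmax.
have [h h0 [w [wT wu wflow]]] := log_flow_extend I_ge0 uflow HT.
have [d d0 Hd] := X_open XT.
have wr t : time_domain T0%:E t -> radii (w t) = r t.
  move=> Dt; have [t0] := Dt; rewrite lte_fin => tT.
  by rewrite wu ?t0 // log_coordK //; apply: X_pos; have [] := Hfl t Dt.
have DT : time_domain (T0 + h)%:E T0 by split; rewrite ?(ltW T0_gt0) // lte_fin ltrDl.
have [e e0 He] : exists2 e : R, 0 < e & forall i s, time_domain (T0 + h)%:E s -> `|s - T0| < e -> `|w s 0 i - xT 0 i| < d.
  suff [e e0 He] : exists2 e : R, 0 < e & forall i, forall s, time_domain (T0 + h)%:E s -> `|s - T0| < e -> `|w s 0 i - xT 0 i| < d.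
    by exists e.
  apply: uniform_pos => [i|i m m' _ mm H s Ds sm]; last by apply: H => //; apply: lt_le_trans mm.
  have := has_deriv_within_cvg (@wflow T0 i DT); rewrite wT => /cvgrPdist_lt /(_ _ d0)/nbhs_normP[e /= e0 He].
  exists e => // s Ds se; have [->|sT] := eqVneq s T0; first by rewrite wT subrr normr0.
  by rewrite distrC; apply: He => //; rewrite /ball_/= distrC.
(* The time h comes from Peano's theorem, the time e keeps the continued solution inside X. *)
pose h' := Num.min h e.
have h'0 : 0 < h' by rewrite lt_min h0.
exists (T0 + h')%:E, (fun t => radii (w t)); split.
- by rewrite lte_fin ltrDl.
- apply: log_flow_solution; first by rewrite lte_fin addr_gt0.
    have sub : time_domain (T0 + h')%:E `<=` time_domain (T0 + h)%:E.
      by move=> s [s0]; rewrite lte_fin => sh; split => //; rewrite lte_fin (lt_le_trans sh) // lerD2l ge_min lexx.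
    move=> t i Dt; have Dt' := sub _ Dt.
    exact: (has_deriv_within_sub sub (@wflow t i Dt')).
  move=> t [t0]; rewrite lte_fin => th.
  have [tT|Tt] := ltP t T0.
    have Dt : time_domain T0%:E t by split; rewrite ?lte_fin.
    by rewrite wr //; have [] := Hfl t Dt.
  apply: Hd => j; apply: He.
    by split => //; rewrite lte_fin (lt_le_trans th) // lerD2l ge_min lexx.
  by rewrite ger0_norm ?subr_ge0 // ltrBlDl (lt_le_trans th) // lerD2l ge_min lexx orbT.
- exact: wr.
Qed.

Section Comparison.
Variables (rs : 'rV[R]_N) (tau : \bar R) (r : R -> 'rV[R]_N).
Hypotheses (rs_cst : constant_R_metric T I rs) (chi_le0 : euler_char T <= 0).
Hypotheses (fl : flow_solution T X C tau r) (norm_eq : norm2 rs = norm2 (r 0)).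

Let D0 : time_domain tau 0.
Proof. by split => //; case: fl. Qed.

Let c_le0 : 2 * pi * (euler_char T)%:~R / area (log_coord rs) <= 0.
Proof.
rewrite pmulr_lle0 ?invr_gt0 ?(area_gt0 T) // pmulr_rle0 ?mulr_gt0 ?pi_gt0 //.
by rewrite -(mulr0z 1) ler_int.
Qed.

Let area_eq : area (log_coord (r 0)) = area (log_coord rs).
Proof.
rewrite -!norm2_radii !log_coordK ?norm_eq //; first by case: rs_cst => -[].
by apply: X_pos; case: fl => _ /(_ _ D0)[].
Qed.

Lemma flow_lower : exists2 c1 : R, 0 < c1 & forall t i, time_domain tau t -> c1 <= expR (log_coord (r t) 0 i).
Proof.
have [av vc] := constant_metric_log rs_cst.
exact: (log_flow_lower I_ge0 (flow_log fl) av erefl c_le0 vc area_eq D0).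
Qed.

Lemma flow_no_essential_singularity : ~ essential_singularity tau r.
Proof.
move=> [i [t [[Dt _] rt]]]; have [c1 c10 Hc1] := flow_lower.
have s0 : 0 < Num.sqrt c1 by rewrite sqrtr_gt0.
move/cvgr_lt : rt => /(_ _ s0)[n _ /(_ n (leqnn n)) /=]; rewrite ltNge => /negP; apply.
have rn : 0 < r (t n) 0 i by apply: X_pos; have [_ /(_ _ (Dt n))[]] := fl.
by rewrite -(ger0_norm (ltW rn)) -sqrtr_sqr ler_sqrt ?sqr_ge0 // -log_coordE // Hc1.
Qed.

Lemma flow_converges : tau = +oo%E -> converges_exp r rs.
Proof.
move=> tauE; have [av vc] := constant_metric_log rs_cst.
have [lam lam0 [K K0 HK]] := log_flow_decay I_ge0 (flow_log fl) av erefl c_le0 vc area_eq D0.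
exists (Num.sqrt K), (lam / 2); rewrite sqrtr_gt0; split => //; first by rewrite divr_gt0.
move=> t t0; have Dt : time_domain tau t by rewrite tauE; split => //; exact: ltry.
have -> : expR (- (lam / 2) * t) = Num.sqrt (expR (- lam * t)).
  have -> : - lam * t = 2 * (- (lam / 2) * t) by field.
  by rewrite expRM_natl sqrtr_sqr gtr0_norm // expR_gt0.
rewrite -sqrtrM ?(ltW K0) // /norm2 ler_sqrt ?mulr_ge0 ?expR_ge0 ?(ltW K0) //.
apply: le_trans (HK t Dt); rewrite !log_coordK; first last.
- by apply: X_pos; have [_ /(_ _ Dt)[]] := fl.
- by case: rs_cst => -[].
by rewrite le_eqVlt; apply/orP; left; apply/eqP; apply: eq_bigr => i _; rewrite !mxE.
Qed.

End Comparison.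
End GeneralFlow.

Lemma elen_cvg (S : Type) (F : set_system S) (FF : Filter F) (f : S -> 'rV[R]_N) r i j :
  (forall k, f s 0 k @[s --> F] --> r 0 k) -> elen I (f s) i j @[s --> F] --> elen I r i j.
Proof.
move=> fr; rewrite /elen.
apply: (@continuous_cvg _ _ _ _ _ (fun s => f s 0 i ^+ 2 + f s 0 j ^+ 2 + 2 * f s 0 i * f s 0 j * I [set i; j]%SET) Num.sqrt).
  exact: sqrt_continuous.
rewrite !expr2; under eq_cvg do rewrite !expr2.
apply: cvgD; first by apply: cvgD; apply: cvgM.
by apply: cvgM; [apply: cvgM => //; apply: cvgM => //; exact: cvg_cst|exact: cvg_cst].
Qed.

Lemma converges_exp_cvg (r : R -> 'rV[R]_N) (rs : 'rV[R]_N) (t : nat -> R) i :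
  converges_exp r rs -> times_to +oo%E t -> r (t n) 0 i @[n --> \oo] --> rs 0 i.
Proof.
move=> [K [lam [K0 lam0 H]]] [Dt /cvgeryP/cvgryPge too]; apply/cvgrPdist_lt => e e0.
(* Past this time K expR (- lam t) is below e; the added 1 makes the inequality strict. *)
have := too ((ln (K / e) + 1) / lam); apply: filterS => n Hn.
have Dn : 0 <= t n by have [] := Dt n.
have : `|r (t n) 0 i - rs 0 i| <= norm2 (r (t n) - rs).
  rewrite -sqrtr_sqr /norm2 ler_sqrt; last by apply: sumr_ge0 => j _; exact: sqr_ge0.
  by rewrite (bigD1 i) //= !mxE lerDl sumr_ge0 // => j _; exact: sqr_ge0.
rewrite distrC => /le_lt_trans; apply; apply: le_lt_trans (H _ Dn) _.
rewrite mulNr expRN ltr_pdivrMr ?expR_gt0 // mulrC -ltr_pdivrMr // -[ltLHS]lnK ?posrE ?divr_gt0 //.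
by rewrite ltr_expR; move: Hn; rewrite ler_pdivrMr // mulrC; lra.
Qed.

Lemma no_removable_at_infinity (r : R -> 'rV[R]_N) (rs : 'rV[R]_N) :
  admissible T I rs -> converges_exp r rs -> ~ removable_singularity T I +oo%E r.
Proof.
move=> [_ ars] cv [t [tt _ [i [j [k [f lim0]]]]]].
have cl a b : elen I (r (t n)) a b @[n --> \oo] --> elen I rs a b.
  by apply: elen_cvg => l; exact: converges_exp_cvg.
have lim1 : elen I (r (t n)) i j + elen I (r (t n)) i k - elen I (r (t n)) j k @[n --> \oo] -->
    elen I rs i j + elen I rs i k - elen I rs j k by apply: cvgB => //; exact: cvgD.
have E0 : 0 = elen I rs i j + elen I rs i k - elen I rs j k by exact: norm_cvg_unique lim0 lim1.
move/esym/eqP : E0; rewrite subr_eq0 => /eqP E.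
have := ars j k i; rewrite -/(is_face T j k i) -is_face_rot => /(_ f).
by rewrite (elenC _ _ j i) E ltxx.
Qed.

(** Some triangle inequality fails at the limit xT but holds at all earlier times, so its excess is
    both <= 0 and >= 0 in the limit. The bounds on the radii provide the compact box. *)
Lemma removable_at_endpoint (T0 : R) (r : R -> 'rV[R]_N) (c1 S : R) (xT : 'rV[R]_N) :
  flow_solution T (admissible T I) (Rcurv T I) T0%:E r -> 0 < c1 ->
  (forall t i, time_domain T0%:E t -> c1 <= expR (log_coord (r t) 0 i) <= S) ->
  ~ admissible T I (radii xT) ->
  (exists M : R, forall t i, time_domain T0%:E t -> `|log_coord (r t) 0 i - xT 0 i| <= M * (T0 - t)) ->
  removable_singularity T I T0%:E r.
Proof.
move=> [T0pos fl] c10 Hc nadm [M HM]; rewrite lte_fin in T0pos.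
(* At n = 0 this is time 0, which belongs to the domain. *)
pose t n : R := T0 * (1 - harmonic n).
have hn n : 0 < (harmonic n : R) <= 1.
  by rewrite /harmonic invr_gt0 ltr0n /= invf_le1 ?ltr0n // ler1n.
have Dt n : time_domain T0%:E (t n).
  have /andP[h0 h1] := hn n; split; first by rewrite mulr_ge0 ?(ltW T0pos) // subr_ge0.
  by rewrite lte_fin gtr_pMr // ltrBlDr ltrDl.
have tcvg : t n @[n --> \oo] --> T0.
  rewrite -[X in _ --> X]mulr1 -[X in _ * X]subr0; apply: cvgM; first exact: cvg_cst.
  by apply: cvgB; [exact: cvg_cst|exact: cvg_harmonic].
have pos n : positive_radii (r (t n)) by have [[]] := fl _ (Dt n).
have xcvg i : log_coord (r (t n)) 0 i @[n --> \oo] --> xT 0 i.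
  apply/cvgrPdist_le => e e0.
  have H : M * (T0 - t n) @[n --> \oo] --> M * (T0 - T0).
    by apply: cvgM; [exact: cvg_cst|apply: cvgB => //; exact: cvg_cst].
  rewrite subrr mulr0 in H; move/cvgr_le : H => /(_ _ e0); apply: filterS => n.
  by rewrite distrC; apply: le_trans; exact: HM.
have rcvg i : r (t n) 0 i @[n --> \oo] --> radii xT 0 i.
  rewrite (_ : (fun n => _) = (fun n => radii (log_coord (r (t n))) 0 i)); last first.
    by apply/funext => n; rewrite log_coordK.
  rewrite mxE; under eq_cvg do rewrite mxE.
  apply: (@continuous_cvg _ _ _ _ _ (fun n => log_coord (r (t n)) 0 i / 2) expR); first exact: continuous_expR.
  by apply: cvgM => //; exact: cvg_cst.
have cl a b : elen I (r (t n)) a b @[n --> \oo] --> elen I (radii xT) a b by exact: elen_cvg.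
have [i [j [k [f bad]]]] : exists i j k, is_face T i j k /\ ~~ (elen I (radii xT) i j < elen I (radii xT) i k + elen I (radii xT) k j).
  apply: contrapT => H; apply: nadm; split; first exact: radii_gt0.
  move=> i j k f; apply: contrapT => /negP bad; apply: H.
  by exists i, j, k.
exists t; split.
- split => //; apply/fine_cvgP; split; first exact: nearW.
  exact: tcvg.
- exists [set x | forall i, `[Num.sqrt c1, Num.sqrt S]%classic (x ord0 i)]; split.
  + by apply: (@rV_compact R N (fun=> `[Num.sqrt c1, Num.sqrt S]%classic)) => a; exact: segment_compact.
  + move=> x Hx a; have := Hx a; rewrite /= in_itv/= => /andP[h _]; apply: lt_le_trans h.
    by rewrite sqrtr_gt0.
  + move=> n a; have p0 : 0 < r (t n) 0 a := pos n a.
    rewrite /= in_itv/= -[X in _ <= X <= _](gtr0_norm p0) -sqrtr_sqr.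
    have /andP[h1 h2] := Hc (t n) a (Dt n); rewrite log_coordE // in h1 h2.
    by rewrite !ler_sqrt ?h1 ?h2 // ?sqr_ge0 // (le_trans (sqr_ge0 _) h2).
(* The side that is too long in the limit is ij, so k takes the place of the distinguished
   vertex. *)
exists k, i, j; split; first by rewrite -/(is_face T k i j) is_face_rot.
have lim1 : elen I (r (t n)) k i + elen I (r (t n)) k j - elen I (r (t n)) i j @[n --> \oo] -->
    elen I (radii xT) k i + elen I (radii xT) k j - elen I (radii xT) i j by apply: cvgB => //; exact: cvgD.
rewrite (_ : 0 = elen I (radii xT) k i + elen I (radii xT) k j - elen I (radii xT) i j) //.
apply/eqP; rewrite eq_sym subr_eq0 eq_le; apply/andP; split.
  by move: bad; rewrite -leNgt (elenC _ _ k i).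
rewrite -subr_ge0; have := limr_ge (cvgP _ lim1) (_ : \forall n \near \oo, 0 <= _).
rewrite (cvg_lim _ lim1) //; apply; apply: nearW => n.
rewrite /= subr_ge0; have [[_ H] _] := fl _ (Dt n).
by have := H i j k f; rewrite (elenC _ _ i k) => /ltW.
Qed.

End Flows.

(** * Evolution of the curvature *)

Section CurvatureEvolution.
Variables (R : realType) (N : nat) (T : triangulated_surface N) (I : {set 'I_N} -> R).
Hypothesis I_ge0 : weight_nonneg T I.
Implicit Types (i j k : 'I_N) (r x : 'rV[R]_N) (d : 'I_N -> R).

Definition curv_form x d i : R :=
  - \sum_(p : 'I_N * 'I_N | (p.1 < p.2)%N && ([set i; p.1; p.2]%SET \in faces T))
    tri_form (I [set p.1; p.2]%SET) (I [set p.2; i]%SET) (I [set i; p.1]%SET)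
      (x 0 i) (x 0 p.1) (x 0 p.2) (d i) (d p.1) (d p.2).

Lemma has_deriv_within_log_curv (A : set R) (u : R -> 'rV[R]_N) t d i : admissible T I (radii (u t)) ->
  (forall j, has_deriv_within A (fun s => u s 0 j) t (d j)) ->
  has_deriv_within A (fun s => log_curv T I (u s) i) t (curv_form (u t) d i).
Proof.
move=> /(admissible_radii I_ge0) au ud.
have H := has_deriv_withinD (has_deriv_within_cst A (2 * pi) t) (has_deriv_withinZ (c := -1)
  (has_deriv_within_sum (A := A) (t := t) (r := index_enum ('I_N * 'I_N)%type)
    (P := fun p => (p.1 < p.2)%N && ([set i; p.1; p.2]%SET \in faces T))
    (f := fun p s => face_angle I (u s) i p.1 p.2)
    (a := fun p => tri_form (I [set p.1; p.2]%SET) (I [set p.2; i]%SET) (I [set i; p.1]%SET)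
      (u t 0 i) (u t 0 p.1) (u t 0 p.2) (d i) (d p.1) (d p.2)) _)).
rewrite /curv_form -mulN1r -[X in has_deriv_within _ _ _ X]add0r.
rewrite (_ : (fun s => _) = (fun s => 2 * pi + -1 * \sum_(p : 'I_N * 'I_N | (p.1 < p.2)%N &&
   ([set i; p.1; p.2]%SET \in faces T)) face_angle I (u s) i p.1 p.2)); last first.
  by apply/funext => s; rewrite mulN1r.
apply: H => p /andP[_ f]; have [w1 w2 w3] := face_weight I_ge0 f.
apply: (@has_deriv_within_tri_angle R A (fun s => u s 0 i) (fun s => u s 0 p.1) (fun s => u s 0 p.2)) => //.
exact: (au _ _ _ f).
Qed.

Lemma tri_form_sum (J : Type) (s : seq J) (c a1 a2 a3 : J -> R) (w1 w2 w3 u1 u2 u3 : R) :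
  tri_form w1 w2 w3 u1 u2 u3 (\sum_(j <- s) c j * a1 j) (\sum_(j <- s) c j * a2 j) (\sum_(j <- s) c j * a3 j) =
  \sum_(j <- s) c j * tri_form w1 w2 w3 u1 u2 u3 (a1 j) (a2 j) (a3 j).
Proof.
elim: s => [|j s IHs]; rewrite ?big_nil ?big_cons; last by rewrite tri_form_lin IHs.
by rewrite /tri_form /angle_form; ring.
Qed.

Let unit_dir j i : R := (i == j)%:R.

Lemma curv_form_unit x d i : curv_form x d i = \sum_j d j * curv_form x (unit_dir j) i.
Proof.
have dE k : d k = \sum_j d j * unit_dir j k.
  rewrite (bigD1 k) //= /unit_dir eqxx mulr1 big1 ?addr0 // => j jk.
  by rewrite eq_sym (negPf jk) mulr0.
rewrite /curv_form; under [RHS]eq_bigr do rewrite mulrN mulr_sumr.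
rewrite sumrN exchange_big /=; congr (- _); apply: eq_bigr => p _.
by rewrite (dE i) (dE p.1) (dE p.2) tri_form_sum.
Qed.

Lemma curv_form_cst x (c : R) i : curv_form x (fun=> c) i = 0.
Proof.
rewrite /curv_form big1 ?oppr0 // => p /andP[_ f]; have [w1 w2 w3] := face_weight I_ge0 f.
exact: tri_form_cst.
Qed.

Lemma curv_form_local x i j : i != j -> [set i; j]%SET \notin edges T -> curv_form x (unit_dir j) i = 0.
Proof.
move=> ij nE; rewrite /curv_form big1 ?oppr0 // => p /andP[_ f].
have E1 : [set i; p.1]%SET \in edges T by exact: (is_face_edge f).
have f2 : is_face T i p.2 p.1 by rewrite -is_faceC.
have E2 : [set i; p.2]%SET \in edges T by exact: (is_face_edge f2).
have n1 : p.1 == j = false by apply/negbTE; apply: contraNneq nE => <-.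
have n2 : p.2 == j = false by apply/negbTE; apply: contraNneq nE => <-.
by rewrite /unit_dir (negPf ij) n1 n2 /= mulr0n /tri_form /angle_form; ring.
Qed.

Let line_coord x j s i : (s *: delta_mx 0 j + x : 'rV[R]_N) 0 i = s * unit_dir j i + x 0 i.
Proof. by rewrite !mxE eqxx. Qed.

Lemma derive_Kcurv_log x i j : admissible T I (radii x) ->
  derivable (Kcurv_log T I i) x (delta_mx 0 j) /\
  'D_(delta_mx 0 j) (Kcurv_log T I i) x = curv_form x (unit_dir j) i.
Proof.
move=> ax; pose l (s : R) : 'rV[R]_N := s *: delta_mx 0 j + x.
have l0 : l 0 = x by rewrite /l scale0r add0r.
have ld k : has_deriv_within setT (fun s => l s 0 k) 0 (unit_dir j k).
  rewrite (_ : (fun s => _) = (fun s => s * unit_dir j k + x 0 k)); last first.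
    by apply/funext => s; rewrite line_coord.
  have := has_deriv_withinD (has_deriv_withinM (has_deriv_within_id setT 0)
    (has_deriv_within_cst setT (unit_dir j k) 0)) (has_deriv_within_cst setT (x 0 k) 0).
  by rewrite mul1r mulr0 !addr0.
have al : admissible T I (radii (l 0)) by rewrite l0.
have /has_deriv_withinP H := has_deriv_within_log_curv (i := i) al ld; rewrite l0 in H.
(* [Kcurv_log] is built on [angle] and is known to agree with [log_curv] only at admissible radii;
   openness keeps a short piece of the line there. *)
have [d d0 Hd] := admissible_open I_ge0 ax.
have HK : has_deriv_within setT (fun s => Kcurv_log T I i (l s)) 0 (curv_form x (unit_dir j) i).
  apply/has_deriv_withinP => e /H[d' d'0 Hd']; exists (Num.min d d'); first by rewrite lt_min d0.
  move=> s _; rewrite lt_min subr0 => /andP[sd sd'].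
  have als : admissible T I (radii (l s)).
    apply: Hd => k; rewrite line_coord addrK normrM; apply: le_lt_trans sd.
    by rewrite /unit_dir; case: (k == j); rewrite ?normr1 ?mulr1 ?normr0 ?mulr0.
  rewrite /Kcurv_log !Kcurv_radii // l0; have := Hd' s Logic.I; rewrite subr0; exact.
have [dd <-] := has_deriv_within_is_derive (filterT : nbhs (0 : R) setT) HK.
have E : (fun h : R => h^-1 *: (Kcurv_log T I i (l (h *: 1 + 0)) - Kcurv_log T I i (l 0))) =
    (fun h => h^-1 *: (Kcurv_log T I i (h *: delta_mx 0 j + x) - Kcurv_log T I i x)).
  by apply/funext => h; rewrite addr0 l0 /l /GRing.scale/= mulr1.
split; first by move: dd; rewrite /derivable E.
by rewrite /derive E.
Qed.

Section AtMetric.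
Variable r : 'rV[R]_N.
Hypothesis ar : admissible T I r.
Let x := log_coord r.

Let rx : radii x = r. Proof. by apply: log_coordK; case: ar. Qed.
Let ax : admissible T I (radii x). Proof. by rewrite rx. Qed.

Lemma derivable_Kcurv_log i j : derivable (Kcurv_log T I i) (log_coord r) (delta_mx 0 j).
Proof. by have [] := derive_Kcurv_log i j ax. Qed.

Lemma dKduE i j : dKdu T I r i j = curv_form x (unit_dir j) i.
Proof. by have [] := derive_Kcurv_log i j ax. Qed.

Lemma sum_dKdu i (c : R) : \sum_j c * dKdu T I r i j = 0.
Proof.
under eq_bigr do rewrite dKduE.
by rewrite -(curv_form_unit x (fun=> c)) curv_form_cst.
Qed.

(** Scaling all radii leaves the angles unchanged, so each row of the Jacobian sums to zero and f i
    may be subtracted; entries of distinct non-adjacent vertices vanish. *)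
Lemma laplacianE (f : 'I_N -> R) i : laplacian T I r f i =
  (r 0 i ^+ 2)^-1 * \sum_(j | [set i; j]%SET \in edges T) (- dKdu T I r i j) * (f j - f i).
Proof.
rewrite /laplacian; congr (_ * _).
transitivity (\sum_j (- dKdu T I r i j) * (f j - f i)).
  under [RHS]eq_bigr do rewrite mulrBr.
  rewrite sumrB -[LHS]subr0; congr (_ - _).
  have := sum_dKdu i (- f i) => {1}<-; apply: eq_bigr => j _.
  by rewrite mulNr mulNr mulrC.
rewrite [RHS]big_mkcond; apply: eq_bigr => j _; case: ifP => // nE.
have [->|ij] := eqVneq i j; first by rewrite subrr mulr0.
by rewrite dKduE curv_form_local ?nE // oppr0 mul0r.
Qed.

End AtMetric.

(** Differentiate R_i = K_i expR (- u_i) with u_j' = Rav - R_j. In the derivative of K_i the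
    constant Rav is in the kernel, which leaves the Laplacian of R; the exponential contributes R_i
    (R_i - Rav). *)
Lemma ricci_flow_curvature tau (r : R -> 'rV[R]_N) : ricci_flow T I tau r ->
  forall t i, time_domain tau t ->
    has_deriv_within (time_domain tau) (fun s => Rcurv T I (r s) i) t
      (laplacian T I (r t) (Rcurv T I (r t)) i
       + Rcurv T I (r t) i * (Rcurv T I (r t) i - Rav T (r t))).
Proof.
move=> fl t i Dt; set D := time_domain tau.
have adm s : D s -> admissible T I (r s) by case: fl => _ /(_ s) H /H[].
have rE s : D s -> radii (log_coord (r s)) = r s by move=> /adm[rp _]; exact: log_coordK.
have C_ext x j : admissible T I x -> Rcurv T I x j = ext_Rcurv T I x j.
  move=> [xp ax]; have xE := log_coordK xp.
  by rewrite -xE Rcurv_radii ?ext_Rcurv_radii // xE.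
have uflow : log_flow T I tau (fun s => log_coord (r s)).
  by apply: (flow_log I_ge0 (X := admissible T I) (C := Rcurv T I)) fl => [x []|] //.
have fieldE j : log_field T I (log_coord (r t)) j = Rav T (r t) - Rcurv T I (r t) j.
  by rewrite -{2 3}(rE t Dt) Rav_radii Rcurv_radii // rE //; exact: adm.
have at_ : admissible T I (radii (log_coord (r t))) by rewrite rE //; exact: adm.
have HK := has_deriv_within_log_curv (i := i) at_ (fun j => @uflow t j Dt).
have HE := has_deriv_within_exp (has_deriv_withinZ (c := -1) (@uflow t i Dt)).
have H := has_deriv_withinM HK HE.
have RE s : D s -> log_curv T I (log_coord (r s)) i * expR (-1 * log_coord (r s) 0 i) = Rcurv T I (r s) i.
  by move=> Ds; rewrite -{3}(rE s Ds) Rcurv_radii ?rE //; [rewrite mulN1r expRN|exact: adm].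
apply: (has_deriv_within_eq RE Dt).
congr (has_deriv_within _ _ _ _) : H.
have pos : 0 < expR (log_coord (r t) 0 i) by exact: expR_gt0.
have rt : r t 0 i ^+ 2 = expR (log_coord (r t) 0 i) by rewrite log_coordE //; case: (adm t Dt).
have lapE : laplacian T I (r t) (Rcurv T I (r t)) i =
    curv_form (log_coord (r t)) (log_field T I (log_coord (r t))) i / expR (log_coord (r t) 0 i).
  rewrite /laplacian rt mulrC curv_form_unit; congr (_ / _).
  rewrite -[LHS]add0r -{1}(sum_dKdu (adm t Dt) i (Rav T (r t))) -big_split /=; apply: eq_bigr => j _.
  by rewrite fieldE (dKduE (adm t Dt)); ring.
rewrite lapE fieldE -(RE t Dt) mulN1r expRN; ring.
Qed.

End CurvatureEvolution.

(** * Long-time behaviour *)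

Section LongTimeBehaviour.
Variables (R : realType) (N : nat) (T : triangulated_surface N) (I : {set 'I_N} -> R).
Hypothesis I_ge0 : weight_nonneg T I.
Implicit Types (i j k : 'I_N) (x rs : 'rV[R]_N) (r : R -> 'rV[R]_N) (tau : \bar R).

Let Rcurv_ext x i : admissible T I x -> Rcurv T I x i = ext_Rcurv T I x i.
Proof.
by move=> [xp ax]; have xE := log_coordK xp; rewrite -xE Rcurv_radii ?ext_Rcurv_radii // xE.
Qed.

Let admissible_pos x : admissible T I x -> positive_radii x. Proof. by case. Qed.

Let positive_open x : positive_radii (radii x) -> exists2 d : R, 0 < d &
  forall y : 'rV[R]_N, (forall j, `|y 0 j - x 0 j| < d) -> positive_radii (radii y).
Proof. by exists 1 => // y _; exact: radii_gt0. Qed.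

(** At a limit point the field must vanish, or u_i would keep moving at nearly constant speed; a
    zero of the field is a constant curvature metric. *)
Lemma ricci_flow_limit r rs : ricci_flow T I +oo%E r -> admissible T I rs ->
  r t @[t --> +oo] --> rs -> constant_R_metric T I rs.
Proof.
move=> fl ars rcvg; split => //; set v := log_coord rs.
have uflow := flow_log I_ge0 admissible_pos Rcurv_ext fl.
have rs0 i : 0 < rs 0 i by case: ars.
have ucvg i : log_coord (r t) 0 i @[t --> +oo] --> v 0 i.
  rewrite mxE; under eq_cvg do rewrite mxE.
  apply: (@continuous_cvg _ _ _ _ _ (fun t => r t 0 i ^+ 2) (@ln R)).
    by apply: continuous_ln; rewrite exprn_gt0.
  have ri : r t 0 i @[t --> +oo] --> rs 0 i by apply: (continuous_cvg _ (@coord_continuous _ _ _ 0 i rs)).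
  by rewrite expr2; under eq_cvg do rewrite expr2; exact: cvgM.
suff f0 i : log_field T I v i = 0.
  exists (2 * pi * (euler_char T)%:~R / area v) => i; have vE : radii v = rs by exact: log_coordK.
  rewrite -vE Rcurv_radii ?vE //; apply/eqP; rewrite eq_sym -subr_eq0; apply/eqP; exact: f0.
have fcvg : log_field T I (log_coord (r t)) i @[t --> +oo] --> log_field T I v i by apply: cvg_log_field.
apply/eqP; apply: contrapT => /negP f0; set f := log_field T I v i in f0 fcvg.
have nf : 0 < `|f| by rewrite normr_gt0.
move/cvgrPdist_le : fcvg => /(_ (`|f| / 2)); rewrite divr_gt0 // => /(_ isT) n1.
move/cvgrPdist_le : (ucvg i) => /(_ 1 ltr01) n2.
have [A [_ HA]] := filterI n1 n2.
pose a := Num.max 0 A + 1.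
have aA : A < a by rewrite ltr_pwDr // le_max lexx orbT.
have a0 : 0 <= a by rewrite addr_ge0 // le_max lexx.
(* Over this time the predicted displacement is 8 with an error of at most 4, while both ends lie
   within 1 of the limit. *)
pose b := a + 8 / `|f|.
have ab : a <= b by rewrite lerDl divr_ge0.
have HD s : a <= s <= b -> time_domain +oo%E s.
  by move=> /andP[as_ _]; split; [exact: le_trans as_|exact: ltry].
have := has_deriv_within_dist (v := f) (m := `|f| / 2) ab HD (fun s Hs => @uflow s i (HD s Hs)).
have ba : b - a = 8 / `|f| by rewrite /b addrC addKr.
have E2 : `|f| / 2 * (b - a) = 4 by rewrite ba; field; rewrite gt_eqF.
have E1 : `|f * (b - a)| = 8.
  by rewrite normrM ba (ger0_norm (x := 8 / _)) ?divr_ge0 // mulrCA divff ?gt_eqF // mulr1.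
rewrite E2 => H; have {H} : `|log_coord (r b) 0 i - log_coord (r a) 0 i - f * (b - a)| <= 4.
  apply: H => s /andP[as_ _]; rewrite distrC; have [h _] := HA s (lt_le_trans aA as_); exact: h.
have [_ hb] := HA b (lt_le_trans aA ab); have [_ ha] := HA a aA; rewrite /= in ha hb.
move: ha hb; set ua := log_coord (r a) 0 i; set ub := log_coord (r b) 0 i => ha hb H.
have t1 := ler_distD (v 0 i) ub ua; rewrite distrC in hb.
have t2 := ler_normB (ub - ua) (ub - ua - f * (b - a)).
rewrite opprB addrC subrK E1 in t2.
by have := le_trans t2 (lerD (le_trans t1 (lerD hb ha)) H); lra.
Qed.

(** A finite maximal time yields a limit with positive radii outside the admissible space, that is,
    the removable singularity excluded by assumption. *)
Lemma ricci_flow_regular tau r rs : euler_char T <= 0 -> constant_R_metric T I rs ->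
  maximal_ricci_flow T I tau r -> norm2 rs = norm2 (r 0) ->
  ((tau < +oo)%E -> ~ removable_singularity T I tau r) -> tau = +oo%E.
Proof.
move=> chi rsc mfl nrm norem; have [fl _] := mfl; have [tau0 Hfl] := fl.
have [c1 c10 Hc1] := flow_lower I_ge0 admissible_pos Rcurv_ext rsc chi fl nrm.
case: tau tau0 mfl fl Hfl norem Hc1 => [T0| |] // tau0 mfl fl Hfl norem Hc1.
have uflow := flow_log I_ge0 admissible_pos Rcurv_ext fl.
have [xT [nX HM]] := maximal_flow_endpoint I_ge0 admissible_pos (@admissible_open _ _ _ _ I_ge0) Rcurv_ext mfl c10 Hc1.
have Hc t i : time_domain T0%:E t -> c1 <= expR (log_coord (r t) 0 i) <= area (log_coord (r 0)).
  by move=> Dt; rewrite Hc1 //= -(area_conserved I_ge0 uflow Dt); exact: area_ge.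
have rem := removable_at_endpoint fl c10 Hc nX HM.
by exfalso; apply: norem rem; exact: ltry.
Qed.

Lemma ext_flow_global tau r rs : euler_char T <= 0 -> constant_R_metric T I rs ->
  maximal_ext_ricci_flow T I tau r -> norm2 rs = norm2 (r 0) -> tau = +oo%E.
Proof.
move=> chi rsc mfl nrm; have [fl _] := mfl; have [tau0 Hfl] := fl.
have pp x : positive_radii x -> positive_radii x by [].
have ee x i : positive_radii x -> ext_Rcurv T I x i = ext_Rcurv T I x i by [].
have [c1 c10 Hc1] := flow_lower I_ge0 pp ee rsc chi fl nrm.
case: tau tau0 mfl fl Hfl Hc1 => [T0| |] // tau0 mfl fl Hfl Hc1.
have [xT [nX _]] := maximal_flow_endpoint I_ge0 pp positive_open ee mfl c10 Hc1.
by exfalso; apply: nX; exact: radii_gt0.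
Qed.

Lemma ricci_flow_no_essential tau r rs : euler_char T <= 0 -> constant_R_metric T I rs ->
  ricci_flow T I tau r -> norm2 rs = norm2 (r 0) -> ~ essential_singularity tau r.
Proof.
move=> chi rsc fl nrm.
exact: (flow_no_essential_singularity I_ge0 admissible_pos Rcurv_ext rsc chi fl nrm).
Qed.

Lemma ricci_flow_converges r rs : euler_char T <= 0 -> constant_R_metric T I rs ->
  ricci_flow T I +oo%E r -> norm2 rs = norm2 (r 0) -> converges_exp r rs.
Proof.
move=> chi rsc fl nrm.
exact: (flow_converges I_ge0 admissible_pos Rcurv_ext rsc chi fl nrm erefl).
Qed.

Lemma ext_flow_converges r rs : euler_char T <= 0 -> constant_R_metric T I rs ->
  flow_solution T (@positive_radii R N) (ext_Rcurv T I) +oo%E r -> norm2 rs = norm2 (r 0) -> converges_exp r rs.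
Proof.
move=> chi rsc fl nrm.
apply: (flow_converges I_ge0 _ _ rsc chi fl nrm erefl) => //.
Qed.

End LongTimeBehaviour.

Unset Implicit Arguments.
Set Strict Implicit.

Theorem theorem1p3 (R : realType) (N : nat) (T : triangulated_surface N)
    (I : {set 'I_N} -> R) (I_ge0 : weight_nonneg T I) :
  (* (1) *)
  ((forall r : 'rV[R]_N, admissible T I r ->
      (forall i j : 'I_N,
         derivable (Kcurv_log T I i) (log_coord r) (delta_mx 0 j)) /\
      (forall (f : 'I_N -> R) (i : 'I_N),
         laplacian T I r f i
         = (r 0 i ^+ 2)^-1 *
           \sum_(j | [set i; j]%SET \in edges T)
              (- dKdu T I r i j) * (f j - f i)))
   /\
   (forall (tau : \bar R) (r : R -> 'rV[R]_N), ricci_flow T I tau r ->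
      forall (t : R) (i : 'I_N), time_domain tau t ->
        has_deriv_within (time_domain tau) (fun s => Rcurv T I (r s) i) t
          (laplacian T I (r t) (Rcurv T I (r t)) i
           + Rcurv T I (r t) i * (Rcurv T I (r t) i - Rav T (r t)))))
  /\
  (* (2) *)
  (forall (r : R -> 'rV[R]_N) (rs : 'rV[R]_N),
     ricci_flow T I +oo%E r -> admissible T I rs ->
     r t @[t --> +oo] --> rs ->
     (exists r' : 'rV[R]_N, constant_R_metric T I r') /\
     constant_R_metric T I rs)
  /\
  (* (3) *)
  (euler_char T <= 0 ->
   forall rs : 'rV[R]_N, constant_R_metric T I rs ->
     (forall (tau : \bar R) (r : R -> 'rV[R]_N),
        ricci_flow T I tau r -> norm2 rs = norm2 (r 0) ->
        ~ essential_singularity tau r) /\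
     (forall (tau : \bar R) (r : R -> 'rV[R]_N),
        maximal_ricci_flow T I tau r -> norm2 rs = norm2 (r 0) ->
        ((tau < +oo)%E -> ~ removable_singularity T I tau r) ->
        [/\ tau = +oo%E, converges_exp r rs &
            ~ removable_singularity T I +oo%E r]))
  /\
  (* (4) *)
  (euler_char T <= 0 ->
   forall rs : 'rV[R]_N, constant_R_metric T I rs ->
     forall (tau : \bar R) (r : R -> 'rV[R]_N),
       maximal_ext_ricci_flow T I tau r -> norm2 (r 0) = norm2 rs ->
       tau = +oo%E /\ converges_exp r rs).
Proof.
split; [split|split; [|split]].
- move=> r ar; split => [i j|f i]; first exact: derivable_Kcurv_log.
  exact: laplacianE.
- exact: ricci_flow_curvature.
- move=> r rs fl ars rcvg; have rsc := ricci_flow_limit I_ge0 fl ars rcvg.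
  by split => //; exists rs.
- move=> chi rs rsc; split => tau r fl nrm; first exact: (ricci_flow_no_essential I_ge0 chi rsc fl nrm).
  move=> norem; have tauE := ricci_flow_regular I_ge0 chi rsc fl nrm norem.
  rewrite tauE in fl; have cv := ricci_flow_converges I_ge0 chi rsc fl.1 nrm.
  split => //; apply: no_removable_at_infinity cv; by case: rsc.
- move=> chi rs rsc tau r fl /esym nrm.
  have tauE := ext_flow_global I_ge0 chi rsc fl nrm.
  rewrite tauE in fl; split => //; exact: (ext_flow_converges I_ge0 chi rsc fl.1 nrm).
Qed.
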